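(* For almost all quadruples $(a,c,d,r)\in(0,\infty)^4$ (with respect to Lebesgue measure) the following properties hold for the system $$(S)\qquad\begin{cases}u_t+u_{xxx}+av_{xxx}=0&\text{in }\mathbb R\times\mathbb T,\\ cv_t+rv_x+v_{xxx}+du_{xxx}=0&\text{in }\mathbb R\times\mathbb T,\\ u(0)=u_0,\quad v(0)=v_0&\text{in }\mathbb T.\end{cases}$$ (i) Given any $(u_0,v_0)\in H:=L^2(\mathbb T)\times L^2(\mathbb T)$, the system $(S)$ has a unique solution $(u,v)\in C_b(\mathbb R,H)$, and the linear map $(u_0,v_0)\mapsto(u,v)$ is continuous from $H$ into $C_b(\mathbb R,H)$. (ii) The energy of the solution, defined by $$E(t):=\|(u,v)(t)\|_H^2=\int_{\mathbb T}|u(t,x)|^2+\frac{ac}{d}|v(t,x)|^2\,dx,$$ does not depend on $t\in\mathbb R$. (iii) For every solution and every $x_0\in\mathbb T$ the functions $u(\cdot,x_0)$ and $v(\cdot,x_0)$ are well defined in $L^2_{\rm loc}(\mathbb R)$. (iv) For every non-degenerate bounded interval $I$ there exist two positive constants $\alpha,\beta$ such that $$\alpha E\le\int_I|u(t,x_0)|^2+|v(t,x_0)|^2\,dt\le\beta E$$ for all solutions of $(S)$ and for all $x_0\in\mathbb T$.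
   Context: $\mathbb T=\mathbb R/2\pi\mathbb Z$ is the circle. $C_b(\mathbb R,H)$ is the Banach space of bounded continuous functions $\mathbb R\to H$ with the uniform norm. $H$ is endowed with the norm $\|(z_1,z_2)\|_H^2=\int_{\mathbb T}|z_1|^2+\frac{ac}{d}|z_2|^2\,dx$. The differential equations are understood in the sense of distributions on $\mathbb R\times\mathbb T$. The functions $u(\cdot,x_0),v(\cdot,x_0)$ are defined by evaluating the Fourier series in $x$ at $x_0$: if $u(t,x)=\sum_{k\in\mathbb Z}\hat u_k(t)e^{ikx}$, then $u(\cdot,x_0):=\sum_{k\in\mathbb Z}\hat u_k(\cdot)e^{ikx_0}$, and ''well defined in $L^2_{\rm loc}(\mathbb R)$'' means that this series converges in $L^2_{\rm loc}(\mathbb R)$; similarly for $v$. *)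

(* Defs.v *)
From HB Require Import structures.
From mathcomp Require Import all_boot all_order all_algebra.
From mathcomp Require Import complex.
From mathcomp Require Import all_classical all_reals all_analysis.

Set Implicit Arguments.
Unset Strict Implicit.
Unset Printing Implicit Defensive.

Import Order.TTheory GRing.Theory Num.Theory.
Import numFieldNormedType.Exports.

Local Open Scope classical_set_scope.
Local Open Scope ring_scope.
Local Open Scope complex_scope.

(* [R[i]] carries no measurable structure, so measurability
   and integration of complex-valued functions are componentwise. *)

Section complex_functions.
Context {R : realType}.
Local Notation mu := (@lebesgue_measure R).
Implicit Types (D : set R) (f : R -> R[i]).

Definition abs2 (z : R[i]) : R := complex.Re z ^+ 2 + complex.Im z ^+ 2.

Definition expi (y : R) : R[i] := cos y +i* sin y.

Definition cintegral D f : R[i] :=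
  (\int[mu]_(x in D) complex.Re (f x))%R +i* (\int[mu]_(x in D) complex.Im (f x))%R.

Definition L2 D f : Prop :=
  [/\ measurable_fun D (fun x => complex.Re (f x)),
      measurable_fun D (fun x => complex.Im (f x))
    & mu.-integrable D (fun x => (abs2 (f x))%:E)].

(* Fundamental domain of R/2piZ: a function on the circle is represented by a
   function on the line of which only the values on [0, 2pi[ matter. *)
Definition circle : set R := `[0, 2 * pi[%classic.

End complex_functions.

Section energy_space.
Context {R : realType}.
Local Notation mu := (@lebesgue_measure R).

(* Elements of H are represented by pairs of functions; equality in H is [eqH],
   i.e. almost everywhere equality on the circle. *)
Definition state : Type := ((R -> R[i]) * (R -> R[i]))%type.

Definition inH (z : state) : Prop := L2 circle z.1 /\ L2 circle z.2.

Definition eqH (z z' : state) : Prop :=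
  {ae mu, forall x, circle x -> z.1 x = z'.1 x /\ z.2 x = z'.2 x}.

Definition combH (k : R[i]) (z z' : state) : state :=
  (fun x => k * z.1 x + z'.1 x, fun x => k * z.2 x + z'.2 x).

Definition subH (z z' : state) : state :=
  (fun x => z.1 x - z'.1 x, fun x => z.2 x - z'.2 x).

Definition sqnormH (a c d : R) (z : state) : R :=
  (\int[mu]_(x in circle) (abs2 (z.1 x) + a * c / d * abs2 (z.2 x)))%R.

Definition normH (a c d : R) (z : state) : R := Num.sqrt (sqnormH a c d z).

Definition trajectory : Type := R -> state.

Definition inCb (a c d : R) (w : trajectory) : Prop :=
  [/\ forall t, inH (w t),
      forall t, normH a c d (subH (w s) (w t)) @[s --> t] --> (0 : R)
    & exists M : R, forall t, normH a c d (w t) <= M].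

Definition normCb (a c d : R) (w : trajectory) : R :=
  sup (range (fun t => normH a c d (w t))).

Definition energy (a c d : R) (w : trajectory) (t : R) : R :=
  sqnormH a c d (w t).

End energy_space.

Section distributions.
Context {R : realType}.
Implicit Types (phi : R * R -> R) (u : R -> R -> R[i]).

Definition dt phi : R * R -> R := 'D_((1, 0) : R * R) phi.
Definition dx phi : R * R -> R := 'D_((0, 1) : R * R) phi.

(* [true] stands for the time derivative, [false] for the space derivative. *)
Definition partials (s : seq bool) phi : R * R -> R :=
  foldr (fun b psi => if b then dt psi else dx psi) phi s.

Definition smooth phi : Prop :=
  forall s : seq bool,
    [/\ continuous (partials s phi),
        forall z, derivable (partials s phi) z ((1, 0) : R * R)
      & forall z, derivable (partials s phi) z ((0, 1) : R * R)].

Definition test_function phi : Prop :=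
  [/\ smooth phi,
      forall t x, phi (t, x + 2 * pi) = phi (t, x)
    & exists M : R, forall t x, M < `|t| -> phi (t, x) = 0].

(* For u continuous in t with values in L^2 of the circle, the inner integral
   is a continuous function of t, so the iterated integral makes sense for any
   choice of representatives. *)
Definition pairing u phi : R[i] :=
  cintegral setT (fun t => cintegral circle (fun x => u t x * (phi (t, x))%:C)).

Definition dist_dt u phi : R[i] := - pairing u (dt phi).
Definition dist_dx (n : nat) u phi : R[i] :=
  (-1) ^+ n * pairing u (iter n dx phi).

Definition solution (a c d r : R) (z : state) (w : trajectory) : Prop :=
  let u t := (w t).1 in
  let v t := (w t).2 in
  [/\ inCb a c d w,
      forall phi, test_function phi ->
        dist_dt u phi + dist_dx 3 u phi + a%:C * dist_dx 3 v phi = 0,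
      forall phi, test_function phi ->
        c%:C * dist_dt v phi + r%:C * dist_dx 1 v phi + dist_dx 3 v phi
          + d%:C * dist_dx 3 u phi = 0
    & eqH (w 0) z].

End distributions.

Section traces.
Context {R : realType}.
Local Notation mu := (@lebesgue_measure R).

Definition fourier_coef (f : R -> R[i]) (k : int) : R[i] :=
  (2 * pi)^-1%:C * cintegral circle (fun x => f x * expi (- (k%:~R * x))).

(* The sum over - m <= k <= n. *)
Definition fourier_sum (u : R -> R -> R[i]) (m n : nat) (x0 t : R) : R[i] :=
  \sum_(j < (m + n).+1)
    fourier_coef (u t) (j%:Z - m%:Z) * expi ((j%:Z - m%:Z)%:~R * x0).

(* [g] represents u(., x0): the two-sided Fourier series of u at x0 converges
   to [g] in L^2_loc. *)
Definition is_trace (u : R -> R -> R[i]) (x0 : R) (g : R -> R[i]) : Prop :=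
  forall p q : R,
    [/\ L2 `[p, q]%classic g,
        forall m n, L2 `[p, q]%classic (fourier_sum u m n x0)
      & (\int[mu]_(t in `[p, q]%classic)
           (abs2 (fourier_sum u mn.1 mn.2 x0 t - g t))%:E)%E
          @[mn --> (\oo, \oo)] --> (0 : \bar R)%E].

End traces.

Section well_posedness.
Context {R : realType}.

Definition well_posed (a c d r : R) : Prop :=
  exists S : state -> @trajectory R,
    [/\ forall z, inH z -> solution a c d r z (S z) /\
          forall w, solution a c d r z w -> forall t, eqH (w t) (S z t),
        forall k z z', inH z -> inH z' ->
          forall t, eqH (S (combH k z z') t) (combH k (S z t) (S z' t))
      & forall z, inH z -> forall e : R, 0 < e -> exists2 del : R, 0 < del &
          forall z', inH z' -> normH a c d (subH z' z) < del ->
            normCb a c d (fun t => subH (S z' t) (S z t)) < e].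

End well_posedness.

(* Main.v *)
Require Import Defs.
From HB Require Import structures.
From mathcomp Require Import all_boot all_order all_algebra.
From mathcomp Require Import complex.
From mathcomp Require Import all_classical all_reals all_analysis.
From mathcomp Require Import measurable_realfun zify ring lra.
Import Order.TTheory GRing.Theory Num.Theory.
Import numFieldNormedType.Exports.
Local Open Scope classical_set_scope.
Local Open Scope ring_scope.

Set Implicit Arguments.
Unset Strict Implicit.
Unset Printing Implicit Defensive.

(* On the k-th Fourier mode the system is a 2x2 linear system of ordinary
   differential equations, whose matrix has two real eigenvalues k^3 lam(r/k^2) and
   eigenvectors orthogonal for the energy. Testing a solution against f(t) cos(kx)
   and f(t) sin(kx) thus determines its Fourier coefficients; conversely, truncated
   Fourier series solve the system exactly and converge uniformly in time.
   The traces are then almost periodic sums over two branches of frequencies, each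
   close to a multiple of k^3, hence with gaps tending to infinity. For the high
   modes Ingham's inequality with a Hann window applies on any interval, and the two
   branches are separated because the ratio v/u has different limits on them. The
   remaining finitely many modes are added one at a time by Haraux's averaging
   argument, which only requires all the frequencies to be distinct. This fails on
   countably many algebraic hypersurfaces only. *)

(** * Square integrable functions *)

Section complex_l2.
Context {R : realType}.
Local Notation mu := (@lebesgue_measure R).
Local Notation intble D f := (mu.-integrable D (EFin \o f)).
Local Notation C := (R[i]).
Local Notation cre := (@complex.Re R).
Local Notation cim := (@complex.Im R).
Implicit Types (D : set R) (f g : R -> C).

(** The constants of the trace estimates may depend neither on the data nor on [x0]. They are
    therefore obtained for finite sums of exponentials, uniformly in the finite set of modes, and
    only then passed to the limit; evaluation at [x0] multiplies both amplitudes of mode k by the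
    unimodular number e^(i k x0), which changes neither their moduli nor the ratio v/u. The mode k =
    0 shapes the formulation: both its frequencies vanish while the mean values of u and v are
    independent, so it is one frequency carrying an arbitrary pair of amplitudes. This is why
    observability is stated for pairs of sums tied by a relation between amplitudes, void at k = 0,
    and not for scalar sums. The exclusion of a d = 1 has its own origin: there one of the two
    limits of frequency / k^3 vanishes, that branch grows only linearly in k, and its gaps stay
    bounded. The other exclusions say, through resultants and hence without square roots, that no
    two modes share a frequency. *)

Lemma abs2_ge0 (z : C) : 0 <= abs2 z.
Proof. by rewrite addr_ge0 ?sqr_ge0. Qed.

Lemma abs2M (y z : C) : abs2 (y * z) = abs2 y * abs2 z.
Proof. by case: y => a b; case: z => c d; rewrite /abs2 /=; ring. Qed.

Lemma abs2_0 : abs2 (0 : C) = 0.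
Proof. by rewrite /abs2 /= expr0n addr0. Qed.

Lemma abs2_1 : abs2 (1 : C) = 1.
Proof. by rewrite /abs2 /= expr0n expr1n addr0. Qed.

Lemma abs2N (z : C) : abs2 (- z) = abs2 z.
Proof. by case: z => a b; rewrite /abs2 /=; ring. Qed.

Lemma abs2_conj (z : C) : abs2 (z^*%C) = abs2 z.
Proof. by case: z => a b; rewrite /abs2 /=; ring. Qed.

Lemma abs2_real (x : R) : abs2 (x%:C)%C = x ^+ 2.
Proof. by rewrite /abs2 /= expr0n addr0. Qed.

Lemma abs2_eq0 (z : C) : abs2 z = 0 -> z = 0.
Proof.
case: z => a b; rewrite /abs2 /= => /eqP.
rewrite paddr_eq0 ?sqr_ge0// !sqrf_eq0 => /andP[/eqP -> /eqP ->].
by [].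
Qed.

Lemma abs2_expi (y : R) : abs2 (expi y) = 1.
Proof. by rewrite /abs2 /expi /= cos2Dsin2. Qed.

Lemma expi0 : expi (0 : R) = 1.
Proof. by rewrite /expi cos0 sin0. Qed.

Lemma expiD (x y : R) : expi (x + y) = expi x * expi y.
Proof.
by rewrite /expi cosD sinD; apply/eqP; rewrite eq_complex /= eqxx /= addrC.
Qed.

Lemma expiN (y : R) : expi (- y) = (expi y)^*%C.
Proof. by rewrite /expi cosN sinN. Qed.

Lemma abs2D_le (y z : C) : abs2 (y + z) <= 2 * abs2 y + 2 * abs2 z.
Proof.
case: y => a b; case: z => c d; rewrite /abs2 /=.
have := sqr_ge0 (a - c); have := sqr_ge0 (b - d); nra.
Qed.

Lemma Re_sqr_le_abs2 (z : C) : cre z ^+ 2 <= abs2 z.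
Proof. by rewrite lerDl sqr_ge0. Qed.

Lemma Im_sqr_le_abs2 (z : C) : cim z ^+ 2 <= abs2 z.
Proof. by rewrite lerDr sqr_ge0. Qed.

Lemma mulcJ_abs2 (z : C) : z * z^*%C = (abs2 z)%:C%C.
Proof. by case: z => a b; apply/eqP; rewrite eq_complex /abs2 /=; apply/andP; split; apply/eqP; ring. Qed.

Lemma creD (y z : C) : cre (y + z) = cre y + cre z. Proof. by case: y; case: z. Qed.
Lemma cimD (y z : C) : cim (y + z) = cim y + cim z. Proof. by case: y; case: z. Qed.
Lemma creB (y z : C) : cre (y - z) = cre y - cre z. Proof. by case: y; case: z. Qed.
Lemma cimB (y z : C) : cim (y - z) = cim y - cim z. Proof. by case: y; case: z. Qed.
Lemma creM (y z : C) : cre (y * z) = cre y * cre z - cim y * cim z.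
Proof. by case: y; case: z. Qed.
Lemma cimM (y z : C) : cim (y * z) = cre y * cim z + cim y * cre z.
Proof. by case: y => a b; case: z. Qed.

Lemma complexP (y z : C) : cre y = cre z -> cim y = cim z -> y = z.
Proof. by case: y => a b; case: z => c d /= -> ->. Qed.

Definition cintegrable D f :=
  intble D (fun x => cre (f x)) /\ intble D (fun x => cim (f x)).

Lemma integrableZlR D (k : R) (f : R -> R) : measurable D ->
  intble D f -> intble D (fun x => k * f x).
Proof. by move=> mD fi; have := @integrableZl _ _ R mu D mD k _ fi; exact: eq_integrable. Qed.

Lemma integrableDR D (f g : R -> R) : measurable D ->
  intble D f -> intble D g -> intble D (fun x => f x + g x).
Proof. by move=> mD fi gi; have := @integrableD _ _ R mu D mD _ _ fi gi; exact: eq_integrable. Qed.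

Lemma integrableBR D (f g : R -> R) : measurable D ->
  intble D f -> intble D g -> intble D (fun x => f x - g x).
Proof. by move=> mD fi gi; have := @integrableB _ _ R mu D mD _ _ fi gi; exact: eq_integrable. Qed.

Lemma cintegrableD D f g : measurable D -> cintegrable D f -> cintegrable D g ->
  cintegrable D (fun x => f x + g x).
Proof.
move=> mD [f1 f2] [g1 g2]; split.
  by have := integrableDR mD f1 g1; apply: eq_integrable => // x _ /=; rewrite creD.
by have := integrableDR mD f2 g2; apply: eq_integrable => // x _ /=; rewrite cimD.
Qed.

Lemma cintegrableZ D (k : C) f : measurable D -> cintegrable D f ->
  cintegrable D (fun x => k * f x).
Proof.
move=> mD [f1 f2]; split.
  have := integrableBR mD (integrableZlR (cre k) mD f1) (integrableZlR (cim k) mD f2).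
  by apply: eq_integrable => // x _ /=; rewrite creM.
have := integrableDR mD (integrableZlR (cre k) mD f2) (integrableZlR (cim k) mD f1).
by apply: eq_integrable => // x _ /=; rewrite cimM.
Qed.

Lemma cintegralD D f g : measurable D -> cintegrable D f -> cintegrable D g ->
  cintegral D (fun x => f x + g x) = cintegral D f + cintegral D g.
Proof.
move=> mD [f1 f2] [g1 g2]; apply: complexP; rewrite ?creD ?cimD /cintegral /=.
  by rewrite -RintegralD//; apply: eq_Rintegral => x _; rewrite creD.
by rewrite -RintegralD//; apply: eq_Rintegral => x _; rewrite cimD.
Qed.

Lemma cintegralZ D (k : C) f : measurable D -> cintegrable D f ->
  cintegral D (fun x => k * f x) = k * cintegral D f.
Proof.
move=> mD [f1 f2]; apply: complexP; rewrite ?creM ?cimM /cintegral /=.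
  rewrite -!RintegralZl// -RintegralB//; do ?exact: integrableZlR.
  by apply: eq_Rintegral => x _; rewrite creM.
rewrite -!RintegralZl// -RintegralD//; do ?exact: integrableZlR.
by apply: eq_Rintegral => x _; rewrite cimM.
Qed.

Lemma eq_cintegral D f g : {in D, f =1 g} -> cintegral D f = cintegral D g.
Proof.
by move=> fg; rewrite /cintegral; congr (_ +i* _)%C;
  apply: eq_Rintegral => x xD; rewrite fg.
Qed.

Lemma eq_cintegrable D f g : measurable D -> {in D, f =1 g} -> cintegrable D f -> cintegrable D g.
Proof.
move=> mD fg [f1 f2]; split.
  by apply: eq_integrable f1 => // x xD /=; rewrite fg.
by apply: eq_integrable f2 => // x xD /=; rewrite fg.
Qed.

Lemma cintegrable0 D : cintegrable D (fun=> 0).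
Proof. by split; exact: integrable0. Qed.

Lemma cintegral0 D : cintegral D (fun=> 0) = 0.
Proof.
by rewrite /cintegral /Rintegral /= !integral0.
Qed.

Lemma cintegrable_sum D (I : Type) (s : seq I) (F : I -> R -> C) : measurable D ->
  (forall i, cintegrable D (F i)) -> cintegrable D (fun x => \sum_(i <- s) F i x).
Proof.
move=> mD Fi; elim: s => [|i s IH].
  by apply: eq_cintegrable (cintegrable0 D) => // x _; rewrite big_nil.
by apply: eq_cintegrable (cintegrableD mD (Fi i) IH) => // x _; rewrite big_cons.
Qed.

Lemma cintegral_sum D (I : Type) (s : seq I) (F : I -> R -> C) : measurable D ->
  (forall i, cintegrable D (F i)) ->
  cintegral D (fun x => \sum_(i <- s) F i x) = \sum_(i <- s) cintegral D (F i).
Proof.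
move=> mD Fi; elim: s => [|i s IH].
  rewrite big_nil -[RHS](cintegral0 D).
  by apply: eq_cintegral => x _; rewrite big_nil.
rewrite big_cons -IH -cintegralD//; last exact: cintegrable_sum.
by apply: eq_cintegral => x _; rewrite big_cons.
Qed.

Lemma measurable_abs2 D f : measurable D ->
  measurable_fun D (fun x => cre (f x)) -> measurable_fun D (fun x => cim (f x)) ->
  measurable_fun D (fun x => abs2 (f x)).
Proof. by move=> mD mr mi; apply: measurable_funD; apply: measurable_funX. Qed.

Lemma le_integrableR D (f g : R -> R) : measurable D -> measurable_fun D f ->
  (forall x, D x -> `|f x| <= g x) -> intble D g -> intble D f.
Proof.
move=> mD mf fg; apply: le_integrable => //; first exact/measurable_EFinP.
by move=> x Dx /=; rewrite lee_fin (le_trans (fg _ Dx))// ler_norm.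
Qed.

Definition nrm2 D f : R := (\int[mu]_(x in D) abs2 (f x))%R.

Lemma nrm2_ge0 D f : 0 <= nrm2 D f.
Proof. by apply: Rintegral_ge0 => x _; exact: abs2_ge0. Qed.

Lemma L2D D f g : measurable D -> L2 D f -> L2 D g -> L2 D (fun x => f x + g x).
Proof.
move=> mD [mrf mif fi] [mrg mig gi].
have mr : measurable_fun D (fun x => cre (f x + g x)).
  apply: (eq_measurable_fun (fun x => cre (f x) + cre (g x))).
    by move=> x _; rewrite creD.
  exact: measurable_funD.
have mi : measurable_fun D (fun x => cim (f x + g x)).
  apply: (eq_measurable_fun (fun x => cim (f x) + cim (g x))).
    by move=> x _; rewrite cimD.
  exact: measurable_funD.
split => //.
apply: (@le_integrableR D _ (fun x => 2 * abs2 (f x) + 2 * abs2 (g x))) => //.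
- exact: measurable_abs2.
- by move=> x _; rewrite ger0_norm ?abs2_ge0// abs2D_le.
- by apply: integrableDR => //; exact: integrableZlR.
Qed.

Lemma L2Z D (k : C) f : measurable D -> L2 D f -> L2 D (fun x => k * f x).
Proof.
move=> mD [mrf mif fi].
split => //.
- apply: (eq_measurable_fun (fun x => cre k * cre (f x) - cim k * cim (f x))).
    by move=> x _; rewrite creM.
  by apply: measurable_funB; apply: measurable_funM => //; exact: measurable_cst.
- apply: (eq_measurable_fun (fun x => cre k * cim (f x) + cim k * cre (f x))).
    by move=> x _; rewrite cimM.
  by apply: measurable_funD; apply: measurable_funM => //; exact: measurable_cst.
- have := integrableZlR (abs2 k) mD fi.
  by apply: eq_integrable => // x _ /=; rewrite abs2M.
Qed.

Lemma eq_L2 D f g : measurable D -> {in D, f =1 g} -> L2 D f -> L2 D g.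
Proof.
move=> mD fg [m1 m2 i]; split.
- by apply: eq_measurable_fun m1 => x xD; rewrite fg.
- by apply: eq_measurable_fun m2 => x xD; rewrite fg.
- by apply: eq_integrable i => // x xD /=; rewrite fg.
Qed.

Lemma L2N D f : measurable D -> L2 D f -> L2 D (fun x => - f x).
Proof.
move=> mD fD; apply: eq_L2 (L2Z (-1) mD fD) => // x _; by rewrite mulN1r.
Qed.

Lemma L2B D f g : measurable D -> L2 D f -> L2 D g -> L2 D (fun x => f x - g x).
Proof. by move=> mD fD gD; apply: L2D => //; apply: L2N. Qed.

Lemma L20 D : measurable D -> L2 D (fun=> 0 : C).
Proof.
move=> mD; split; rewrite /=; do ?exact: measurable_cst.
have i0 : mu.-integrable D (cst 0) by exact: integrable0.
by apply: eq_integrable i0 => // x _; rewrite /= abs2_0.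
Qed.

Lemma L2_subset D D' f : measurable D -> measurable D' -> D `<=` D' ->
  L2 D' f -> L2 D f.
Proof.
move=> mD mD' DD' [m1 m2 i]; split.
- exact: measurable_funS m1.
- exact: measurable_funS m2.
- exact: (@integrableS _ _ R mu D' D) i.
Qed.

Lemma L2_bounded D f (M : R) : measurable D -> (mu D < +oo)%E ->
  measurable_fun D (fun x => cre (f x)) -> measurable_fun D (fun x => cim (f x)) ->
  (forall x, D x -> abs2 (f x) <= M) -> L2 D f.
Proof.
move=> mD fD m1 m2 fM; split=> //.
apply: (@le_integrableR D _ (fun=> M)) => //.
- exact: measurable_abs2.
- by move=> x Dx; rewrite ger0_norm ?abs2_ge0// fM.
- by apply: measurable_bounded_integrable => //; exact: bounded_cst.
Qed.

Lemma L2_conj D f : L2 D f -> L2 D (fun x => (f x)^*%C).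
Proof.
have re_conj (z : C) : cre (z^*%C) = cre z by case: z.
have im_conj (z : C) : cim (z^*%C) = - cim z by case: z.
move=> [m1 m2 i]; split.
- by apply: eq_measurable_fun m1 => x _; rewrite re_conj.
- apply: (eq_measurable_fun (\- (fun x => cim (f x)))).
    by move=> x _; rewrite /= im_conj.
  exact: measurable_funN.
- rewrite (_ : (fun _ => _) = (fun x => (abs2 (f x))%:E))//.
  by apply/funext => x; rewrite abs2_conj.
Qed.

Lemma cintegrable_L2M D f g : measurable D -> L2 D f -> L2 D g ->
  cintegrable D (fun x => f x * g x).
Proof.
move=> mD [mrf mif fi] [mrg mig gi].
have bnd (y z : C) : `|cre (y * z)| <= abs2 y + abs2 z /\
                     `|cim (y * z)| <= abs2 y + abs2 z.
  case: y => a b; case: z => c d; rewrite /abs2 /=.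
  have := sqr_ge0 (a - c); have := sqr_ge0 (b - d).
  have := sqr_ge0 (a - d); have := sqr_ge0 (b - c).
  have := sqr_ge0 (a + c); have := sqr_ge0 (b + d).
  have := sqr_ge0 (a + d); have := sqr_ge0 (b + c).
  have := sqr_ge0 a; have := sqr_ge0 b; have := sqr_ge0 c; have := sqr_ge0 d.
  by move=> *; split; rewrite ler_norml; apply/andP; split; nra.
have Fi := integrableDR mD fi gi.
split.
- apply: le_integrableR Fi => //; last by move=> x _; have [] := bnd (f x) (g x).
  apply: (eq_measurable_fun (fun x => cre (f x) * cre (g x) - cim (f x) * cim (g x))).
    by move=> x _; rewrite creM.
  by apply: measurable_funB; apply: measurable_funM.
- apply: le_integrableR Fi => //; last by move=> x _; have [] := bnd (f x) (g x).
  apply: (eq_measurable_fun (fun x => cre (f x) * cim (g x) + cim (f x) * cre (g x))).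
    by move=> x _; rewrite cimM.
  by apply: measurable_funD; apply: measurable_funM.
Qed.

Lemma nrm2Z D (k : C) f : measurable D -> L2 D f ->
  nrm2 D (fun x => k * f x) = abs2 k * nrm2 D f.
Proof.
move=> mD [_ _ i]; rewrite /nrm2 -RintegralZl//.
by apply: eq_Rintegral => x _; rewrite abs2M.
Qed.

Lemma nrm2N D f : nrm2 D (fun x => - f x) = nrm2 D f.
Proof. by apply: eq_Rintegral => x _; rewrite abs2N. Qed.

Lemma nrm2D D f g : measurable D -> L2 D f -> L2 D g ->
  nrm2 D (fun x => f x + g x) = nrm2 D f + nrm2 D g
    + 2 * cre (cintegral D (fun x => f x * (g x)^*%C)).
Proof.
move=> mD fD gD.
have [i1 _] := cintegrable_L2M mD fD (L2_conj gD).
have [_ _ f2] := fD; have [_ _ g2] := gD.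
rewrite /nrm2 /= -RintegralD// -RintegralZl// -RintegralD//; last 2 first.
- exact: integrableDR.
- exact: integrableZlR.
apply: eq_Rintegral => x _; case: (f x) => a b; case: (g x) => c d.
by rewrite /abs2 /=; ring.
Qed.

Lemma nrm2D_le D f g : measurable D -> L2 D f -> L2 D g ->
  nrm2 D (fun x => f x + g x) <= 2 * nrm2 D f + 2 * nrm2 D g.
Proof.
move=> mD fD gD; have [_ _ fgi] := L2D mD fD gD.
have [_ _ f2] := fD; have [_ _ g2] := gD.
rewrite /nrm2 -!RintegralZl// -RintegralD//; [|exact: integrableZlR..].
apply: le_Rintegral => //; first by apply: integrableDR => //; exact: integrableZlR.
by move=> x _; exact: abs2D_le.
Qed.

Lemma nrm2B_sym D f g : nrm2 D (fun x => f x - g x) = nrm2 D (fun x => g x - f x).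
Proof. by apply: eq_Rintegral => x _; rewrite -abs2N opprB. Qed.

(** The discriminant argument behind Cauchy-Schwarz, with [X] the squared modulus of the scalar
    product. The quadratic is smallest at t = 1/B, where it equals A - X/B. If B = 0 it is affine in
    t and takes the value - A - 2 at t = (A + 1)/X, which forces X = 0. *)
Lemma quadratic_ge0_discr (A B X : R) : 0 <= A -> 0 <= B -> 0 <= X ->
  (forall t, 0 <= A - 2 * t * X + t ^+ 2 * (X * B)) -> X <= A * B.
Proof.
move=> A0 B0 X0 h; have [B00|B00] := eqVneq B 0.
  have [->|Xn] := eqVneq X 0; first by rewrite mulr_ge0.
  have := h ((A + 1) / X); rewrite B00.
  have -> : 2 * ((A + 1) / X) * X = 2 * (A + 1) by rewrite mulrA divfK.
  by rewrite !mulr0; lra.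
have Bp : 0 < B by rewrite lt_def B00.
have := h B^-1.
have -> : B^-1 ^+ 2 * (X * B) = B^-1 * X by field.
rewrite -(@pmulr_rge0 _ B)//.
have -> : B * (A - 2 * B^-1 * X + B^-1 * X) = A * B - X by field.
by rewrite subr_ge0.
Qed.

(** The form is bilinear, so the square norm to expand is that of f - t Z conj(g), where Z is the
    integral itself: the cross term is then - 2 t |Z|^2, which is real. *)
Lemma cauchy_schwarz D f g : measurable D -> L2 D f -> L2 D g ->
  abs2 (cintegral D (fun x => f x * g x)) <= nrm2 D f * nrm2 D g.
Proof.
move=> mD fD gD; set Z := cintegral D _.
apply: quadratic_ge0_discr; rewrite ?nrm2_ge0 ?abs2_ge0// => t.
pose k : C := (- t)%:C%C * Z.
have cgD := L2_conj gD; have kD := L2Z k mD cgD.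
have := nrm2_ge0 D (fun x => f x + k * (g x)^*%C).
rewrite nrm2D// nrm2Z//.
have -> : nrm2 D (fun x => (g x)^*%C) = nrm2 D g.
  by apply: eq_Rintegral => x _; rewrite abs2_conj.
have -> : cintegral D (fun x => f x * (k * (g x)^*)^*)%C = k^*%C * Z.
  rewrite /Z -cintegralZ//; last exact: cintegrable_L2M.
  apply: eq_cintegral => x _.
  move: (f x) (g x) k {kD} => [a b] [c d] [e h].
  by apply: complexP => /=; ring.
have -> : k^*%C * Z = ((- t) * abs2 Z)%:C%C.
  by rewrite /k; move: (Z) => [a b]; apply: complexP; rewrite /abs2 /=; ring.
rewrite abs2M abs2_real /=; congr (_ <= _).
ring.
Qed.

Lemma L2_cintegrable D f : measurable D -> (mu D < +oo)%E -> L2 D f -> cintegrable D f.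
Proof.
move=> mD fD fL.
have h1 : L2 D (fun=> 1 : C).
  apply: (@L2_bounded D _ 1) => //=; do ?exact: measurable_cst.
  by move=> x _; rewrite abs2_1.
have := cintegrable_L2M mD fL h1.
by apply: eq_cintegrable => // x _; rewrite mulr1.
Qed.

Lemma continuous_integrable (h : R -> R) (p q : R) : continuous h ->
  intble `[p, q]%classic h.
Proof.
move=> ch; apply: continuous_compact_integrable; first exact: segment_compact.
exact: continuous_subspaceT.
Qed.

Definition ccontinuous f := continuous (fun x => cre (f x)) /\ continuous (fun x => cim (f x)).

Lemma ccontinuous_cintegrable f (p q : R) : ccontinuous f -> cintegrable `[p, q]%classic f.
Proof. by move=> [c1 c2]; split; exact: continuous_integrable. Qed.

Lemma continuous_abs2 f : ccontinuous f -> continuous (fun x => abs2 (f x)).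
Proof.
move=> [c1 c2] x; apply: cvgD; first by apply: (@cvgM R); exact: c1.
by apply: cvgM; exact: c2.
Qed.

Lemma ccontinuous_L2 f (p q : R) : ccontinuous f -> L2 `[p, q]%classic f.
Proof.
move=> cf; have [c1 c2] := cf; split.
- by apply: (@measurable_funS _ _ _ _ setT) => //; exact: continuous_measurable_fun.
- by apply: (@measurable_funS _ _ _ _ setT) => //; exact: continuous_measurable_fun.
- by apply: continuous_integrable; exact: continuous_abs2.
Qed.

(** Expand the square norm of (F n - g) + g; the cross term tends to 0 by Cauchy-Schwarz. *)
Lemma nrm2_cvg D (F : nat -> R -> C) g : measurable D -> (forall n, L2 D (F n)) -> L2 D g ->
  nrm2 D (fun x => F n x - g x) @[n --> \oo] --> 0 ->
  nrm2 D (F n) @[n --> \oo] --> nrm2 D g.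
Proof.
move=> mD FD gD h.
have E n : nrm2 D (F n) = nrm2 D (fun x => F n x - g x) + nrm2 D g
    + 2 * cre (cintegral D (fun x => (F n x - g x) * (g x)^*%C)).
  rewrite -nrm2D//; last exact: L2B.
  by apply: eq_Rintegral => x _; rewrite subrK.
have S : nrm2 D (fun x => F n x - g x) * nrm2 D g @[n --> \oo] --> 0.
  by rewrite -[X in _ --> X](mul0r (nrm2 D g)); apply: cvgMl.
have {}S : Num.sqrt (nrm2 D (fun x => F n x - g x) * nrm2 D g) @[n --> \oo] --> 0.
  rewrite -[X in _ --> X]sqrtr0; apply: (cvg_comp _ _ S).
  exact: sqrt_continuous.
have T : cre (cintegral D (fun x => (F n x - g x) * (g x)^*%C)) @[n --> \oo] --> 0.
  apply/norm_cvg0P; apply: squeeze_cvgr S; last exact: cvg_cst.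
  near=> n; rewrite normr_ge0 andTb -sqrtr_sqr ler_sqrt; last first.
    by rewrite mulr_ge0 ?nrm2_ge0.
  apply: (le_trans (Re_sqr_le_abs2 _)).
  apply: (le_trans (cauchy_schwarz mD (L2B mD (FD n) gD) (L2_conj gD))).
  rewrite (_ : nrm2 D (fun x => (g x)^*%C) = nrm2 D g)//.
  by apply: eq_Rintegral => x _; rewrite abs2_conj.
have L : (nrm2 D (fun x => F n x - g x) + nrm2 D g
    + 2 * cre (cintegral D (fun x => (F n x - g x) * (g x)^*%C))) @[n --> \oo] -->
    0 + nrm2 D g + 2 * 0.
  apply: cvgD; first by apply: cvgD => //; exact: cvg_cst.
  by apply: cvgMr.
by move: L; rewrite mulr0 addr0 add0r; under eq_fun do rewrite -E.
Unshelve. all: by end_near. Qed.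

End complex_l2.

(** * Completeness of L^2, simultaneously on an increasing sequence of domains *)

Section complex_l2_complete.
Context {R : realType}.
Local Notation mu := (@lebesgue_measure R).
Local Notation intble D f := (mu.-integrable D (EFin \o f)).
Local Notation C := (R[i]).
Local Notation cre := (@complex.Re R).
Local Notation cim := (@complex.Im R).

(* AM-GM turns geometric decay of the square integrals of the increments [a n]
   into summability of their integrals. *)
Lemma ae_summable_increments (D : set R) (a : nat -> R -> R) (b : nat -> R -> R) :
  measurable D -> (mu D < +oo)%E ->
  (forall n, measurable_fun D (a n)) ->
  (forall n, intble D (b n)) ->
  (forall n x, D x -> a n x ^+ 2 <= b n x) ->
  (forall n, \int[mu]_(x in D) b n x <= (4 ^+ n)^-1) ->
  {ae mu, forall x, D x -> cvgn (series (fun n => a n x))}.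
Proof.
move=> mD fD ma ib ab hb.
have fmD : mu D \is a fin_num by rewrite ge0_fin_numE.
pose f n x := `|a n x|%:E.
have mf n : measurable_fun D (f n).
  by apply/measurable_EFinP; apply: measurableT_comp.
have f0 n x : D x -> (0 <= f n x)%E by move=> _; rewrite lee_fin.
have amgm (y z e : R) : 0 < e -> y ^+ 2 <= z -> `|y| <= e + e^-1 * z.
  move=> e0 yz; rewrite -(ler_pM2l e0) mulrDr mulrA divff ?gt_eqF// mul1r.
  have : `|y| ^+ 2 <= z by rewrite real_normK ?num_real.
  have := sqr_ge0 (`|y| - e); have := normr_ge0 y; nra.
(* AM-GM with weight 2^-n bounds the n-th integral by 2^-n mu(D) + 2^n 4^-n, that is K / 2^n,
   written 2 K / 2^(n+1) to match the geometric series used below. *)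
pose K := fine (mu D) + 1.
have K0 : 0 <= K by rewrite addr_ge0// fine_ge0.
have intf n : (\int[mu]_(x in D) f n x <= ((2 * K) / (2 ^ n.+1)%:R)%:E)%E.
  have e0 : 0 < ((2 ^+ n)^-1 : R) by rewrite invr_gt0 exprn_gt0.
  have i1 : intble D (fun=> (2 ^+ n)^-1 : R).
    by apply: measurable_bounded_integrable => //; exact: bounded_cst.
  have i2 : intble D (fun x => (2 ^+ n)^-1^-1 * b n x) by exact: integrableZlR.
  have i3 := integrableDR mD i1 i2.
  apply: (@le_trans _ _ (\int[mu]_(x in D) ((2 ^+ n)^-1 + (2 ^+ n)^-1^-1 * b n x)%:E)%E).
    apply: ge0_le_integral => //.
    - by move=> x _; rewrite lee_fin.
    - exact: mf.
    - exact: measurable_int i3.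
    - by move=> x Dx; rewrite lee_fin amgm// ab.
  rewrite -[leLHS]fineK; last exact: (@integrable_fin_num _ _ _ mu _ mD _ i3).
  rewrite lee_fin.
  rewrite (_ : fine _ = \int[mu]_(x in D) ((2 ^+ n)^-1 + (2 ^+ n)^-1^-1 * b n x))//.
  rewrite RintegralD// RintegralZl// Rintegral_cst// invrK.
  have -> : 2 * K / (2 ^ n.+1)%:R = (2 ^+ n)^-1 * fine (mu D) + (2 ^+ n)^-1.
    by rewrite /K natrX exprS; field; rewrite expf_neq0.
  rewrite lerD2l; apply: (le_trans (ler_wpM2l _ (hb n))); first by rewrite exprn_ge0.
  rewrite (_ : 4 = 2 * 2) ?exprMn; last by rewrite -natrM.
  by rewrite invfM mulrA divff ?mul1r// expf_neq0.
pose A x := (\sum_(n <oo) f n x)%E.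
have mA : measurable_fun D A.
  by apply: ge0_emeasurable_sum => // n x Dx _; exact: f0.
have A0 x : (0 <= A x)%E by apply: nneseries_ge0 => n _ _; rewrite lee_fin.
have iA : mu.-integrable D A.
  apply/integrableP; split => //.
  under eq_integral do rewrite gee0_abs//.
  rewrite integral_nneseries//.
  apply: (@le_lt_trans _ _ (2 * K)%:E); last exact: ltry.
  apply: le_trans; last exact: (@epsilon_trick0 R (2 * K) xpredT (mulr_ge0 _ K0)).
  by apply: lee_nneseries => // n _ _; apply: integral_ge0 => x Dx; exact: f0.
have := @integrable_ae _ _ R mu D mD A iA.
apply: filterS => x h Dx; have {h} := h Dx => Afin.
apply: normed_cvg.
apply: nondecreasing_is_cvgn.
  by apply: nondecreasing_series => n _ _; exact: normr_ge0.
exists (fine (A x)) => _ [n _ <-] /=.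
rewrite -lee_fin fineK// /series /= -sumEFin.
exact: nneseries_lim_ge.
Qed.

(** Having one limit for all the domains is what makes the traces functions on the whole line. A
    diagonal subsequence has increments at most 4^-j on [D j], hence on all earlier domains, and so
    converges almost everywhere on each of them; Fatou's lemma then gives convergence in norm of the
    full sequence. *)
Lemma L2_complete (D : nat -> set R) (F : nat -> R -> C) :
  (forall j, measurable (D j)) -> (forall j, (mu (D j) < +oo)%E) ->
  (forall i j, (i <= j)%N -> D i `<=` D j) ->
  (forall n j, L2 (D j) (F n)) ->
  (forall j e, 0 < e -> exists N, forall n m, (N <= n)%N -> (N <= m)%N ->
     nrm2 (D j) (fun x => F n x - F m x) <= e) ->
  exists g, forall j, L2 (D j) g /\
    nrm2 (D j) (fun x => F n x - g x) @[n --> \oo] --> 0.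
Proof.
move=> mD fD ndD FD cF.
have /choice[N hN] : forall j, exists N, forall n m, (N <= n)%N -> (N <= m)%N ->
     nrm2 (D j) (fun x => F n x - F m x) <= (4 ^+ j)^-1.
  by move=> j; apply: cF; rewrite invr_gt0 exprn_gt0.
(* The maximum makes [nn] monotone and above [N]; the added j makes it tend to infinity. *)
pose nn j := (j + \max_(i < j.+1) N i)%N.
have nnN j : (N j <= nn j)%N.
  apply: leq_trans (leq_addl _ _).
  exact: (@leq_bigmax _ (fun i : 'I_j.+1 => N i) ord_max).
have nnS j : (nn j <= nn j.+1)%N.
  rewrite /nn leq_add// [X in (_ <= X)%N]big_ord_recr /=.
  by rewrite leq_maxl.
have nnj j : (j <= nn j)%N by exact: leq_addr.
pose h j := F (nn j).
have inc i j : (i <= j)%N -> nrm2 (D i) (fun x => h j.+1 x - h j x) <= (4 ^+ j)^-1.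
  move=> ij; apply: le_trans (hN j _ _ (leq_trans (nnN j) (nnS j)) (nnN j)).
  have [m1 m2 i3] := L2B (mD j) (FD (nn j.+1) j) (FD (nn j) j).
  have [m1' m2' i3'] := L2B (mD i) (FD (nn j.+1) i) (FD (nn j) i).
  rewrite /nrm2 /Rintegral fine_le//.
  - exact: (@integrable_fin_num _ _ _ mu _ (mD i) _ i3').
  - exact: (@integrable_fin_num _ _ _ mu _ (mD j) _ i3).
  - apply: ge0_subset_integral => //; last exact: ndD.
    + exact: mD.
    + exact: mD.
    + by apply/measurable_EFinP; apply: measurable_abs2 => //; exact: mD.
    + by move=> x _; rewrite lee_fin abs2_ge0.
have aecvg i (pr : C -> R) : (forall y z, pr (y - z) = pr y - pr z) ->
    (forall z, pr z ^+ 2 <= abs2 z) ->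
    (forall f, L2 (D i) f -> measurable_fun (D i) (fun x => pr (f x))) ->
    {ae mu, forall x, D i x -> cvgn (fun j => pr (h j x))}.
  move=> prB pra mpr.
  (* The increments are under control on [D i] only from index i on, hence the shift. *)
  have hL n : L2 (D i) (fun x => h (n + i).+1 x - h (n + i)%N x) by apply: L2B; [exact: mD|exact: FD..].
  have Hs : {ae mu, forall x, D i x ->
      cvgn (series (fun n => pr (h (n + i).+1 x - h (n + i)%N x)))}.
    apply: (@ae_summable_increments (D i) (fun n x => pr (h (n + i).+1 x - h (n + i)%N x))
      (fun n x => abs2 (h (n + i).+1 x - h (n + i)%N x)) (mD i) (fD i)) => [n|n|n x Dx|n].
    - exact: (mpr _ (hL n)).
    - by have [] := hL n.
    - exact: pra.
    - apply: (le_trans (inc _ _ (leq_addl n i))).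
      by rewrite lef_pV2 ?posrE ?exprn_gt0// ler_weXn2l ?ler1n// leq_addr.
  apply: (@filterS _ _ (ae_filter_ringOfSetsType mu) _ _ _ Hs) => x hx /hx{hx}.
  pose q n := pr (h (n + i)%N x).
  rewrite (_ : (fun n => pr _) = fun n => q n.+1 - q n); last first.
    by apply/funext => n; rewrite prB /q addSn.
  move=> hq.
  have E n : q n = q 0 + series (fun n => q n.+1 - q n) n.
    by rewrite /series /= telescope_sumr// addrC subrK.
  have /cvg_ex[l hl] : cvgn (fun n => q 0 + series (fun n => q n.+1 - q n) n).
    by apply: is_cvgD => //; exact: is_cvg_cst.
  apply/cvg_ex; exists l; rewrite -(cvg_shiftn i).
  by under eq_fun do rewrite -/(q _) E.
have Cre i := aecvg i cre (fun y z => creB y z) Re_sqr_le_abs2 (fun f fL => let: And3 a _ _ := fL in a).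
have Cim i := aecvg i cim (fun y z => cimB y z) Im_sqr_le_abs2 (fun f fL => let: And3 _ a _ := fL in a).
(* The upper limit exists everywhere and is measurable; it is the limit wherever the subsequence
   converges. *)
pose lm (pr : C -> R) x : R := fine (limn_esup (fun j => (pr (h j x))%:E)).
have mlm i (pr : C -> R) : (forall f, L2 (D i) f -> measurable_fun (D i) (fun x => pr (f x))) ->
    measurable_fun (D i) (lm pr).
  move=> mpr; apply: measurableT_comp => //.
  apply: measurable_fun_limn_esup => n.
  by apply/measurable_EFinP; apply: mpr; exact: FD.
have lmE (pr : C -> R) x : cvgn (fun j => pr (h j x)) -> pr (h j x) @[j --> \oo] --> lm pr x.
  move=> /cvg_ex[l hl].
  suff -> : lm pr x = l by [].
  rewrite /lm; have [_ ->] : (limn_einf (fun j => (pr (h j x))%:E) = l%:E) *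
      (limn_esup (fun j => (pr (h j x))%:E) = l%:E) => //.
  by apply: cvg_limn_einf_sup; apply: cvg_EFin => //; exact: nearW.
pose g x : C := (lm cre x +i* lm cim x)%C.
have mg1 i : measurable_fun (D i) (fun x => cre (g x)) by apply: mlm => f [].
have mg2 i : measurable_fun (D i) (fun x => cim (g x)) by apply: mlm => f [].
have mB i n : measurable_fun (D i) (fun x => abs2 (F n x - g x)).
  have [m1 m2 _] := FD n i.
  apply: measurable_abs2; first exact: mD.
    by under eq_fun do rewrite creB; exact: measurable_funB.
  by under eq_fun do rewrite cimB; exact: measurable_funB.
(* Fatou's lemma for [F n - h j] as j grows, with n fixed beyond the Cauchy index of e. *)
have fat i e : 0 < e -> exists N, forall n, (N <= n)%N ->
    (\int[mu]_(x in D i) (abs2 (F n x - g x))%:E <= e%:E)%E.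
  move=> e0; have [K hK] := cF i e e0; exists K => n Kn.
  pose G j x := (abs2 (F n x - h (j + K)%N x))%:E.
  have GL j : L2 (D i) (fun x => F n x - h (j + K)%N x) by apply: L2B; [exact: mD|exact: FD..].
  have mG j : measurable_fun (D i) (G j).
    by apply/measurable_EFinP; have [m1 m2 _] := GL j; apply: measurable_abs2 => //; exact: mD.
  have aeG : ae_eq mu (D i) (fun x => (abs2 (F n x - g x))%:E) (fun x => limn_einf (G ^~ x)).
    apply: (@filterS2 _ _ (ae_filter_ringOfSetsType mu) _ _ _ _ (Cre i) (Cim i)) => x h1 h2 Dx.
    have {}h1 := lmE _ _ (h1 Dx); have {}h2 := lmE _ _ (h2 Dx).
    have [-> _] : (limn_einf (G ^~ x) = (abs2 (F n x - g x))%:E) *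
      (limn_esup (G ^~ x) = (abs2 (F n x - g x))%:E) => //.
    apply: cvg_limn_einf_sup; apply: cvg_EFin; first exact: nearW.
    rewrite /G /comp /abs2; under eq_fun do rewrite /= creB cimB.
    rewrite creB cimB.
    rewrite -(cvg_shiftn K) in h1; rewrite -(cvg_shiftn K) in h2.
    have c1 : cre (F n x) - cre (h (j + K)%N x) @[j --> \oo] --> cre (F n x) - cre (g x).
      by apply: cvgB => //; exact: cvg_cst.
    have c2 : cim (F n x) - cim (h (j + K)%N x) @[j --> \oo] --> cim (F n x) - cim (g x).
      by apply: cvgB => //; exact: cvg_cst.
    by apply: cvgD; apply: cvgM.
  rewrite (ge0_ae_eq_integral _ _ _ _ _ aeG).
  - apply: le_trans (fatou mu (mD i) mG _) _.
      by move=> j x _; rewrite lee_fin abs2_ge0.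
    rewrite limn_einf_lim; apply: lime_le; first exact: is_cvg_einfs.
    apply: nearW => j; apply: ge_ereal_inf.
    exists (\int[mu]_(x in D i) G j x)%E; first by exists j => /=.
    have [_ _ iG] := GL j.
    rewrite -[leLHS]fineK; last exact: (@integrable_fin_num _ _ _ mu _ (mD i) _ iG).
    rewrite lee_fin; apply: hK => //.
    by rewrite (leq_trans _ (nnj _))// leq_addl.
  - exact: mD.
  - by apply/measurable_EFinP; exact: mB.
  - apply: (eq_measurable_fun (fun x => - limn_esup (fun j => - G j x))%E).
      by move=> x _; rewrite /limn_einf.
    apply: measurableT_comp => //; apply: measurable_fun_limn_esup => j.
    exact: measurableT_comp.
  - by move=> x _; rewrite lee_fin abs2_ge0.
  - move=> x _; rewrite limn_einf_lim; apply: lime_ge; first exact: is_cvg_einfs.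
    apply: nearW => j; apply: le_ereal_inf_tmp => _ [k /= _ <-].
    by rewrite lee_fin abs2_ge0.
have BL i : exists N, forall n, (N <= n)%N -> L2 (D i) (fun x => F n x - g x).
  have [N' hN'] := fat i 1 ltr01; exists N' => n /hN' hn.
  have [m1 m2 _] := FD n i.
  split.
  - by under eq_fun do rewrite creB; exact: measurable_funB.
  - by under eq_fun do rewrite cimB; exact: measurable_funB.
  - apply/integrableP; split; first by apply/measurable_EFinP; exact: mB.
    under eq_integral do rewrite gee0_abs ?lee_fin ?abs2_ge0//.
    by apply: (le_lt_trans hn); rewrite ltry.
exists g => i.
have gL : L2 (D i) g.
  have [N' /(_ N' (leqnn _)) hN'] := BL i.
  have := L2B (mD i) (FD N' i) hN'.
  by apply: eq_L2; [exact: mD|move=> x _; rewrite opprB addrC subrK].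
split => //.
apply/cvgrPdist_le => e e0; have [K hK] := fat i e e0.
exists K => // n /= Kn; rewrite sub0r normrN ger0_norm ?nrm2_ge0//.
have [_ _ ii] := L2B (mD i) (FD n i) gL.
rewrite -lee_fin /nrm2 /Rintegral fineK; first exact: hK.
exact: (@integrable_fin_num _ _ _ mu _ (mD i) _ ii).
Qed.

End complex_l2_complete.

(** * Fourier series on the circle *)

Section complex_calculus.
Context {R : realType}.
Local Notation mu := (@lebesgue_measure R).
Local Notation C := (R[i]).
Local Notation cre := (@complex.Re R).
Local Notation cim := (@complex.Im R).
Implicit Types (f g F G : R -> C) (x t : R).

Lemma is_deriveD1 (f g : R -> R) x (a b : R) : is_derive x (1 : R) f a ->
  is_derive x (1 : R) g b -> is_derive x (1 : R) (fun y => f y + g y) (a + b).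
Proof. by move=> fa gb; exact: is_deriveD. Qed.

Lemma is_deriveM1 (f g : R -> R) x (a b : R) : is_derive x (1 : R) f a ->
  is_derive x (1 : R) g b -> is_derive x (1 : R) (fun y => f y * g y) (a * g x + f x * b).
Proof.
move=> fa gb; have := is_deriveM fa gb.
by move=> /is_derive_eq; apply; rewrite /GRing.scale /= addrC mulrC.
Qed.

Lemma is_deriveN1 (f : R -> R) x (a : R) : is_derive x (1 : R) f a ->
  is_derive x (1 : R) (fun y => - f y) (- a).
Proof. by move=> fa; exact: is_deriveN. Qed.

Lemma is_derive_comp1 (f g : R -> R) x (a b : R) : is_derive x (1 : R) g b ->
  is_derive (g x) (1 : R) f a -> is_derive x (1 : R) (fun y => f (g y)) (a * b).
Proof.
move=> gb fa; have := @is_derive1_comp _ f g x a b fa gb.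
by move=> /is_derive_eq; apply; rewrite mulrC.
Qed.

Lemma is_derive_affine (w b x : R) : is_derive x (1 : R) (fun y => w * y + b) w.
Proof.
have h1 : is_derive x (1 : R) (fun _ : R => w) 0 by exact: is_derive_cst.
have h2 : is_derive x (1 : R) (fun y : R => y) 1 by exact: is_derive_id.
have h3 : is_derive x (1 : R) (fun _ : R => b) 0 by exact: is_derive_cst.
have := is_deriveD1 (is_deriveM1 h1 h2) h3.
by move=> /is_derive_eq; apply; rewrite mul0r mulr1 add0r addr0.
Qed.

Lemma is_derive_continuous (F f : R -> R) :
  (forall x, is_derive x (1 : R) F (f x)) -> continuous F.
Proof.
move=> dF x; apply: differentiable_continuous; apply/derivable1_diffP.
by have [] := dF x.
Qed.

Lemma FTC2_Rintegral (F f : R -> R) (p q : R) : (forall x, is_derive x (1 : R) F (f x)) ->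
  continuous f -> p <= q -> (\int[mu]_(x in `[p, q]) f x)%R = F q - F p.
Proof.
move=> dF cf; rewrite le_eqVlt => /predU1P[->|pq].
  by rewrite set_itv1 Rintegral_set1 subrr.
rewrite /Rintegral (@continuous_FTC2 R f F)//.
- exact: continuous_subspaceT.
- have cF := is_derive_continuous dF.
  split; first by move=> x _; have [] := dF x.
    by apply: cvg_at_right_filter; exact: cF.
  by apply: cvg_at_left_filter; exact: cF.
- by move=> x _; rewrite derive1E; have [_ ->] := dF x.
Qed.

Definition cderive F (l : C) x :=
  is_derive x (1 : R) (fun y => cre (F y)) (cre l) /\
  is_derive x (1 : R) (fun y => cim (F y)) (cim l).

Lemma cderive_cst (k : C) x : cderive (fun=> k) 0 x.
Proof. by split; exact: is_derive_cst. Qed.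

Lemma cderiveD F G (a b : C) x : cderive F a x -> cderive G b x ->
  cderive (fun y => F y + G y) (a + b) x.
Proof.
move=> [F1 F2] [G1 G2]; split.
  by under eq_fun do rewrite creD; rewrite creD; exact: is_deriveD1.
by under eq_fun do rewrite cimD; rewrite cimD; exact: is_deriveD1.
Qed.

Lemma cderiveM F G (a b : C) x : cderive F a x -> cderive G b x ->
  cderive (fun y => F y * G y) (a * G x + F x * b) x.
Proof.
move=> [F1 F2] [G1 G2]; split.
  under eq_fun do rewrite creM.
  have := is_deriveD1 (is_deriveM1 F1 G1) (is_deriveN1 (is_deriveM1 F2 G2)).
  by move=> /is_derive_eq; apply; rewrite creD !creM; ring.
under eq_fun do rewrite cimM.
have := is_deriveD1 (is_deriveM1 F1 G2) (is_deriveM1 F2 G1).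
by move=> /is_derive_eq; apply; rewrite cimD !cimM; ring.
Qed.

Lemma cderiveZ F (k a : C) x : cderive F a x -> cderive (fun y => k * F y) (k * a) x.
Proof.
move=> Fa; have := cderiveM (cderive_cst k x) Fa.
by rewrite mul0r add0r.
Qed.

Lemma cderive_expi (w b x : R) :
  cderive (fun y => expi (w * y + b)) ((0 +i* w)%C * expi (w * x + b)) x.
Proof.
split => /=.
  have := is_derive_comp1 (is_derive_affine w b x) (is_derive_cos _).
  by move=> /is_derive_eq; apply; ring.
have := is_derive_comp1 (is_derive_affine w b x) (is_derive_sin _).
by move=> /is_derive_eq; apply; ring.
Qed.

Lemma cderive_expiZ (w x : R) :
  cderive (fun y => expi (w * y)) ((0 +i* w)%C * expi (w * x)) x.
Proof.
have := cderive_expi w 0 x; rewrite addr0.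
by under eq_fun do rewrite addr0.
Qed.

Lemma cderive_continuous F f : (forall x, cderive F (f x) x) -> ccontinuous F.
Proof.
move=> dF; split.
  by apply: (is_derive_continuous (f := fun x => cre (f x))) => x; have [] := dF x.
by apply: (is_derive_continuous (f := fun x => cim (f x))) => x; have [] := dF x.
Qed.

Lemma ccontinuous_cst (k : C) : ccontinuous (fun=> k).
Proof. by split; exact: cst_continuous. Qed.

Lemma ccontinuousD F G : ccontinuous F -> ccontinuous G -> ccontinuous (fun x => F x + G x).
Proof.
move=> [F1 F2] [G1 G2]; split => x.
  by under eq_fun do rewrite creD; apply: cvgD; [exact: F1|exact: G1].
by under eq_fun do rewrite cimD; apply: cvgD; [exact: F2|exact: G2].
Qed.

Lemma ccontinuousM F G : ccontinuous F -> ccontinuous G -> ccontinuous (fun x => F x * G x).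
Proof.
move=> [F1 F2] [G1 G2]; split => x.
  under eq_fun do rewrite creM.
  by apply: cvgB; apply: cvgM; [exact: F1|exact: G1|exact: F2|exact: G2].
under eq_fun do rewrite cimM.
by apply: cvgD; apply: cvgM; [exact: F1|exact: G2|exact: F2|exact: G1].
Qed.

Lemma ccontinuousZ (k : C) F : ccontinuous F -> ccontinuous (fun x => k * F x).
Proof. by move=> cF; apply: ccontinuousM => //; exact: ccontinuous_cst. Qed.

Lemma ccontinuousB F G : ccontinuous F -> ccontinuous G -> ccontinuous (fun x => F x - G x).
Proof.
move=> cF cG; have := ccontinuousD cF (ccontinuousZ (-1) cG).
by under eq_fun do rewrite mulN1r.
Qed.

Lemma ccontinuous_sum (I : Type) (s : seq I) (F : I -> R -> C) :
  (forall i, ccontinuous (F i)) -> ccontinuous (fun y => \sum_(i <- s) F i y).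
Proof.
move=> cF; elim: s => [|i s IH].
  by under eq_fun do rewrite big_nil; exact: ccontinuous_cst.
under eq_fun do rewrite big_cons; exact: ccontinuousD.
Qed.

Lemma ccontinuous_expi (w b : R) : ccontinuous (fun x => expi (w * x + b)).
Proof. exact: (cderive_continuous (cderive_expi w b)). Qed.

Lemma ccontinuous_expiZ (w : R) : ccontinuous (fun x => expi (w * x)).
Proof. exact: (cderive_continuous (cderive_expiZ w)). Qed.

Lemma cFTC2 F f (p q : R) : (forall x, cderive F (f x) x) -> ccontinuous f ->
  p <= q -> cintegral `[p, q]%classic f = F q - F p.
Proof.
move=> dF [c1 c2] pq; apply: complexP; rewrite /cintegral /= ?creB ?cimB.
  by apply: (FTC2_Rintegral (F := fun x => cre (F x))) => // x; have [] := dF x.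
by apply: (FTC2_Rintegral (F := fun x => cim (F x))) => // x; have [] := dF x.
Qed.

Lemma imw_mul (w : R) : w != 0 -> (0 +i* w)%C * (0 -i* w^-1)%C = 1 :> C.
Proof. by move=> w0; apply: complexP => /=; rewrite ?mul0r ?mulr0 ?add0r ?addr0 ?mulrN ?mulfV// opprK. Qed.

Lemma cintegral_expi (w b p q : R) : w != 0 -> p <= q ->
  cintegral `[p, q]%classic (fun x => expi (w * x + b)) =
    (0 -i* w^-1)%C * (expi (w * q + b) - expi (w * p + b)).
Proof.
move=> w0 pq; rewrite mulrBr.
apply: (@cFTC2 (fun x => (0 -i* w^-1)%C * expi (w * x + b))) => //; last exact: ccontinuous_expi.
move=> x; have := cderiveZ (0 -i* w^-1)%C (cderive_expi w b x).
by rewrite mulrA [_ * (0 +i* w)%C]mulrC imw_mul// mul1r.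
Qed.

End complex_calculus.

(** * Fourier coefficients, Bessel's inequality and the Riesz-Fischer theorem *)

Section fourier_algebra.
Context {R : realType}.
Local Notation mu := (@lebesgue_measure R).
Local Notation C := (R[i]).
Local Notation cre := (@complex.Re R).
Local Notation cim := (@complex.Im R).
Local Notation circle := (@circle R).
Implicit Types (f g F G : R -> C) (x t : R) (k m : int) (s : seq int) (c : int -> C).

Definition fexp k x : C := expi (k%:~R * x).

Definition fsum s c x : C := \sum_(k <- s) c k * fexp k x.

Definition ints (m n : nat) : seq int := [seq j%:Z - m%:Z | j <- iota 0 (m + n).+1].

Lemma ints_uniq (m n : nat) : uniq (ints m n).
Proof.
rewrite map_inj_uniq ?iota_uniq// => i j /eqP.
by rewrite subr_eq subrK => /eqP[].
Qed.

Lemma mem_ints (m n : nat) k : (k \in ints m n) = (- m%:Z <= k <= n%:Z).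
Proof.
apply/mapP/idP => [[j]|/andP[h1 h2]].
  by rewrite mem_iota add0n ltnS => /andP[_ jmn] ->; lia.
exists (absz (k + m%:Z)); last by lia.
by rewrite mem_iota add0n ltnS; lia.
Qed.

Lemma big_ints (V : nmodType) (m n : nat) (H : int -> V) :
  \sum_(j < (m + n).+1) H (j%:Z - m%:Z) = \sum_(k <- ints m n) H k.
Proof. by rewrite /ints big_map -(big_mkord xpredT (fun j => H (j%:Z - m%:Z))) /index_iota subn0. Qed.

Lemma measurable_circle : measurable circle.
Proof. exact: measurable_itv. Qed.

Lemma pi2_gt0 : 0 < 2 * pi :> R.
Proof. by rewrite mulr_gt0// pi_gt0. Qed.

Lemma circle_lty : (mu circle < +oo)%E.
Proof. by rewrite /Defs.circle lebesgue_measure_itv /=; case: ifP => _; rewrite -?EFinB ltry. Qed.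

Hint Resolve measurable_circle circle_lty : core.

Lemma cintegral_circle f : cintegrable circle f ->
  cintegral circle f = cintegral `[0, 2 * pi]%classic f.
Proof.
by move=> [f1 f2]; rewrite /cintegral /Defs.circle !Rintegral_itv_bndo_bndc.
Qed.

Lemma ccontinuous_L2_circle f : ccontinuous f -> L2 circle f.
Proof.
move=> cf; apply: (@L2_subset R circle `[0, 2 * pi]%classic) => //.
  by move=> x /=; rewrite /circle /= !in_itv /= => /andP[-> /ltW ->].
exact: ccontinuous_L2.
Qed.

Lemma ccontinuous_circle f : ccontinuous f -> cintegrable circle f.
Proof. by move=> cf; apply: L2_cintegrable => //; exact: ccontinuous_L2_circle. Qed.

Lemma ccontinuous_fexp k : ccontinuous (fexp k).
Proof. exact: ccontinuous_expiZ. Qed.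

Lemma ccontinuous_fsum s c : ccontinuous (fsum s c).
Proof. by apply: ccontinuous_sum => k; apply: ccontinuousZ; exact: ccontinuous_fexp. Qed.

Lemma expi_2pi k : expi (k%:~R * (2 * pi)) = 1 :> C.
Proof.
have h (n : nat) : expi (n%:R * (2 * pi)) = 1 :> C.
  elim: n => [|n IH]; first by rewrite mul0r expi0.
  rewrite -natr1 mulrDl mul1r expiD IH mul1r /expi.
  by rewrite mulr_natl cos2pi sin2pi.
case: k => n; first exact: h.
by rewrite NegzE mulrNz mulNr expiN h; apply: complexP => /=; rewrite ?oppr0.
Qed.

Lemma cintegral_fexp k : cintegral circle (fexp k) = if k == 0 then (2 * pi)%:C%C else 0.
Proof.
rewrite cintegral_circle; last exact/ccontinuous_circle/ccontinuous_fexp.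
have [->|k0] := eqVneq k 0.
  rewrite (@eq_cintegral _ _ _ (fun=> 1)); last by move=> x _; rewrite /fexp mul0r expi0.
  rewrite (@cFTC2 _ (fun x => x%:C%C))//.
  - by rewrite subr0.
  - by move=> x; split => /=; [exact: is_derive_id|exact: is_derive_cst].
  - exact: ccontinuous_cst.
  - exact/ltW/pi2_gt0.
have kR : k%:~R != 0 :> R by rewrite intr_eq0.
rewrite (@eq_cintegral _ _ _ (fun x => expi (k%:~R * x + 0))); last by move=> x _; rewrite addr0.
rewrite cintegral_expi//; last exact/ltW/pi2_gt0.
by rewrite !addr0 expi_2pi mulr0 expi0 subrr mulr0.
Qed.

Lemma fexpD k m x : fexp (k + m) x = fexp k x * fexp m x.
Proof. by rewrite /fexp intrD mulrDl expiD. Qed.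

Lemma fexpN k x : fexp (- k) x = (fexp k x)^*%C.
Proof. by rewrite /fexp mulrNz mulNr expiN. Qed.

Lemma fexp0 x : fexp 0 x = 1.
Proof. by rewrite /fexp mul0r expi0. Qed.

Lemma abs2_fexp k x : abs2 (fexp k x) = 1.
Proof. exact: abs2_expi. Qed.

Lemma fourier_coefE f k : fourier_coef f k =
  (2 * pi)^-1%:C%C * cintegral circle (fun x => f x * fexp (- k) x).
Proof.
by congr (_ * _); apply: eq_cintegral => x _; rewrite /fexp mulrNz mulNr.
Qed.

Lemma cintegral_fourier_coef f k :
  cintegral circle (fun x => f x * fexp (- k) x) = (2 * pi)%:C%C * fourier_coef f k.
Proof.
rewrite fourier_coefE mulrA -rmorphM /= mulfV ?mul1r//.
by rewrite gt_eqF// pi2_gt0.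
Qed.

Lemma L2_fexp k : L2 circle (fexp k).
Proof. exact/ccontinuous_L2_circle/ccontinuous_fexp. Qed.

Lemma fourier_coefD f g k : L2 circle f -> L2 circle g ->
  fourier_coef (fun x => f x + g x) k = fourier_coef f k + fourier_coef g k.
Proof.
move=> fL gL; rewrite !fourier_coefE -mulrDr -cintegralD//.
- by congr (_ * _); apply: eq_cintegral => x _; rewrite mulrDl.
- exact: (cintegrable_L2M _ fL (L2_fexp _)).
- exact: (cintegrable_L2M _ gL (L2_fexp _)).
Qed.

Lemma fourier_coefZ (a : C) f k : L2 circle f ->
  fourier_coef (fun x => a * f x) k = a * fourier_coef f k.
Proof.
move=> fL; rewrite !fourier_coefE mulrCA -(cintegralZ a)//.
- by congr (_ * _); apply: eq_cintegral => x _; rewrite mulrA.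
- exact: (cintegrable_L2M _ fL (L2_fexp _)).
Qed.

Lemma fourier_coefB f g k : L2 circle f -> L2 circle g ->
  fourier_coef (fun x => f x - g x) k = fourier_coef f k - fourier_coef g k.
Proof.
move=> fL gL; rewrite -[- fourier_coef g k]mulN1r -fourier_coefZ// -fourier_coefD//.
  by have -> : (fun x => f x - g x) = (fun x => f x + -1 * g x) by apply/funext => x; rewrite mulN1r.
exact: L2Z.
Qed.

Lemma nrm2_fexp k : nrm2 circle (fexp k) = 2 * pi.
Proof.
rewrite /nrm2 (@eq_Rintegral _ _ _ _ _ (fun=> 1)); last by move=> x _; rewrite abs2_fexp.
rewrite Rintegral_cst; last exact: measurable_circle.
have mc : mu circle = (2 * pi)%:E.
  by rewrite /Defs.circle lebesgue_measure_itv /= lte_fin pi2_gt0 sube0.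
by rewrite mul1r; exact: (congr1 fine mc).
Qed.

(* Cauchy-Schwarz against [fexp (- k)], of square norm [2 pi]. *)
Lemma fourier_coef_le f k : L2 circle f ->
  2 * pi * abs2 (fourier_coef f k) <= nrm2 circle f.
Proof.
move=> fL; rewrite fourier_coefE abs2M abs2_real.
have := cauchy_schwarz measurable_circle fL (L2_fexp (- k)).
rewrite nrm2_fexp; set A := abs2 _; set B := nrm2 _ _ => h.
rewrite -(ler_pM2r pi2_gt0); apply: le_trans h; rewrite le_eqVlt; apply/orP; left; apply/eqP.
have fld (P : R) : P != 0 -> P * (P^-1 ^+ 2 * A) * P = A by move=> P0; field.
by apply: fld; rewrite gt_eqF// pi2_gt0.
Qed.

Lemma fourier_coef_fsum s c k : uniq s ->
  fourier_coef (fsum s c) k = if k \in s then c k else 0.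
Proof.
move=> us; rewrite fourier_coefE.
rewrite (@eq_cintegral _ _ _ (fun x => \sum_(j <- s) c j * fexp (j - k) x)); last first.
  move=> x _; rewrite /fsum mulr_suml; apply: eq_bigr => j _.
  by rewrite -mulrA -fexpD.
rewrite cintegral_sum//; last first.
  by move=> j; apply: cintegrableZ => //; exact/ccontinuous_circle/ccontinuous_fexp.
have E j : cintegral circle (fun x => c j * fexp (j - k) x) =
    if j == k then c k * (2 * pi)%:C%C else 0.
  rewrite cintegralZ//; last exact/ccontinuous_circle/ccontinuous_fexp.
  by rewrite cintegral_fexp subr_eq0; case: eqP => [->//|_]; rewrite mulr0.
under eq_bigr do rewrite E.
rewrite -big_mkcond /=; case: ifP => ks.
  rewrite -big_filter filter_pred1_uniq// big_seq1 mulrCA -rmorphM mulVf ?mulr1//.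
  by rewrite gt_eqF// pi2_gt0.
rewrite big_seq_cond big1 ?mulr0// => j /andP[js /eqP jk].
by rewrite -jk js in ks.
Qed.

(** Induction on the set of modes: the remainder over [s] still has the k-th coefficient of [f] when
    k is not in [s], and removing that mode lowers the square norm by 2 pi times the squared modulus
    of the coefficient. *)
Lemma nrm2_sub_fsum f s : uniq s -> L2 circle f ->
  nrm2 circle (fun x => f x - fsum s (fourier_coef f) x) =
  nrm2 circle f - 2 * pi * \sum_(k <- s) abs2 (fourier_coef f k).
Proof.
move=> + fL; elim: s => [|k s IH].
  move=> _; rewrite big_nil mulr0 subr0.
  by apply: eq_Rintegral => x _; rewrite /fsum big_nil subr0.
move=> /= /andP[ks us].
pose h x := f x - fsum s (fourier_coef f) x.
have sL : L2 circle (fsum s (fourier_coef f)).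
  exact/ccontinuous_L2_circle/ccontinuous_fsum.
have hL : L2 circle h by apply: L2B.
pose a := fourier_coef f k.
have hk : fourier_coef h k = a.
  by rewrite fourier_coefB// fourier_coef_fsum// (negbTE ks) subr0.
rewrite big_cons mulrDr opprD addrCA -IH// -/h.
rewrite (_ : nrm2 circle _ = nrm2 circle (fun x => h x + - a * fexp k x)); last first.
  by apply: eq_Rintegral => x _; rewrite /h /fsum big_cons; congr abs2; rewrite mulNr opprD addrA addrAC.
rewrite nrm2D//; last by apply: L2Z => //; exact: L2_fexp.
rewrite nrm2Z ?nrm2_fexp//; last exact: L2_fexp.
rewrite (_ : cintegral circle _ = (- a)^*%C * ((2 * pi)%:C%C * a)); last first.
  rewrite -hk -cintegral_fourier_coef -cintegralZ//.
    apply: eq_cintegral => x _; rewrite hk fexpN rmorphM /=.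
    by rewrite mulrCA mulrA.
  exact: (cintegrable_L2M _ hL (L2_fexp _)).
rewrite -/a abs2N.
have -> : cre ((- a)^*%C * ((2 * pi)%:C%C * a)) = - (2 * pi * abs2 a).
  by case: (a) => a1 a2; rewrite /abs2 /=; ring.
ring.
Qed.

Lemma bessel f s : uniq s -> L2 circle f ->
  2 * pi * \sum_(k <- s) abs2 (fourier_coef f k) <= nrm2 circle f.
Proof. by move=> us fL; rewrite -subr_ge0 -nrm2_sub_fsum// nrm2_ge0. Qed.

(** A trigonometric sum is its own partial Fourier sum, so the remainder in [nrm2_sub_fsum]
    vanishes. *)
Lemma nrm2_fsum s c : uniq s ->
  nrm2 circle (fsum s c) = 2 * pi * \sum_(k <- s) abs2 (c k).
Proof.
move=> us; have sL : L2 circle (fsum s c) by exact/ccontinuous_L2_circle/ccontinuous_fsum.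
have := nrm2_sub_fsum us sL.
have E k : k \in s -> fourier_coef (fsum s c) k = c k.
  by move=> ks; rewrite fourier_coef_fsum// ks.
rewrite (_ : nrm2 circle _ = 0).
  move=> /esym/eqP; rewrite subr_eq0 => /eqP ->; congr (_ * _).
  by rewrite !big_seq; apply: eq_bigr => k ks; rewrite E.
rewrite (_ : nrm2 _ _ = nrm2 circle (fun=> 0)).
  rewrite /nrm2 /Rintegral; under eq_integral do rewrite abs2_0.
  by rewrite integral0.
apply: eq_Rintegral => x _; congr abs2; apply/eqP; rewrite subr_eq0; apply/eqP.
by rewrite /fsum !big_seq; apply: eq_bigr => k ks; rewrite E.
Qed.

Lemma big_uniq_split (V : nmodType) (s1 s2 : seq int) (H : int -> V) :
  uniq s1 -> uniq s2 -> {subset s1 <= s2} ->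
  \sum_(k <- s2) H k = \sum_(k <- s1) H k + \sum_(k <- s2 | k \notin s1) H k.
Proof.
move=> u1 u2 s12; rewrite (bigID (mem s1)) /=; congr (_ + _).
rewrite -big_filter; apply: perm_big; apply: uniq_perm => //.
  exact: filter_uniq.
by move=> k; rewrite mem_filter andb_idr// => /s12.
Qed.

Lemma ints_subset (m n m' n' : nat) : (m <= m')%N -> (n <= n')%N ->
  {subset ints m n <= ints m' n'}.
Proof. by move=> mm nn k; rewrite !mem_ints => /andP[h1 h2]; apply/andP; split; lia. Qed.

(** The masses of the symmetric partial sums increase and are bounded, so the partial sums are
    Cauchy. A coefficient is a continuous functional by [fourier_coef_le], and that of the n-th
    partial sum is exactly [c k] once n >= |k|. *)
Lemma riesz_fischer c (B : R) :
  (forall s, uniq s -> \sum_(k <- s) abs2 (c k) <= B) ->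
  exists g, [/\ L2 circle g, forall k, fourier_coef g k = c k &
    nrm2 circle (fun x => fsum (ints n n) c x - g x) @[n --> \oo] --> 0].
Proof.
move=> cB.
pose S n := fsum (ints n n) c; pose A n := \sum_(k <- ints n n) abs2 (c k).
have SL n : L2 circle (S n) by exact/ccontinuous_L2_circle/ccontinuous_fsum.
have diff (n m : nat) : (m <= n)%N -> nrm2 circle (fun x => S n x - S m x) = 2 * pi * (A n - A m).
  move=> mn; have sub := ints_subset mn mn.
  rewrite (_ : nrm2 circle _ = nrm2 circle (fsum [seq k <- ints n n | k \notin ints m m] c)).
    rewrite nrm2_fsum ?filter_uniq ?ints_uniq// big_filter.
    by rewrite /A (big_uniq_split _ (ints_uniq m m) (ints_uniq n n) sub) [_ + _ - _]addrC addKr.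
  apply: eq_Rintegral => x _; congr abs2; rewrite /S /fsum big_filter.
  by rewrite (big_uniq_split _ (ints_uniq m m) (ints_uniq n n) sub) [_ + _ - _]addrC addKr.
have ndA : nondecreasing_seq A.
  move=> m n mn; rewrite -subr_ge0 -(pmulr_rge0 _ pi2_gt0) -diff//.
  exact: nrm2_ge0.
have cvA : cvgn A.
  apply: nondecreasing_is_cvgn => //; exists B => _ [n _ <-].
  by apply: cB; exact: ints_uniq.
have cau e : 0 < e -> exists N, forall n m : nat, (N <= n)%N -> (N <= m)%N ->
     nrm2 circle (fun x => S n x - S m x) <= e.
  move=> e0; have e1 : 0 < e / (2 * pi) by rewrite divr_gt0// pi2_gt0.
  have /cvg_ex[l hl] := cvA.
  have /cvgrPdist_le/(_ _ (divr_gt0 e1 (ltr0n _ 2)))[N _ hN] := hl.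
  have key (n m : nat) : (N <= n)%N -> (N <= m)%N -> (m <= n)%N ->
      nrm2 circle (fun x => S n x - S m x) <= e.
    move=> Nn Nm mn; rewrite diff// -ler_pdivlMl ?pi2_gt0// mulrC.
    have := hN n Nn; have := hN m Nm.
    rewrite !ler_norml => /andP[_ h1] /andP[h2 _].
    by move: h1 h2; rewrite /=; lra.
  exists N => n m Nn Nm; have [mn|/ltnW mn] := leqP m n; first exact: key.
  by rewrite nrm2B_sym; exact: key.
have [g hg] := @L2_complete R (fun=> circle) S (fun=> measurable_circle) (fun=> circle_lty)
  (fun _ _ _ _ h => h) (fun n _ => SL n) (fun _ => cau).
have {hg} [gL hg] := hg 0%N; exists g; split => // k.
apply/eqP; rewrite -subr_eq0; apply/eqP/abs2_eq0.
apply/eqP; rewrite eq_le abs2_ge0 andbT -(pmulr_rle0 _ pi2_gt0).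
apply/ler_addgt0Pl => e e0; rewrite addr0.
have /cvgrPdist_le/(_ _ e0)[N _ hN] := hg.
pose n := maxn N (absz k).
have := hN n (leq_maxl _ _); rewrite /= sub0r normrN ger0_norm ?nrm2_ge0//.
apply: le_trans.
have := fourier_coef_le k (L2B measurable_circle (SL n) gL).
rewrite fourier_coefB// fourier_coef_fsum ?ints_uniq// mem_ints ifT; last first.
  have := leq_maxr N (absz k); rewrite -/n; lia.
by rewrite -abs2N opprB.
Qed.

End fourier_algebra.

(** * Completeness of the trigonometric system and Parseval's identity *)

Section fourier_complete.
Context {R : realType}.
Local Notation mu := (@lebesgue_measure R).
Local Notation intble D f := (mu.-integrable D (EFin \o f)).
Local Notation C := (R[i]).
Local Notation cre := (@complex.Re R).
Local Notation cim := (@complex.Im R).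
Local Notation circle := (@circle R).
Hint Resolve measurable_circle circle_lty : core.
Implicit Types (f g : R -> C) (x : R).

Lemma bernoulli_le (t : R) (n : nat) : 0 <= t <= 1 -> 1 - n%:R * t <= (1 - t) ^+ n.
Proof.
move=> /andP[t0 t1]; elim: n => [|n IH]; first by rewrite mul0r subr0 expr0.
rewrite exprS -natr1; have n0 : 0 <= n%:R :> R by [].
apply: (@le_trans _ _ ((1 - t) * (1 - n%:R * t))); last first.
  by rewrite ler_wpM2l// subr_ge0.
have := mulr_ge0 n0 (sqr_ge0 t); nra.
Qed.

Lemma bernoulli_inv_le (t : R) (n : nat) : 0 <= t <= 1 -> (1 - t) ^+ n * (1 + n%:R * t) <= 1.
Proof.
move=> /andP[t0 t1]; elim: n => [|n IH]; first by rewrite mul0r addr0 expr0 mulr1.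
apply: le_trans IH; rewrite exprS -natr1 -mulrA mulrCA.
rewrite ler_wpM2l ?exprn_ge0 ?subr_ge0//.
have := mulr_ge0 (ler0n R n) (sqr_ge0 t); have := sqr_ge0 t; nra.
Qed.

(* The Brosowski-Deutsch polynomials, approximating the step at 1/2. *)
Definition step_poly (n : nat) (y : R) : R := (1 - y ^+ n) ^+ (2 ^ n).

Lemma step_poly_itv (n : nat) (y : R) : 0 <= y <= 1 -> 0 <= step_poly n y <= 1.
Proof.
move=> /andP[y0 y1]; have h : 0 <= y ^+ n <= 1 by rewrite exprn_ge0// exprn_ile1.
case/andP: h => h0 h1; rewrite exprn_ge0 ?subr_ge0// exprn_ile1// ?subr_ge0//.
by rewrite lerBlDr lerDl.
Qed.

(** Bernoulli's inequality bounds the polynomial below by 1 - (2 y)^n, and 2 y < 1. *)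
Lemma step_poly_cvg1 (y : R) : 0 <= y < 2^-1 -> step_poly n y @[n --> \oo] --> (1 : R).
Proof.
move=> /andP[y0 y1]; have y11 : y <= 1 by lra.
have L : (1 - (2 * y) ^+ n) @[n --> \oo] --> (1 - 0 : R).
  apply: cvgB; first exact: cvg_cst.
  by apply: cvg_expr; rewrite ger0_norm; lra.
rewrite subr0 in L.
apply: (squeeze_cvgr _ L (cvg_cst _)).
near=> n; apply/andP; split; last first.
  by have /andP[] := step_poly_itv n (introT andP (conj y0 y11)).
rewrite exprMn -natrX; apply: bernoulli_le.
by rewrite exprn_ge0// exprn_ile1.
Unshelve. all: by end_near. Qed.

(** Bernoulli's inequality in the form (1 - t)^N (1 + N t) <= 1, with t = y^n and N = 2^n, bounds
    the polynomial by (2 y)^-n, and 2 y > 1. *)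
Lemma step_poly_cvg0 (y : R) : 2^-1 < y <= 1 -> step_poly n y @[n --> \oo] --> (0 : R).
Proof.
move=> /andP[y0 y1]; have y2 : 0 < 2 * y by lra.
have yp : 0 <= y by lra.
have L : ((2 * y)^-1 ^+ n) @[n --> \oo] --> (0 : R).
  apply: cvg_expr; rewrite ger0_norm ?invr_ge0 ?(ltW y2)//.
  by rewrite invf_lt1//; lra.
apply: (squeeze_cvgr _ (cvg_cst _) L).
near=> n; have /andP[-> _] := step_poly_itv n (introT andP (conj yp y1)).
rewrite andTb exprVn -[leRHS]mul1r ler_pdivlMr ?exprn_gt0//.
have h : 0 <= y ^+ n <= 1 by rewrite exprn_ge0// exprn_ile1.
apply: le_trans (bernoulli_inv_le (2 ^ n) h).
rewrite ler_wpM2l//.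
  by have /andP[] := step_poly_itv n (introT andP (conj yp y1)).
by rewrite exprMn -natrX lerDr.
Unshelve. all: by end_near. Qed.

(** A frequency may occur several times in the list, so that products require no regrouping. *)
Definition trigpoly (T : R -> C) := exists l : seq (C * int),
  forall x, T x = \sum_(p <- l) p.1 * fexp p.2 x.

Lemma trigpoly_cst (k : C) : trigpoly (fun=> k).
Proof. by exists [:: (k, 0)] => x; rewrite big_seq1 fexp0 mulr1. Qed.

Lemma trigpoly_fexp (k : int) : trigpoly (fexp k).
Proof. by exists [:: (1, k)] => x; rewrite big_seq1 mul1r. Qed.

Lemma trigpolyD f g : trigpoly f -> trigpoly g -> trigpoly (fun x => f x + g x).
Proof. by move=> [l hl] [l' hl']; exists (l ++ l') => x; rewrite big_cat hl hl'. Qed.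

Lemma trigpolyM f g : trigpoly f -> trigpoly g -> trigpoly (fun x => f x * g x).
Proof.
move=> [l hl] [l' hl'].
exists [seq (p.1 * q.1, p.2 + q.2) | p <- l, q <- l'] => x.
rewrite big_allpairs_dep hl hl' mulr_suml; apply: eq_bigr => p _.
rewrite mulr_sumr; apply: eq_bigr => q _ /=.
by rewrite fexpD mulrACA.
Qed.

Lemma trigpolyX f (n : nat) : trigpoly f -> trigpoly (fun x => f x ^+ n).
Proof.
move=> hf; elim: n => [|n IH].
  by under eq_fun do rewrite expr0; exact: trigpoly_cst.
by under eq_fun do rewrite exprS; exact: trigpolyM.
Qed.

Lemma trigpoly_ortho f T : L2 circle f -> (forall k, fourier_coef f k = 0) -> trigpoly T ->
  cintegral circle (fun x => f x * T x) = 0.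
Proof.
move=> fL f0 [l hl].
rewrite (@eq_cintegral _ _ _ (fun x => \sum_(p <- l) p.1 * (f x * fexp p.2 x))); last first.
  by move=> x _; rewrite hl mulr_sumr; apply: eq_bigr => p _; rewrite mulrCA.
have ifp (k : int) : cintegrable circle (fun x => f x * fexp k x).
  by apply: cintegrable_L2M => //; exact: L2_fexp.
rewrite cintegral_sum//; last by move=> p; apply: cintegrableZ.
apply: big1 => p _; rewrite cintegralZ//.
by rewrite -[p.2]opprK cintegral_fourier_coef f0 !mulr0.
Qed.

(** A trigonometric polynomial with values in [0, 1] that equals 1/2 at both ends of the arc from 0
    to b, lies below 1/2 inside and above 1/2 outside. Composing it with the step polynomials
    approximates the indicator of the arc. *)
Definition arc_weight (b x : R) : R := (2 - cos (x - b / 2) + cos (b / 2)) / 4.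

Lemma arc_weight_itv (b x : R) : 0 <= arc_weight b x <= 1.
Proof.
have := cos_le1 (x - b / 2); have := cos_geN1 (x - b / 2).
have := cos_le1 (b / 2); have := cos_geN1 (b / 2).
by rewrite /arc_weight => *; apply/andP; split; lra.
Qed.

Lemma cos_decreasing (x y : R) : 0 <= y -> y < x -> x <= pi -> cos x < cos y.
Proof.
by move=> y0 yx xpi; rewrite ltr_cos ?in_itv //=; apply/andP; split; lra.
Qed.

Lemma arc_weight_lt (b x : R) : 0 < b < 2 * pi -> 0 < x < b -> arc_weight b x < 2^-1.
Proof.
move=> /andP[b0 b2] /andP[x0 xb].
suff : cos (b / 2) < cos (x - b / 2) by rewrite /arc_weight; lra.
rewrite -[cos (x - b / 2)]cos_norm.
have n1 : `|x - b / 2| < b / 2 by rewrite ltr_norml; apply/andP; split; lra.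
have n0 := normr_ge0 (x - b / 2).
apply: cos_decreasing => //; lra.
Qed.

Lemma arc_weight_gt (b x : R) : 0 < b < 2 * pi -> b < x < 2 * pi -> 2^-1 < arc_weight b x.
Proof.
move=> /andP[b0 b2] /andP[bx x2].
suff : cos (x - b / 2) < cos (b / 2) by rewrite /arc_weight; lra.
have [xp|xp] := leP (x - b / 2) pi.
  apply: cos_decreasing; lra.
have -> : cos (x - b / 2) = cos (2 * pi - (x - b / 2)).
  by rewrite -[LHS]cosN mulr_natl -[in RHS]addrC cosD2pi.
by apply: cos_decreasing => //; lra.
Qed.

Lemma trigpoly_step (b : R) (n : nat) :
  trigpoly (fun x => (step_poly n (arc_weight b x))%:C%C).
Proof.
have tw : trigpoly (fun x => (arc_weight b x)%:C%C).
  have E x : (arc_weight b x)%:C%C =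
      ((2 + cos (b / 2)) / 4)%:C%C + ((- (expi (- (b / 2)) / 8%:R)) * fexp 1 x
        + (- (expi (b / 2) / 8%:R)) * fexp (-1) x).
    rewrite fexpN /fexp mul1r /expi /arc_weight cosN sinN cosB.
    apply: complexP => /=; last by simpc; field.
    by simpc; field.
  under eq_fun do rewrite E.
  apply: trigpolyD; first exact: trigpoly_cst.
  by apply: trigpolyD; apply: trigpolyM; try exact: trigpoly_cst; exact: trigpoly_fexp.
rewrite /step_poly; under eq_fun do rewrite rmorphXn rmorphB rmorph1 rmorphXn -[- _]mulN1r /=.
apply: trigpolyX; apply: trigpolyD; first exact: trigpoly_cst.
by apply: trigpolyM; [exact: trigpoly_cst|exact: trigpolyX].
Qed.

Lemma ae_neq (y : R) : {ae mu, forall x, x != y}.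
Proof.
exists [set y]; split; [exact: measurable_set1|exact: lebesgue_measure_set1|].
by move=> x /= /negP; rewrite negbK => /eqP.
Qed.

(** Dominated convergence: the step polynomials of the arc weight tend to the indicator of the arc,
    except possibly at 0 and b, where the weight is 1/2. *)
Lemma Rintegral_step_eq0 (phi : R -> R) (b : R) : intble circle phi -> 0 < b < 2 * pi ->
  (forall n, \int[mu]_(x in circle) (phi x * step_poly n (arc_weight b x)) = 0) ->
  \int[mu]_(x in circle) (phi x * (x <= b)%R%:R) = 0.
Proof.
move=> iphi b02 h.
have mphi : measurable_fun circle phi by apply/measurable_EFinP; exact: measurable_int iphi.
have ms n : measurable_fun circle (fun x => step_poly n (arc_weight b x)).
  apply: (@measurable_funS _ _ _ _ setT) => //; apply: measurable_funX.
  apply: measurable_funB; first exact: measurable_cst.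
  apply: measurable_funX; apply: continuous_measurable_fun => x.
  apply: cvgM; last exact: cvg_cst.
  apply: cvgD; last exact: cvg_cst.
  apply: cvgB; first exact: cvg_cst.
  apply: (@cvg_comp _ _ _ (fun y => y - b / 2) cos); last exact: continuous_cos.
  by apply: cvgB; [exact: cvg_id|exact: cvg_cst].
have mi : measurable_fun circle (fun x => (x <= b)%R%:R : R).
  apply: (@measurable_funS _ _ _ _ setT) => //.
  rewrite (_ : (fun _ => _) = \1_`]-oo, b]); first exact: measurable_indic.
  by apply/funext => x; rewrite indicE mem_setE in_itv.
have := @dominated_convergence _ _ R mu circle measurable_circle
  (fun n x => (phi x * step_poly n (arc_weight b x))%:E)
  (fun x => (phi x * (x <= b)%R%:R)%:E) (fun x => `|phi x|%:E).
case.
- by move=> n; apply/measurable_EFinP; apply: measurable_funM; [exact: mphi|exact: ms].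
- by apply/measurable_EFinP; apply: measurable_funM; [exact: mphi|exact: mi].
- apply: (@filterS2 _ _ (ae_filter_ringOfSetsType mu) _ _ _ _ (ae_neq 0) (ae_neq b)) => x xn0 xnb.
  rewrite /circle /= in_itv /= => /andP[x0 x2].
  apply: cvg_EFin; first exact: nearW.
  apply: (@cvgMr R).
  have {}x0 : 0 < x by rewrite lt_def xn0.
  have /andP[w0 w1] := arc_weight_itv b x.
  have [xb|xb] := leP x b.
    by apply: step_poly_cvg1; rewrite w0 arc_weight_lt// x0 lt_neqAle xnb.
  by apply: step_poly_cvg0; rewrite w1 arc_weight_gt// xb.
- exact: (@integrable_norm _ _ R mu circle phi iphi).
- apply: aeW => x n _; rewrite /= lee_fin normrM ler_piMr//.
  by have /andP[s0 s1] := step_poly_itv n (arc_weight_itv b x); rewrite ger0_norm.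
move=> ii _ L.
have : (fun n => (0%:E : \bar R)) @ \oo --> (\int[mu]_(x in circle) (phi x * (x <= b)%R%:R)%:E)%E.
  apply: cvg_trans L; apply: near_eq_cvg; near=> n => /=.
  have in_ : mu.-integrable circle (fun x => (phi x * step_poly n (arc_weight b x))%:E).
    apply: (@le_integrableR R circle _ (fun x => `|phi x|)) => //.
    - by apply: measurable_funM; [exact: mphi|exact: ms].
    - move=> x _; rewrite normrM ler_piMr//.
      by have /andP[s0 s1] := step_poly_itv n (arc_weight_itv b x); rewrite ger0_norm.
    - exact: (@integrable_norm _ _ R mu circle phi iphi).
  rewrite -(h n) /Rintegral fineK//.
  exact: (@integrable_fin_num _ _ _ mu _ measurable_circle _ in_).
move=> L'; rewrite /Rintegral.
have -> : (\int[mu]_(x in circle) (phi x * (x <= b)%R%:R)%:E = 0%:E)%E => //.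
by rewrite -(cvg_lim _ L')// lim_cst.
Unshelve. all: by end_near. Qed.

(** The hypothesis says that the primitive of [phi] vanishes on ]0, 2 pi[, and by Lebesgue's
    differentiation theorem [phi] is almost everywhere the derivative of this primitive. *)
Lemma Rintegral_arcs_eq0 (phi : R -> R) : intble circle phi ->
  (forall b, 0 < b < 2 * pi -> \int[mu]_(x in circle) (phi x * (x <= b)%R%:R) = 0) ->
  {ae mu, forall x, circle x -> phi x = 0}.
Proof.
move=> iphi h; pose f := phi \_ circle.
have iT : intble setT f.
  rewrite /f -restrict_EFin.
  by have := (@integrable_mkcond _ _ R mu circle (EFin \o phi) measurable_circle).1 iphi.
have iy y : intble `]-oo, y]%classic f.
  by apply: (@integrableS _ _ R mu setT `]-oo, y]%classic) iT.
have lf : locally_integrable setT f by exact: integrable_locally.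
pose F y := \int[mu]_(t in `]-oo, y]) f t.
have FF : {ae mu, forall x, derivable F x 1 /\ derive1 F x = f x} := FTC1Ny iy lf.
have F0 y : 0 < y < 2 * pi -> F y = 0.
  move=> y02; rewrite -(h y y02) /F /f -Rintegral_mkcondr.
  rewrite setIC Rintegral_mkcondr; apply: eq_Rintegral => x _.
  rewrite patchE mem_setE in_itv /=.
  by case: ifP => _; rewrite ?mulr1 ?mulr0.
apply: (@filterS2 _ _ (ae_filter_ringOfSetsType mu) _ _ _ _ (ae_neq 0) FF) => x xn0 [_ F'].
rewrite /Defs.circle /= in_itv /= => /andP[x0 x2].
have {}x0 : 0 < x by rewrite lt_def xn0.
have <- : f x = phi x by rewrite /f patchE mem_set// /Defs.circle /= in_itv /= (ltW x0).
rewrite -F' derive1E (_ : 'D_1 F x = 'D_1 (cst 0) x); first by rewrite derive_cst.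
apply: near_eq_derive.
have : \forall y \near x, y \in `]0, 2 * pi[ by apply: near_in_itvoo; rewrite in_itv /= x0.
by apply: filterS => y; rewrite in_itv /= => /F0.
Qed.

(** The approximations of arcs are real trigonometric polynomials, so orthogonality to them passes
    to the real and imaginary parts separately. *)
Lemma fourier_unique f : L2 circle f -> (forall k, fourier_coef f k = 0) ->
  {ae mu, forall x, circle x -> f x = 0}.
Proof.
move=> fL f0; have [i1 i2] := L2_cintegrable measurable_circle circle_lty fL.
have key b n : cintegral circle (fun x => f x * (step_poly n (arc_weight b x))%:C%C) = 0.
  by apply: trigpoly_ortho => //; exact: trigpoly_step.
have h1 : {ae mu, forall x, circle x -> cre (f x) = 0}.
  apply: Rintegral_arcs_eq0 => // b b0; apply: Rintegral_step_eq0 => // n.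
  have := congr1 cre (key b n); rewrite /cintegral /= => <-.
  by apply: eq_Rintegral => x _; case: (f x) => u v /=; ring.
have h2 : {ae mu, forall x, circle x -> cim (f x) = 0}.
  apply: Rintegral_arcs_eq0 => // b b0; apply: Rintegral_step_eq0 => // n.
  have := congr1 cim (key b n); rewrite /cintegral /= => <-.
  by apply: eq_Rintegral => x _; case: (f x) => u v /=; ring.
apply: (@filterS2 _ _ (ae_filter_ringOfSetsType mu) _ _ _ _ h1 h2) => x e1 e2 Dx.
by apply: complexP; rewrite ?e1 ?e2.
Qed.

Lemma fourier_inj f g : L2 circle f -> L2 circle g ->
  (forall k, fourier_coef f k = fourier_coef g k) ->
  {ae mu, forall x, circle x -> f x = g x}.
Proof.
move=> fL gL fg; have := fourier_unique (L2B measurable_circle fL gL).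
case=> [k|Z [mZ Z0 hZ]].
  by rewrite fourier_coefB// fg subrr.
exists Z; split => // x /= hx; apply: hZ => /= h; apply: hx => Dx.
by apply/eqP; rewrite -subr_eq0; apply/eqP; exact: h.
Qed.

Lemma Rintegral_ae_eq (D : set R) (p q : R -> R) : measurable D ->
  measurable_fun D p -> measurable_fun D q -> intble D p ->
  {ae mu, forall x, D x -> p x = q x} ->
  \int[mu]_(x in D) p x = \int[mu]_(x in D) q x.
Proof.
move=> mD mp mq ip pq; congr fine; apply: ae_eq_integral => //.
- exact/measurable_EFinP.
- exact/measurable_EFinP.
- apply: (@filterS _ _ (ae_filter_ringOfSetsType mu) _ _ _ pq) => x h Dx.
  by congr EFin; exact: h.
Qed.

Lemma nrm2_ae_eq (D : set R) f g : measurable D -> L2 D f -> L2 D g ->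
  {ae mu, forall x, D x -> f x = g x} -> nrm2 D f = nrm2 D g.
Proof.
move=> mD [m1 m2 i] [m1' m2' i'] fg; apply: Rintegral_ae_eq => //.
- exact: measurable_abs2.
- exact: measurable_abs2.
- by apply: (@filterS _ _ (ae_filter_ringOfSetsType mu) _ _ _ fg) => x h Dx; rewrite h.
Qed.

Lemma fourier_coef_ae_eq f g k : L2 circle f -> L2 circle g ->
  {ae mu, forall x, circle x -> f x = g x} -> fourier_coef f k = fourier_coef g k.
Proof.
move=> fL gL fg; rewrite -[LHS](subrK (fourier_coef g k)) -fourier_coefB//.
rewrite -[RHS]add0r; congr (_ + _); apply/abs2_eq0/eqP.
rewrite eq_le abs2_ge0 andbT -(pmulr_rle0 _ (@pi2_gt0 R)).
have fgL := L2B measurable_circle fL gL.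
apply: le_trans (fourier_coef_le _ fgL) _.
rewrite (@nrm2_ae_eq _ _ (fun=> 0))//; last 2 first.
- exact: L20.
- by apply: (@filterS _ _ (ae_filter_ringOfSetsType mu) _ _ _ fg) => x h Dx; rewrite h// subrr.
rewrite /nrm2 /Rintegral; under eq_integral do rewrite abs2_0.
by rewrite integral0.
Qed.

(** Bessel's inequality and Riesz-Fischer give some sum [g] of the Fourier series; it has the
    coefficients of [f], hence equals [f] almost everywhere by uniqueness. *)
Lemma fourier_cvg f : L2 circle f ->
  nrm2 circle (fun x => f x - fsum (ints n n) (fourier_coef f) x) @[n --> \oo] --> 0.
Proof.
move=> fL.
have hB (s : seq int) : uniq s ->
    \sum_(k <- s) abs2 (fourier_coef f k) <= nrm2 circle f / (2 * pi).
  by move=> us; rewrite ler_pdivlMr ?pi2_gt0// mulrC bessel.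
have [g [gL gf gc]] := riesz_fischer hB.
have fg : {ae mu, forall x, circle x -> f x = g x} by apply: fourier_inj.
apply: cvg_trans gc; apply: near_eq_cvg; near=> n.
rewrite nrm2B_sym; have sL : L2 circle (fsum (ints n n) (fourier_coef f)).
  exact/ccontinuous_L2_circle/ccontinuous_fsum.
apply: nrm2_ae_eq; [exact: measurable_circle|exact: L2B|exact: L2B|].
by apply: (@filterS _ _ (ae_filter_ringOfSetsType mu) _ _ _ fg) => x h Dx; rewrite h.
Unshelve. all: by end_near. Qed.

Lemma parseval f : L2 circle f ->
  2 * pi * (\sum_(k <- ints n n) abs2 (fourier_coef f k)) @[n --> \oo] --> nrm2 circle f.
Proof.
move=> fL; have L := fourier_cvg fL.
have : nrm2 circle f - nrm2 circle (fun x => f x - fsum (ints n n) (fourier_coef f) x)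
    @[n --> \oo] --> nrm2 circle f - 0 by apply: cvgB => //; exact: cvg_cst.
rewrite subr0; apply: cvg_trans; apply: near_eq_cvg; near=> n.
by rewrite nrm2_sub_fsum ?ints_uniq// opprB addrC subrK.
Unshelve. all: by end_near. Qed.

End fourier_complete.

(** * Ingham's inequalities *)

Section hann_window.
Context {R : realType}.
Local Notation mu := (@lebesgue_measure R).
Local Notation C := (R[i]).
Local Notation cre := (@complex.Re R).
Local Notation cim := (@complex.Im R).
Implicit Types (s : seq int) (c : int -> C) (w : int -> R).

Definition expsum s w c (t : R) : C := \sum_(k <- s) c k * expi (w k * t).

Lemma ccontinuous_expsum s w c : ccontinuous (expsum s w c).
Proof. by apply: ccontinuous_sum => k; apply: ccontinuousZ; exact: ccontinuous_expiZ. Qed.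

Lemma Rintegral_itv_cst (p q k : R) : p <= q ->
  \int[mu]_(x in `[p, q]) k = k * (q - p).
Proof.
move=> pq; have cF : continuous (fun _ : R => k) by move=> x; exact: cvg_cst.
have := FTC2_Rintegral (F := fun x => k * x + 0) (fun x => is_derive_affine k 0 x) cF pq.
by move=> ->; rewrite !addr0 mulrBr.
Qed.

Lemma Rintegral_sub_itv (h : R -> R) (p q p' q' : R) : continuous h -> (forall x, 0 <= h x) ->
  p <= p' -> q' <= q ->
  \int[mu]_(x in `[p', q']) h x <= \int[mu]_(x in `[p, q]) h x.
Proof.
move=> ch h0 pp qq.
have i1 := continuous_integrable p' q' ch; have i2 := continuous_integrable p q ch.
rewrite /Rintegral fine_le//.
- exact: (@integrable_fin_num _ _ _ mu _ _ _ i1).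
- exact: (@integrable_fin_num _ _ _ mu _ _ _ i2).
- apply: ge0_subset_integral => //.
  + by apply/measurable_EFinP; apply: (@measurable_funS _ _ _ _ setT) => //; exact: continuous_measurable_fun.
  + by move=> x _; rewrite lee_fin.
  + by move=> x /=; rewrite !in_itv /= => /andP[h1 h2]; apply/andP; split; lra.
Qed.

Lemma nrm2_sub_itv (f : R -> C) (p q p' q' : R) : ccontinuous f -> p <= p' -> q' <= q ->
  nrm2 `[p', q']%classic f <= nrm2 `[p, q]%classic f.
Proof.
move=> cf pp qq; apply: Rintegral_sub_itv => //; first exact: continuous_abs2.
by move=> x; exact: abs2_ge0.
Qed.

(** The subtracted 2/n makes the induction work, since 2/(n+1)^2 <= 2/n - 2/(n+1). For n = 0 the sum
    is empty and the bound is 0. *)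
Lemma big_ints_inv_sq (n : nat) :
  \sum_(j <- ints n n | j != 0) (j%:~R ^+ 2)^-1 <= 4 - (if n is 0 then 4 else 2 / n%:R) :> R.
Proof.
elim: n => [|n IH]; first by rewrite /ints /= big_cons (subrr 0%:Z) eqxx big_nil subrr.
pose H (j : int) : R := if j != 0 then (j%:~R ^+ 2)^-1 else 0.
rewrite big_mkcond -/(H _) in IH; rewrite big_mkcond -/(H _).
have sub : {subset ints n n <= ints n.+1 n.+1} by apply: ints_subset.
rewrite (@eq_bigr _ _ _ _ _ _ _ H)// in IH; rewrite (@eq_bigr _ _ _ _ _ _ _ H)//.
rewrite (big_uniq_split _ (ints_uniq n n) (ints_uniq n.+1 n.+1) sub) -[X in _ + X <= _]big_filter.
rewrite (perm_big (r1 := [seq k <- ints n.+1 n.+1 | k \notin ints n n]) [:: n.+1%:Z; - n.+1%:Z]); last first.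
  apply: uniq_perm.
  - by rewrite filter_uniq// ints_uniq.
  - by [].
  - move=> k; rewrite mem_filter !mem_ints !in_cons in_nil orbF; apply/idP/idP; lia.
have T2 : \sum_(i <- [:: n.+1%:Z; - n.+1%:Z]) H i = (n.+1%:R ^+ 2)^-1 + (n.+1%:R ^+ 2)^-1.
  by rewrite !big_cons big_nil addr0 /H mulrNz sqrrN.
rewrite [X in _ + X <= _](_ : _ = (n.+1%:R ^+ 2)^-1 + (n.+1%:R ^+ 2)^-1); last exact: T2.
have n1 : 0 < n.+1%:R :> R by [].
apply: (@le_trans _ _ ((4 - (if n is 0 then 4 else 2 / n%:R)) + ((n.+1%:R ^+ 2)^-1 + (n.+1%:R ^+ 2)^-1))).
  by apply: lerD.
case: n {IH sub T2} n1 => [|n] n1; first by rewrite expr1n invr1; lra.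
have n0 : 0 < n.+1%:R :> R by [].
rewrite -[n.+2%:R]natr1; set x := n.+1%:R in n0 *.
rewrite -subr_ge0.
have -> : 4 - 2 / (x + 1) - (4 - 2 / x + (((x + 1) ^+ 2)^-1 + ((x + 1) ^+ 2)^-1))
   = 2 / (x * (x + 1) ^+ 2) by field; apply/andP; split; lra.
by rewrite divr_ge0// mulr_ge0 ?sqr_ge0// ltW.
Qed.

(* The Schur-test constant of the kernel [1 / (k - m) ^ 2]. *)
Lemma sum_inv_sq_le s (k : int) : uniq s ->
  \sum_(m <- s | m != k) ((k - m)%:~R ^+ 2)^-1 <= 4 :> R.
Proof.
move=> us.
pose s' := [seq k - m | m <- s].
have us' : uniq s' by rewrite map_inj_uniq// => x y /eqP; rewrite (inj_eq (addrI k)) eqr_opp => /eqP.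
have -> : \sum_(m <- s | m != k) ((k - m)%:~R ^+ 2)^-1 =
    \sum_(j <- s' | j != 0) (j%:~R ^+ 2)^-1 :> R.
  by rewrite big_map; apply: eq_bigl => m; rewrite subr_eq0 eq_sym.
have [n hn] : exists n, {subset s' <= ints n n}.
  exists (\max_(j <- s') absz j) => j js; rewrite mem_ints.
  have : (absz j <= \max_(j <- s') absz j)%N by rewrite (big_rem j)//= leq_maxl.
  lia.
rewrite big_mkcond; apply: (@le_trans _ _ (\sum_(j <- ints n n | j != 0) (j%:~R ^+ 2)^-1)).
  rewrite [leRHS]big_mkcond (big_uniq_split _ us' (ints_uniq n n) hn) lerDl.
  by apply: sumr_ge0 => j _; case: ifP => _ //; rewrite invr_ge0 sqr_ge0.
apply: le_trans (big_ints_inv_sq n) _; rewrite lerBlDr lerDl.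
by case: n {hn} => // n; rewrite divr_ge0.
Qed.

(** The hypothesis gives x^2 - n^2 >= 3 x^2 / 4, and 9 x^4 / 16 >= n^2 x^2. The factor 4 bounds the
    squared modulus of e^(i x L) - 1 in the transform of the window. *)
Lemma hann_hat_bound_aux (x n : R) : 0 < n ^+ 2 -> x != 0 -> 4 * n ^+ 2 <= x ^+ 2 ->
  (n ^+ 2 / (x * (x ^+ 2 - n ^+ 2))) ^+ 2 * 4 <= (2 * n / x ^+ 2) ^+ 2.
Proof.
move=> nu2 x0 x2; have d0 : 0 < x ^+ 2 - n ^+ 2 by lra.
have X0 : 0 < x ^+ 2 by lra.
rewrite !expr_div_n mulrAC ler_pdivrMr; last by rewrite exprn_even_gt0//= mulf_neq0// gt_eqF.
rewrite [leRHS]mulrAC ler_pdivlMr; last by rewrite exprn_gt0.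
rewrite !exprMn; set X := x ^+ 2 in X0 d0 x2 *; set Y := n ^+ 2 in nu2 x2 d0 *.
have h : X ^+ 2 * (9 / 16) <= (X - Y) ^+ 2 by nra.
have -> : Y ^+ 2 * 4 * X ^+ 2 = 4 * Y * X * (Y * X) by ring.
have -> : 2 ^+ 2 * Y * (X * (X - Y) ^+ 2) = 4 * Y * X * (X - Y) ^+ 2 by ring.
have c0 : 0 <= 4 * Y * X by apply: mulr_ge0; [apply: mulr_ge0; [lra|exact: ltW]|exact: ltW].
apply: ler_wpM2l => //.
by apply: le_trans h; nra.
Qed.

Variables (p L : R).
Hypothesis L0 : 0 < L.
Let nu : R := 2 * pi / L.
Let q := p + L.

Let nu0 : 0 < nu.
Proof. by rewrite divr_gt0// pi2_gt0. Qed.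

(** One period of 1 - cos on [p, p + L]. It vanishes with its derivative at both ends, so its
    Fourier transform decays fast enough for the kernel of the Gram matrix to be summable; the
    transform of the indicator of the interval would decay only like 1/|x|. *)
Definition hann (t : R) : R := 1 - cos (nu * t - nu * p).

Lemma hann_ge0 t : 0 <= hann t. Proof. by rewrite subr_ge0 cos_le1. Qed.

Lemma hann_le2 t : hann t <= 2.
Proof. by rewrite /hann; have := cos_geN1 (nu * t - nu * p); lra. Qed.

Lemma continuous_hann : continuous hann.
Proof.
have [c1 _] := @ccontinuous_expi R nu (- (nu * p)).
by move=> x; apply: cvgB; [exact: cvg_cst|exact: c1].
Qed.

Lemma ccontinuous_hann : ccontinuous (fun t => (hann t)%:C%C).
Proof. by split; [exact: continuous_hann|move=> x; exact: cvg_cst]. Qed.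

Definition hann_hat (x : R) : C :=
  cintegral `[p, q]%classic (fun t => (hann t)%:C%C * expi (x * t - x * p)).

Let pq : p <= q. Proof. by rewrite lerDl ltW. Qed.

Lemma hann_expi (x t : R) : (hann t)%:C%C * expi (x * t - x * p) =
  expi (x * t - x * p) + ((- 2^-1)%:C%C * expi ((x + nu) * t - (x + nu) * p)
   + (- 2^-1)%:C%C * expi ((x - nu) * t - (x - nu) * p)).
Proof.
have E e : (x + e) * t - (x + e) * p = (x * t - x * p) + (e * t - e * p) by ring.
rewrite (E nu) (E (- nu)).
have -> : - nu * t - - nu * p = - (nu * t - nu * p) by ring.
rewrite !(expiD (x * t - x * p)) expiN /hann /expi; by apply: complexP => /=; [field|field].
Qed.

Lemma hann_hat0 : hann_hat 0 = L%:C%C.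
Proof.
rewrite /hann_hat; under eq_cintegral do rewrite hann_expi.
have cE (w : R) : cintegrable `[p, q]%classic (fun t => expi (w * t - w * p)).
  by apply: ccontinuous_cintegrable; exact: ccontinuous_expi.
rewrite cintegralD//; last by apply: cintegrableD => //; apply: cintegrableZ.
rewrite cintegralD//; [|exact: cintegrableZ..].
rewrite (_ : cintegral _ (fun x => expi (0 * x - 0 * p)) = L%:C%C); last first.
  rewrite (@eq_cintegral _ _ _ (fun=> 1)); last by move=> x _; rewrite !mul0r subrr expi0.
  rewrite (@cFTC2 _ (fun x => x%:C%C))//.
  - by rewrite -rmorphB /q addrC addKr.
  - by move=> x; split => /=; [exact: is_derive_id|exact: is_derive_cst].
  - exact: ccontinuous_cst.
rewrite !cintegralZ// add0r sub0r !cintegral_expi ?oppr_eq0 ?gt_eqF//.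
have shift (w : R) : w * q - w * p = w * L by rewrite /q; ring.
rewrite !shift.
have nuL : nu * L = 1%:~R * (2 * pi) by rewrite /nu divfK ?gt_eqF// mul1r.
rewrite mulNr nuL -mulNr -mulrNz !expi_2pi.
have E1 (w : R) : expi (w * p - w * p) = 1 :> C by rewrite subrr expi0.
by rewrite !E1 !subrr !mulr0 !addr0.
Qed.

(** Since nu L = 2 pi, the three exponentials of [hann_expi] have the same increment e^(i x L) - 1
    over the window, and the transform collapses to i nu^2 / (x (x^2 - nu^2)) times that
    increment. *)
Lemma abs2_hann_hat_le (x : R) : 2 * nu <= `|x| -> abs2 (hann_hat x) <= (2 * nu / x ^+ 2) ^+ 2.
Proof.
move=> hx.
have x2 : 4 * nu ^+ 2 <= x ^+ 2.
  rewrite -[x ^+ 2]real_normK ?num_real//.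
  have -> : 4 * nu ^+ 2 = (2 * nu) ^+ 2 by ring.
  by rewrite ler_sqr ?nnegrE// mulr_ge0// ltW.
have nu2 : 0 < nu ^+ 2 by rewrite exprn_gt0.
have xn0 : x != 0 by rewrite -sqrf_eq0 gt_eqF//; lra.
have xnn : (x + nu) * (x - nu) != 0.
  have -> : (x + nu) * (x - nu) = x ^+ 2 - nu ^+ 2 by ring.
  by rewrite gt_eqF//; lra.
move: (xnn); rewrite mulf_eq0 negb_or => /andP[xp xm].
rewrite /hann_hat; under eq_cintegral do rewrite hann_expi.
have cE (w : R) : cintegrable `[p, q]%classic (fun t => expi (w * t - w * p)).
  by apply: ccontinuous_cintegrable; exact: ccontinuous_expi.
rewrite cintegralD//; last by apply: cintegrableD => //; apply: cintegrableZ.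
rewrite cintegralD//; [|exact: cintegrableZ..].
rewrite !cintegralZ// !cintegral_expi//.
have shift (w : R) : w * q - w * p = w * L by rewrite /q; ring.
rewrite !shift.
have nuL : nu * L = 1%:~R * (2 * pi) by rewrite /nu divfK ?gt_eqF// mul1r.
have E1 (w : R) : expi (w * p - w * p) = 1 :> C by rewrite subrr expi0.
rewrite !E1 mulrDl mulrBl nuL !expiD expiN expi_2pi.
have -> : (1 : C)^*%C = 1 by apply: complexP => /=; rewrite ?oppr0.
rewrite !mulr1; set Z := expi (x * L) - 1.
have -> : (0 -i* x^-1)%C * Z + ((- 2^-1)%:C%C * ((0 -i* (x + nu)^-1)%C * Z) +
    (- 2^-1)%:C%C * ((0 -i* (x - nu)^-1)%C * Z)) =
    (0 +i* (nu ^+ 2 / (x * (x ^+ 2 - nu ^+ 2))))%C * Z.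
  rewrite !mulrA -!mulrDl; congr (_ * Z).
  have -> : x ^+ 2 - nu ^+ 2 = (x + nu) * (x - nu) by ring.
  apply: complexP => /=; first by ring.
  by field; rewrite xn0 xp xm.
rewrite abs2M.
have Z4 : abs2 Z <= 4.
  have := abs2D_le (expi (x * L)) (-1); rewrite abs2N abs2_1 abs2_expi -/Z; lra.
apply: (@le_trans _ _ ((nu ^+ 2 / (x * (x ^+ 2 - nu ^+ 2))) ^+ 2 * 4)).
  by rewrite {1}/abs2 /= expr0n add0r ler_wpM2l// sqr_ge0.
have d0 : 0 < x ^+ 2 - nu ^+ 2 by lra.
have X0 : 0 < x ^+ 2 by lra.
by apply: hann_hat_bound_aux => //; rewrite -sqrf_eq0 gt_eqF.
Qed.

End hann_window.

(** * Gram sums for the Hann window and the two inequalities *)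

Section ingham.
Context {R : realType}.
Local Notation mu := (@lebesgue_measure R).
Local Notation C := (R[i]).
Local Notation cre := (@complex.Re R).
Local Notation cim := (@complex.Im R).
Implicit Types (s : seq int) (c : int -> C) (w : int -> R).

Lemma creMl (x : R) (z : C) : cre (x%:C%C * z) = x * cre z.
Proof. by case: z => a b /=; ring. Qed.

Lemma Re_mul3_le (y z g : C) (B : R) : 0 <= B -> abs2 g <= B ^+ 2 ->
  `|cre (y * z * g)| <= B * ((abs2 y + abs2 z) / 2).
Proof.
move=> B0 gB; rewrite -ler_sqr ?nnegrE ?normr_ge0//; last first.
  by rewrite mulr_ge0// divr_ge0// addr_ge0// abs2_ge0.
rewrite real_normK ?num_real//; apply: (le_trans (Re_sqr_le_abs2 _)).
rewrite !abs2M mulrC exprMn ler_pM ?mulr_ge0 ?abs2_ge0//.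
have := sqr_ge0 (abs2 y - abs2 z); nra.
Qed.

Lemma abs2_sum s (z : int -> C) : abs2 (\sum_(k <- s) z k) =
  \sum_(k <- s) \sum_(m <- s) cre (z k * (z m)^*%C).
Proof.
have reS (I : Type) (r : seq I) (F : I -> C) : cre (\sum_(i <- r) F i) = \sum_(i <- r) cre (F i).
  by elim: r => [|i r IH]; rewrite ?big_nil// !big_cons creD IH.
have -> (y : C) : abs2 y = cre (y * y^*%C) by rewrite mulcJ_abs2.
rewrite mulr_suml reS; apply: eq_bigr => k _.
by rewrite rmorph_sum mulr_sumr reS.
Qed.

Lemma continuous_hann_abs2 (p L : R) (f : R -> C) : ccontinuous f ->
  continuous (fun t => hann p L t * abs2 (f t)).
Proof.
by move=> cf x; apply: cvgM; [exact: continuous_hann|exact: continuous_abs2].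
Qed.

Lemma Rintegral_sum (D : set R) s (F : int -> R -> R) : measurable D ->
  (forall k, mu.-integrable D (EFin \o F k)) ->
  \int[mu]_(x in D) (\sum_(k <- s) F k x) = \sum_(k <- s) \int[mu]_(x in D) F k x.
Proof.
move=> mD iF; suff [] : mu.-integrable D (EFin \o (fun x => \sum_(k <- s) F k x)) /\
  \int[mu]_(x in D) (\sum_(k <- s) F k x) = \sum_(k <- s) \int[mu]_(x in D) F k x by [].
elim: s => [|k s [IH1 IH2]].
  rewrite big_nil; split.
    have i0 : mu.-integrable D (cst 0) by exact: integrable0.
    by apply: eq_integrable i0 => // x _; rewrite /= big_nil.
  under eq_Rintegral do rewrite big_nil.
  by rewrite /Rintegral integral0.
rewrite big_cons -IH2 -RintegralD//; split.
  have := integrableDR mD (iF k) IH1.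
  by apply: eq_integrable => // x _; rewrite /= big_cons.
by apply: eq_Rintegral => x _; rewrite big_cons.
Qed.

(** Expanding the square gives a Hermitian form in the coefficients; the phases at p are absorbed in
    them without changing their moduli, so that the kernel is [hann_hat] at the differences of
    frequencies. *)
Lemma hann_gram (p L : R) s w c : 0 < L ->
  \int[mu]_(t in `[p, p + L]) (hann p L t * abs2 (expsum s w c t)) =
  \sum_(k <- s) \sum_(m <- s)
    cre ((c k * expi (w k * p)) * (c m * expi (w m * p))^*%C * hann_hat p L (w k - w m)).
Proof.
move=> L0; pose d k := c k * expi (w k * p).
pose H k m t : C := d k * (d m)^*%C * ((hann p L t)%:C%C * expi ((w k - w m) * t - (w k - w m) * p)).
have cH k m : ccontinuous (H k m).
  apply: ccontinuousZ; apply: ccontinuousM; first exact: ccontinuous_hann.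
  exact: ccontinuous_expi.
have iH k m := ccontinuous_cintegrable p (p + L) (cH k m).
have E t : hann p L t * abs2 (expsum s w c t) = \sum_(k <- s) \sum_(m <- s) cre (H k m t).
  rewrite abs2_sum mulr_sumr; apply: eq_bigr => k _; rewrite mulr_sumr; apply: eq_bigr => m _.
  have -> : H k m t = (hann p L t)%:C%C * (c k * expi (w k * t) * (c m * expi (w m * t))^*%C).
    rewrite /H.
    have -> : (w k - w m) * t - (w k - w m) * p = (w k * t - w m * t) - (w k * p - w m * p) by ring.
    rewrite /d !rmorphM !expiD !expiN !expiD !expiN.
    have e1 (y : R) : expi y * (expi y)^*%C = 1 :> C by rewrite mulcJ_abs2 abs2_expi.
    have -> : ((expi (w k * p) * (expi (w m * p))^*)^* = (expi (w k * p))^* * expi (w m * p))%C.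
      by move: (expi _) (expi _) => [? ?] [? ?]; apply: complexP => /=; ring.
    set a := expi (w k * p); set b := expi (w m * p).
    have ha : a * a^*%C = 1 by exact: e1. have hb : b * b^*%C = 1 by exact: e1.
    transitivity ((hann p L t)%:C%C * (c k * expi (w k * t) * ((c m)^*%C * (expi (w m * t))^*%C))
      * (a * a^*%C) * (b * b^*%C)); first by ring.
    by rewrite ha hb !mulr1.
  by rewrite creMl.
under eq_Rintegral do rewrite E.
have iR k m : mu.-integrable `[p, p + L]%classic (EFin \o (fun t => cre (H k m t))) by have [] := iH k m.
have cS k : continuous (fun t => \sum_(m <- s) cre (H k m t)).
  elim: s {E} => [|m s' IH]; first by under eq_fun do rewrite big_nil; move=> x; exact: cvg_cst.
  under eq_fun do rewrite big_cons.
  by move=> x; apply: cvgD; [have [+ _] := cH k m; exact|exact: IH].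
rewrite Rintegral_sum//; last by move=> k; exact: continuous_integrable.
apply: eq_bigr => k _; rewrite Rintegral_sum//; apply: eq_bigr => m _.
rewrite /hann_hat -cintegralZ//.
apply: ccontinuous_cintegrable; apply: ccontinuousM; first exact: ccontinuous_hann.
exact: ccontinuous_expi.
Qed.

(** The diagonal of the Gram matrix is L. A gap of 2 nu |k - m| bounds the other entries by 1 / (2
    nu (k - m)^2), and the Schur test bounds their contribution by the factor 4 / (2 nu) = L / pi <=
    L / 2. The gap is required only between indices with non-zero coefficients, so that modes can be
    discarded by masking coefficients. *)
Lemma hann_ingham (p L : R) s w c : 0 < L -> uniq s ->
  (forall k m, c k != 0 -> c m != 0 -> k != m ->
     4 * pi / L * `|(k - m)%:~R| <= `|w k - w m|) ->
  `|\int[mu]_(t in `[p, p + L]) (hann p L t * abs2 (expsum s w c t)) - L * \sum_(k <- s) abs2 (c k)|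
    <= L / 2 * \sum_(k <- s) abs2 (c k).
Proof.
move=> L0 us gap; rewrite hann_gram//.
pose d k := c k * expi (w k * p).
have dE k : abs2 (d k) = abs2 (c k) by rewrite abs2M abs2_expi mulr1.
pose T k m := cre (d k * (d m)^*%C * hann_hat p L (w k - w m)).
have Tkk k : T k k = L * abs2 (c k).
  by rewrite /T subrr hann_hat0// mulcJ_abs2 dE /= mulr0 subr0 mulrC.
pose nu := 2 * pi / L; have nu0 : 0 < nu by rewrite divr_gt0// pi2_gt0.
have off k m : k != m -> `|T k m| <= (2 * nu)^-1 * ((k - m)%:~R ^+ 2)^-1 * ((abs2 (c k) + abs2 (c m)) / 2).
  move=> km; have B0 : 0 <= (2 * nu)^-1 * ((k - m)%:~R ^+ 2)^-1 :> R.
    by rewrite mulr_ge0// invr_ge0 ?sqr_ge0// mulr_ge0// ltW.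
  have rhs0 : 0 <= (2 * nu)^-1 * ((k - m)%:~R ^+ 2)^-1 * ((abs2 (c k) + abs2 (c m)) / 2).
    by rewrite mulr_ge0// divr_ge0// addr_ge0// abs2_ge0.
  have [ck0|ck0] := eqVneq (c k) 0.
    have -> : T k m = 0 by rewrite /T /d ck0 !mul0r.
    by rewrite normr0.
  have [cm0|cm0] := eqVneq (c m) 0.
    have -> : T k m = 0.
      rewrite /T /d cm0 mul0r; have -> : (0 : C)^*%C = 0 by apply: complexP => /=; rewrite ?oppr0.
      by rewrite mulr0 mul0r.
    by rewrite normr0.
  rewrite -(dE k) -(dE m) -(abs2_conj (d m)); apply: Re_mul3_le => //.
  have g := gap k m ck0 cm0 km.
  have km1 : 1 <= `|(k - m)%:~R| :> R.
    by rewrite -intr_norm -[1]/(1%:~R) ler_int; move: km; rewrite -subr_eq0; lia.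
  have E4 : 4 * pi / L = 2 * nu by rewrite /nu; field; rewrite gt_eqF.
  rewrite E4 in g.
  have nn : 0 < 2 * nu by rewrite mulr_gt0.
  have wkm : 2 * nu <= `|w k - w m| by apply: le_trans g; rewrite ler_peMr// ltW.
  apply: (le_trans (@abs2_hann_hat_le R p L L0 _ wkm)).
  have kmn0 : 0 < `|(k - m)%:~R| :> R by apply: lt_le_trans km1.
  rewrite ler_sqr ?nnegrE//; last by rewrite divr_ge0 ?sqr_ge0// mulr_ge0// ltW.
  rewrite -/nu -[(w k - w m) ^+ 2]real_normK ?num_real// -[(k - m)%:~R ^+ 2]real_normK ?num_real//.
  move: g; set a := `|(k - m)%:~R| in km1 kmn0 *; set b := `|w k - w m| => g.
  have b0 : 0 < b by apply: lt_le_trans wkm.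
  rewrite ler_pdivrMr ?exprn_gt0// -invfM ler_pdivlMl; last by rewrite mulr_gt0// exprn_gt0.
  have -> : 2 * nu * a ^+ 2 * (2 * nu) = (2 * nu * a) ^+ 2 by ring.
  by rewrite ler_sqr ?nnegrE; [exact: g|rewrite mulr_ge0 ?ltW|exact: ltW].
have -> : \sum_(k <- s) \sum_(m <- s) T k m - L * \sum_(k <- s) abs2 (c k) =
    \sum_(k <- s) \sum_(m <- s | m != k) T k m.
  rewrite mulr_sumr -sumrB !big_seq; apply: eq_bigr => k ks.
  by rewrite (bigD1_seq k)//= Tkk addrC addrK.
apply: (@le_trans _ _ (\sum_(k <- s) \sum_(m <- s | m != k)
    ((2 * nu)^-1 * ((k - m)%:~R ^+ 2)^-1 * ((abs2 (c k) + abs2 (c m)) / 2)))).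
  apply: (le_trans (ler_norm_sum _ _ _)); apply: ler_sum => k _.
  apply: (le_trans (ler_norm_sum _ _ _)); apply: ler_sum => m mk.
  by apply: off; rewrite eq_sym.
pose K k m : R := (2 * nu)^-1 * ((k - m)%:~R ^+ 2)^-1.
(* The kernel is symmetric, so the two halves of the arithmetic mean contribute equally. *)
have split_sum : \sum_(k <- s) \sum_(m <- s | m != k) (K k m * ((abs2 (c k) + abs2 (c m)) / 2)) =
  \sum_(k <- s) \sum_(m <- s | m != k) (K k m * abs2 (c k)).
  have swap : \sum_(k <- s) \sum_(m <- s | m != k) (K k m * abs2 (c m)) =
     \sum_(k <- s) \sum_(m <- s | m != k) (K k m * abs2 (c k)).
    rewrite (exchange_big_dep predT)//=; apply: eq_bigr => m _.
    rewrite (eq_bigl (fun k => k != m)); last by move=> k; rewrite eq_sym.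
    apply: eq_bigr => k _; congr (_ * _).
    by rewrite /K -[k - m]opprB mulrNz sqrrN.
  transitivity (\sum_(k <- s) \sum_(m <- s | m != k) (K k m * abs2 (c k)) / 2 +
     \sum_(k <- s) \sum_(m <- s | m != k) (K k m * abs2 (c m)) / 2).
    rewrite -big_split; apply: eq_bigr => k _; rewrite -big_split; apply: eq_bigr => m _ /=.
    by rewrite mulrDl mulrDr !mulrA.
  have dv (F : int -> int -> R) : \sum_(k <- s) \sum_(m <- s | m != k) F k m / 2 =
      (\sum_(k <- s) \sum_(m <- s | m != k) F k m) / 2.
    by rewrite mulr_suml; apply: eq_bigr => k _; rewrite mulr_suml.
  by rewrite !dv swap; lra.
rewrite split_sum mulr_sumr; apply: ler_sum => k _.
rewrite -mulr_suml ler_wpM2r ?abs2_ge0//.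
rewrite /K -mulr_sumr.
apply: (@le_trans _ _ ((2 * nu)^-1 * 4)).
  by apply: ler_wpM2l; [rewrite invr_ge0 mulr_ge0// ltW|exact: sum_inv_sq_le].
rewrite mulrC ler_pdivrMr; last by rewrite mulr_gt0.
rewrite /nu.
have -> : L / 2 * (2 * (2 * pi / L)) = 2 * pi by field; rewrite gt_eqF.
have := @pi_ge2 R; lra.
Qed.

(** The window is at most 2, so the plain integral is at least half of the weighted one, itself at
    least L / 2 times the sum. *)
Lemma ingham_lower (p q : R) s w c : p < q -> uniq s ->
  (forall k m, c k != 0 -> c m != 0 -> k != m ->
     4 * pi / (q - p) * `|(k - m)%:~R| <= `|w k - w m|) ->
  (q - p) / 4 * \sum_(k <- s) abs2 (c k) <= nrm2 `[p, q]%classic (expsum s w c).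
Proof.
move=> pq us gap; have L0 : 0 < q - p by rewrite subr_gt0.
have := hann_ingham p L0 us gap; rewrite (_ : p + (q - p) = q); last by ring.
rewrite ler_norml => /andP[+ _].
set A := \sum_(k <- s) _; set I := \int[mu]_(_ in _) _ => h.
suff : I <= 2 * nrm2 `[p, q]%classic (expsum s w c) by lra.
have ca := continuous_abs2 (ccontinuous_expsum s w c).
rewrite /nrm2 -RintegralZl//; last exact: continuous_integrable.
apply: le_Rintegral => //.
- by apply: continuous_integrable; apply: continuous_hann_abs2; exact: ccontinuous_expsum.
- by apply: integrableZlR => //; exact: continuous_integrable.
- by move=> t _; rewrite ler_wpM2r ?abs2_ge0// hann_le2.
Qed.

(* The window is taken twice as long as [p, q], which then sits where it is at
   least 1. *)
Lemma ingham_upper (p q : R) s w c : p < q -> uniq s ->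
  (forall k m, c k != 0 -> c m != 0 -> k != m ->
     4 * pi / (q - p) * `|(k - m)%:~R| <= `|w k - w m|) ->
  nrm2 `[p, q]%classic (expsum s w c) <= 3 * (q - p) * \sum_(k <- s) abs2 (c k).
Proof.
move=> pq us gap; have l0 : 0 < q - p by rewrite subr_gt0.
pose p' := p - (q - p) / 2; pose L := 2 * (q - p).
have L0 : 0 < L by rewrite mulr_gt0.
have gap' k m : c k != 0 -> c m != 0 -> k != m ->
    4 * pi / L * `|(k - m)%:~R| <= `|w k - w m|.
  move=> ck cm km; apply: le_trans (gap k m ck cm km).
  rewrite ler_wpM2r// ler_wpM2l ?mulr_ge0 ?pi_ge0//.
  by rewrite lef_pV2 ?posrE// /L; lra.
have := hann_ingham p' L0 us gap'; rewrite ler_norml => /andP[_].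
set A := \sum_(k <- s) _; set I := \int[mu]_(_ in _) _ => h.
suff : nrm2 `[p, q]%classic (expsum s w c) <= I by rewrite /L in h; lra.
have cf := ccontinuous_expsum s w c; have ch := @continuous_hann_abs2 p' L _ cf.
apply: (@le_trans _ _ (\int[mu]_(t in `[p, q]) (hann p' L t * abs2 (expsum s w c t)))).
  apply: le_Rintegral => //.
  - by apply: continuous_integrable; exact: continuous_abs2.
  - exact: continuous_integrable.
  move=> t /=; rewrite in_itv /= => /andP[pt tq]; rewrite ler_peMl ?abs2_ge0// /hann.
  set u := (t - p - (q - p) / 2).
  have -> : 2 * pi / L * t - 2 * pi / L * p' = pi / (q - p) * u + pi.
    by rewrite /u /L /p'; field; rewrite gt_eqF.
  rewrite cosDpi opprK lerDl cos_ge0_pihalf//.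
  have b0 : 0 < pi / (q - p) by rewrite divr_gt0// pi_gt0.
  have -> : pi / 2 = pi / (q - p) * ((q - p) / 2) by field; rewrite gt_eqF.
  by rewrite -mulrN !ler_pM2l// /u; apply/andP; split; lra.
apply: Rintegral_sub_itv => //.
- by move=> x; rewrite mulr_ge0 ?abs2_ge0// hann_ge0.
- by rewrite /p'; lra.
- by rewrite /p' /L; lra.
Qed.

End ingham.

(** * Low frequencies *)

Section low_frequencies.
Context {R : realType}.
Local Notation mu := (@lebesgue_measure R).
Local Notation C := (R[i]).
Local Notation cre := (@complex.Re R).
Local Notation cim := (@complex.Im R).
Implicit Types (s : seq int) (c : int -> C).

(** The gap condition of [hann_ingham] with an arbitrarily large constant, at the cost of dropping
    low indices: this is what permits arbitrarily short intervals. *)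
Definition gapped (w : int -> R) := forall gam : R, exists N : nat, forall k m : int,
  (N < absz k)%N -> (N < absz m)%N -> k != m -> gam * `|(k - m)%:~R| <= `|w k - w m|.

Lemma abs2_sum_le s (z : int -> C) :
  abs2 (\sum_(k <- s) z k) <= 2 ^+ size s * \sum_(k <- s) abs2 (z k).
Proof.
elim: s => [|k s IH]; first by rewrite !big_nil abs2_0 mulr0.
rewrite !big_cons; apply: (le_trans (abs2D_le _ _)).
rewrite exprS -mulrA; move: IH; set S' := \sum_(j <- s) abs2 (z j); set E := 2 ^+ size s => IH.
have E1 : 1 <= E by rewrite exprn_ege1// ler1n.
have : 0 <= (E - 1) * abs2 (z k) by rewrite mulr_ge0 ?abs2_ge0// subr_ge0.
lra.
Qed.

Lemma nrm2_le_bound (p q K : R) (f : R -> C) : p <= q -> ccontinuous f ->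
  (forall t, p <= t -> t <= q -> abs2 (f t) <= K) ->
  nrm2 `[p, q]%classic f <= K * (q - p).
Proof.
move=> pq cf fK; rewrite -(Rintegral_itv_cst K pq); apply: le_Rintegral => //.
- by apply: continuous_integrable; exact: continuous_abs2.
- by apply: continuous_integrable; move=> x; exact: cvg_cst.
- by move=> t /=; rewrite in_itv /= => /andP[]; exact: fK.
Qed.

Lemma nrm2_itvD_le (p q : R) (f g : R -> C) : ccontinuous f -> ccontinuous g ->
  nrm2 `[p, q]%classic (fun t => f t + g t) <=
    2 * nrm2 `[p, q]%classic f + 2 * nrm2 `[p, q]%classic g.
Proof. by move=> cf cg; apply: nrm2D_le => //; exact: ccontinuous_L2. Qed.

(** Whatever [s] is, at most 2 N + 1 of its modes are low, so they are bounded pointwise;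
    coincidences between their frequencies do no harm to an upper bound. Ingham's inequality treats
    the others. *)
Lemma expsum_upper (w : int -> R) (p q : R) : gapped w -> p < q ->
  exists2 beta, 0 < beta & forall s c, uniq s ->
    nrm2 `[p, q]%classic (expsum s w c) <= beta * \sum_(k <- s) abs2 (c k).
Proof.
move=> gw pq; have [N hN] := gw (4 * pi / (q - p)).
have l0 : 0 < q - p by rewrite subr_gt0.
pose K := 2 ^+ (N + N).+1 * (q - p) : R.
have K0 : 0 < K by rewrite mulr_gt0// exprn_gt0.
exists (2 * K + 2 * (3 * (q - p))); first by rewrite addr_gt0// !mulr_gt0.
move=> s c us.
pose cl k := if (absz k <= N)%N then c k else 0.
pose ch k := if (absz k <= N)%N then 0 else c k.
have E : expsum s w c = fun t => expsum s w cl t + expsum s w ch t.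
  apply/funext => t; rewrite /expsum -big_split; apply: eq_bigr => k _.
  by rewrite /cl /ch /= -mulrDl; case: ifP; rewrite ?addr0 ?add0r.
have S : \sum_(k <- s) abs2 (c k) = \sum_(k <- s) abs2 (cl k) + \sum_(k <- s) abs2 (ch k).
  by rewrite -big_split; apply: eq_bigr => k _; rewrite /cl /ch /=; case: ifP; rewrite abs2_0 ?addr0 ?add0r.
have sl0 : 0 <= \sum_(k <- s) abs2 (cl k) by apply: sumr_ge0 => k _; exact: abs2_ge0.
have sh0 : 0 <= \sum_(k <- s) abs2 (ch k) by apply: sumr_ge0 => k _; exact: abs2_ge0.
have Bh : nrm2 `[p, q]%classic (expsum s w ch) <= 3 * (q - p) * \sum_(k <- s) abs2 (ch k).
  apply: ingham_upper => // k m; rewrite /ch.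
  have [|kN] := leqP (absz k) N; first by rewrite eqxx.
  have [|mN] := leqP (absz m) N; first by rewrite eqxx.
  by move=> _ _; exact: hN.
have Bl : nrm2 `[p, q]%classic (expsum s w cl) <= K * \sum_(k <- s) abs2 (cl k).
  rewrite mulrAC; apply: nrm2_le_bound; [exact: ltW|exact: ccontinuous_expsum|].
  move=> t _ _; rewrite /expsum.
  rewrite (bigID (fun k => (absz k <= N)%N)) /= [X in _ + X]big1 ?addr0; last first.
    by move=> k /negbTE kN; rewrite /cl kN mul0r.
  rewrite -big_filter; apply: (le_trans (abs2_sum_le _ _)).
  apply: ler_pM => //; first by apply: sumr_ge0 => k _; exact: abs2_ge0.
    rewrite ler_weXn2l ?ler1n//.
    have -> : (N + N).+1 = size (ints N N) by rewrite size_map size_iota.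
    apply: uniq_leq_size; first exact: filter_uniq.
    by move=> k; rewrite mem_filter mem_ints => /andP[kN _]; lia.
  rewrite big_filter [leRHS](bigID (fun k => (absz k <= N)%N)) /= -[leLHS]addr0; apply: lerD.
    by apply: ler_sum => k _; rewrite abs2M abs2_expi mulr1.
  by apply: sumr_ge0 => k _; exact: abs2_ge0.
rewrite E; apply: (le_trans (nrm2_itvD_le _ _ _ _)); try exact: ccontinuous_expsum.
rewrite S mulrDl !mulrDr.
have := mulr_ge0 (ltW K0) sh0; have := mulr_ge0 (ltW l0) sl0; lra.
Qed.

Implicit Types (w : bool -> int -> R) (a : bool -> int -> C) (P : bool -> int -> bool).

Definition bsum (V : nmodType) s (F : bool -> int -> V) := \sum_(k <- s) (F true k + F false k).

Lemma bsumE (V : nmodType) s (F : bool -> int -> V) :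
  bsum s F = \sum_(k <- s) F true k + \sum_(k <- s) F false k.
Proof. exact: big_split. Qed.

Definition modal s w a t : C := bsum s (fun b k => a b k * expi (w b k * t)).

Definition mass s a : R := bsum s (fun b k => abs2 (a b k)).

Lemma modalE s w a t : modal s w a t = expsum s (w true) (a true) t + expsum s (w false) (a false) t.
Proof. exact: big_split. Qed.

Lemma mass_ge0 s a : 0 <= mass s a.
Proof. by apply: sumr_ge0 => k _; rewrite addr_ge0// abs2_ge0. Qed.

Lemma ccontinuous_modal s w a : ccontinuous (modal s w a).
Proof.
rewrite (_ : modal s w a = fun t => expsum s (w true) (a true) t + expsum s (w false) (a false) t).
  by apply: ccontinuousD; exact: ccontinuous_expsum.
by apply/funext => t; rewrite modalE.
Qed.

Lemma modal_upper w (p q : R) : gapped (w true) -> gapped (w false) -> p < q ->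
  exists2 beta, 0 < beta & forall s a, uniq s ->
    nrm2 `[p, q]%classic (modal s w a) <= beta * mass s a.
Proof.
move=> g1 g2 pq; have [b1 b10 h1] := expsum_upper g1 pq; have [b2 b20 h2] := expsum_upper g2 pq.
exists (2 * b1 + 2 * b2); first by rewrite addr_gt0// mulr_gt0.
move=> s a us.
rewrite (_ : modal s w a = fun t => expsum s (w true) (a true) t + expsum s (w false) (a false) t); last first.
  by apply/funext => t; rewrite modalE.
apply: (le_trans (nrm2_itvD_le _ _ _ _)); try exact: ccontinuous_expsum.
have := h1 s (a true) us; have := h2 s (a false) us.
rewrite /mass bsumE mulrDl !mulrDr.
have s1 : 0 <= \sum_(k <- s) abs2 (a true k) by apply: sumr_ge0 => k _; exact: abs2_ge0.
have s2 : 0 <= \sum_(k <- s) abs2 (a false k) by apply: sumr_ge0 => k _; exact: abs2_ge0.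
have := mulr_ge0 (ltW b10) s2; have := mulr_ge0 (ltW b20) s1; lra.
Qed.

Lemma bsum_mask (V : nmodType) s (F : bool -> int -> V) b0 k0 : uniq s ->
  bsum s F = bsum s (fun b k => if (b == b0) && (k == k0) then 0 else F b k)
    + (if k0 \in s then F b0 k0 else 0).
Proof.
move=> us; rewrite /bsum; case: ifP => k0s; last first.
  rewrite addr0 !big_seq; apply: eq_bigr => k ks.
  have -> : (k == k0) = false by apply/negP => /eqP kk; rewrite kk k0s in ks.
  by rewrite !andbF.
rewrite !(bigD1_seq k0)//= eqxx !andbT.
have E : \sum_(k <- s | k != k0) ((if (true == b0) && (k == k0) then 0 else F true k) +
     (if (false == b0) && (k == k0) then 0 else F false k)) =
     \sum_(k <- s | k != k0) (F true k + F false k).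
  by apply: eq_bigr => k kk; rewrite (negbTE kk) !andbF.
rewrite E; case: b0 {E}; rewrite /= ?add0r ?addr0; first by rewrite -addrA addrC.
by rewrite addrAC.
Qed.

Lemma sin_le_id (y : R) : 0 <= y -> sin y <= y.
Proof.
move=> y0; have := FTC2_Rintegral (fun x => is_derive_sin x) (@continuous_cos R) y0.
rewrite sin0 subr0 => <-; have := Rintegral_itv_cst 1 y0; rewrite subr0 mul1r => {2}<-.
apply: le_Rintegral => //.
- exact: continuous_integrable (@continuous_cos R).
- by apply: continuous_integrable; move=> x; exact: cvg_cst.
Qed.

(* Fourier multiplier of the average over [t, t + del]. *)
Definition avg_mult (del x : R) : C :=
  if x == 0 then 1 else (0 -i* (x * del)^-1)%C * (expi (x * del) - 1).

(** The real part of the multiplier is sin(th)/th with th = x del, which stays below some [rho] < 1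
    away from 0: it is at most 1/2 for th >= 2, and for th < 2 it is at most cos(th/2) because
    sin(th) = 2 sin(th/2) cos(th/2). Evenness covers negative th. *)
Lemma avg_mult_lower (del gam : R) : 0 < del -> 0 < gam ->
  exists2 c0, 0 < c0 & forall x, gam <= `|x| -> c0 <= abs2 (1 - avg_mult del x).
Proof.
move=> d0 g0; pose th0 := Num.min (gam * del) 1.
have th00 : 0 < th0 by rewrite lt_min mulr_gt0//=.
have th01 : th0 <= 1 by rewrite ge_min lexx orbT.
have pi2 := @pi_ge2 R.
pose rho := Num.max (2^-1) (cos (th0 / 2)).
have rho1 : rho < 1.
  rewrite gt_max; apply/andP; split; first lra.
  rewrite -[ltRHS](@cos0 R); apply: cos_decreasing; lra.
exists ((1 - rho) ^+ 2); first by rewrite exprn_gt0// subr_gt0.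
move=> x gx.
have xn0 : x != 0 by rewrite -normr_gt0; apply: lt_le_trans gx.
have key (th : R) : th0 <= th -> sin th / th <= rho.
  move=> th0h; have thp : 0 < th by apply: lt_le_trans th0h.
  rewrite /rho le_max; have [t2|t2] := leP 2 th.
    apply/orP; left; rewrite ler_pdivrMr//; have := sin_le1 th; lra.
  apply/orP; right; rewrite ler_pdivrMr//.
  have -> : sin th = 2 * (cos (th / 2) * sin (th / 2)).
    by rewrite mulr_natl -sin_mulr2n -mulr_natl; congr sin; field.
  have c1 : cos (th / 2) <= cos (th0 / 2).
    move: th0h; rewrite le_eqVlt => /predU1P[->//|h]; apply/ltW/cos_decreasing; lra.
  have c0 : 0 <= cos (th / 2) by apply: cos_ge0_pihalf; apply/andP; split; lra.
  have s1 : sin (th / 2) <= th / 2 by apply: sin_le_id; lra.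
  have := ler_wpM2l c0 s1; have : cos (th / 2) * th <= cos (th0 / 2) * th by rewrite ler_wpM2r// ltW.
  lra.
have {}key (th : R) : th0 <= `|th| -> sin th / th <= rho.
  have [tp|tn] := ger0P th; first exact: key.
  by move=> /key; rewrite sinN invrN mulrNN.
have thx : th0 <= `|x * del|.
  by rewrite normrM (ger0_norm (ltW d0)) ge_min; apply/orP; left; rewrite ler_wpM2r// ltW.
rewrite /avg_mult (negbTE xn0).
have := key _ thx; set th := x * del => h.
have -> : 1 - (0 -i* th^-1)%C * (expi th - 1) = ((1 - sin th / th) +i* ((cos th - 1) / th))%C.
  by apply: complexP => /=; ring.
apply: le_trans (Re_sqr_le_abs2 _) => /=.
by rewrite ler_sqr ?nnegrE; lra.
Qed.

(** The mean over [t, t + del] of [f] demodulated at the frequency [w0]. Taking the phase relative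
    to t makes every exponential an eigenfunction, with eigenvalue 1 at the frequency [w0]. *)
Definition average (del w0 : R) (f : R -> C) (t : R) : C :=
  cintegral `[t, t + del]%classic (fun y => (del^-1)%:C%C * expi (- w0 * y - - w0 * t) * f y).

Lemma average_expi (del w0 w1 t : R) : 0 < del ->
  average del w0 (fun y => expi (w1 * y)) t = avg_mult del (w1 - w0) * expi (w1 * t).
Proof.
move=> d0; have td : t <= t + del by rewrite lerDl ltW.
have dC : (del^-1)%:C%C * del%:C%C = 1 :> C by rewrite -rmorphM /= mulVf// gt_eqF.
rewrite /average; under eq_cintegral => y _.
  rewrite -mulrA -expiD.
  have -> : - w0 * y - - w0 * t + w1 * y = w1 * t + ((w1 - w0) * y - (w1 - w0) * t) by ring.
  rewrite expiD mulrA.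
  over.
rewrite cintegralZ//; last by apply: ccontinuous_cintegrable; exact: ccontinuous_expi.
rewrite /avg_mult; case: eqP => [->|/eqP x0].
  rewrite (@eq_cintegral _ _ _ (fun=> 1)); last by move=> x _; rewrite !mul0r subrr expi0.
  rewrite (@cFTC2 _ (fun x => x%:C%C))//.
  - by rewrite -rmorphB addrC addKr mul1r mulrAC dC mul1r.
  - by move=> x; split => /=; [exact: is_derive_id|exact: is_derive_cst].
  - exact: ccontinuous_cst.
rewrite cintegral_expi// subrr expi0.
have -> : (w1 - w0) * (t + del) - (w1 - w0) * t = (w1 - w0) * del by ring.
have -> : (0 -i* ((w1 - w0) * del)^-1)%C = (del^-1)%:C%C * (0 -i* (w1 - w0)^-1)%C.
  by apply: complexP => /=; rewrite ?invfM; ring.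
ring.
Qed.

Lemma average_modal (del w0 t : R) s w a : 0 < del ->
  average del w0 (modal s w a) t = modal s w (fun b k => avg_mult del (w b k - w0) * a b k) t.
Proof.
move=> d0.
pose G b k y := (del^-1)%:C%C * expi (- w0 * y - - w0 * t) * (a b k * expi (w b k * y)).
have cE b k : ccontinuous (fun y => (del^-1)%:C%C * expi (- w0 * y - - w0 * t) * expi (w b k * y)).
  apply: ccontinuousM; last exact: ccontinuous_expiZ.
  by apply: ccontinuousZ; exact: ccontinuous_expi.
have iE b k := ccontinuous_cintegrable t (t + del) (cE b k).
have GE b k y : G b k y = a b k * ((del^-1)%:C%C * expi (- w0 * y - - w0 * t) * expi (w b k * y)).
  by rewrite /G mulrCA.
have iG b k : cintegrable `[t, t + del]%classic (G b k).
  have := cintegrableZ (a b k) (measurable_itv _) (iE b k).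
  by apply: eq_cintegrable => // y _; rewrite GE.
rewrite /average (@eq_cintegral _ _ _ (fun y => \sum_(k <- s) (G true k y + G false k y))); last first.
  by move=> y _; rewrite /modal /bsum mulr_sumr; apply: eq_bigr => k _; rewrite mulrDr.
rewrite cintegral_sum//; last by move=> k; exact: cintegrableD.
rewrite /modal /bsum; apply: eq_bigr => k _; rewrite cintegralD//.
have cG b : cintegral `[t, t + del]%classic (G b k) =
    avg_mult del (w b k - w0) * a b k * expi (w b k * t).
  rewrite (eq_cintegral (fun y _ => GE b k y)) cintegralZ//.
  by have := average_expi w0 (w b k) t d0; rewrite /average => ->; ring.
by rewrite !cG.
Qed.

Lemma abs2_average_le (del w0 t p q : R) (f : R -> C) : 0 < del -> ccontinuous f ->
  p <= t -> t + del <= q -> abs2 (average del w0 f t) <= del^-1 * nrm2 `[p, q]%classic f.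
Proof.
move=> d0 cf pt tq; have td : t <= t + del by rewrite lerDl ltW.
have cg : ccontinuous (fun y => (del^-1)%:C%C * expi (- w0 * y - - w0 * t)).
  by apply: ccontinuousZ; exact: ccontinuous_expi.
apply: (le_trans (cauchy_schwarz _ (ccontinuous_L2 _ _ cg) (ccontinuous_L2 _ _ cf))) => //.
have -> : nrm2 `[t, t + del]%classic (fun y => (del^-1)%:C%C * expi (- w0 * y - - w0 * t)) = del^-1.
  rewrite /nrm2 (@eq_Rintegral _ _ _ _ _ (fun=> del^-1 ^+ 2)); last first.
    by move=> y _; rewrite abs2M abs2_expi mulr1 abs2_real.
  by rewrite Rintegral_itv_cst// addrC addKr; field; rewrite gt_eqF.
by apply: ler_wpM2l; [rewrite invr_ge0 ltW|exact: nrm2_sub_itv].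
Qed.

(** [P] selects the modes that may be present and [V] relates the two amplitudes of a mode. The
    constant depends on the interval but not on the finite set [s]. Requiring a length strictly
    above [l] leaves room to shorten the interval. *)
Definition observable w (V : bool -> int -> C -> C -> Prop) (l : R) P :=
  forall p q : R, l < q - p -> exists2 alpha, 0 < alpha &
    forall s (au av : bool -> int -> C), uniq s ->
      (forall b k, P b k -> V b k (au b k) (av b k)) ->
      (forall b k, ~~ P b k -> au b k = 0 /\ av b k = 0) ->
    alpha * (mass s au + mass s av) <=
      nrm2 `[p, q]%classic (modal s w au) + nrm2 `[p, q]%classic (modal s w av).

(* Subtracting from a modal sum its average against the mode of frequency w0
   over short intervals removes that frequency, multiplies the amplitudes at the
   other frequencies by factors bounded away from 0, and costs an arbitrarily
   small part of the observation interval. *)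
Lemma observable_add w (V : bool -> int -> C -> C -> Prop) (l : R) P b0 k0 :
  gapped (w true) -> gapped (w false) -> 0 < l ->
  (forall b k (z x y : C), V b k x y -> V b k (z * x) (z * y)) ->
  observable w V l P ->
  (exists2 gam, 0 < gam & forall b k, P b k -> gam <= `|w b k - w b0 k0|) ->
  observable w V l (fun b k => P b k || ((b == b0) && (k == k0))).
Proof.
move=> g1 g2 l0 VZ obs [gam gam0 hgam] p q lpq.
(* Half of the spare length: [p, q - del] is still longer than [l], and every average starting in it
   stays within [p, q]. *)
pose del := (q - p - l) / 2; have d0 : 0 < del by rewrite /del; lra.
have lpq' : l < q - del - p by rewrite /del; lra.
have [alpha a0 ha] := obs p (q - del) lpq'.
have pq : p < q by lra.
have pq' : p <= q - del by lra.
have [beta be0 hbe] := modal_upper g1 g2 pq.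
have [c0 c00 hc0] := avg_mult_lower d0 gam0.
set w0 := w b0 k0 in hgam *.
(* [M] bounds the effect of subtracting the average on the square norm: 2 for the sum itself, and 2
   times the integral over [p, q - del] of the pointwise bound by 1/del times the square norm. In
   [K], the first term controls the old modes and the second recovers the new one. *)
pose M := 2 + 2 * (del^-1 * (q - del - p)).
have M0 : 0 < M by rewrite addr_gt0// !mulr_gt0// ?invr_gt0//; lra.
pose K := M / (alpha * c0) + (2 + 2 * (beta * (M / (alpha * c0)))) / (q - p).
have ac0 : 0 < alpha * c0 by rewrite mulr_gt0.
have Mac : 0 < M / (alpha * c0) by rewrite divr_gt0.
have K0 : 0 < K.
  rewrite /K addr_gt0// divr_gt0 ?subr_gt0//.
  have : 0 < beta * (M / (alpha * c0)) by rewrite mulr_gt0.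
  lra.
exists K^-1; rewrite ?invr_gt0// => s au av us hV h0.
rewrite ler_pdivrMl//.
pose kap b k := avg_mult del (w b k - w0).
pose m a b k : C := (1 - kap b k) * a b k.
pose msk a b k : C := if (b == b0) && (k == k0) then 0 else a b k.
have kap0 : 1 - kap b0 k0 = 0 by rewrite /kap /avg_mult subrr eqxx subrr.
have F1 a : (forall b k, ~~ (P b k || ((b == b0) && (k == k0))) -> a b k = 0) ->
    c0 * mass s (msk a) <= mass s (m a).
  move=> ha0; have t b k : c0 * abs2 (msk a b k) <= abs2 (m a b k).
    rewrite /msk /m; case: ifP => bk; first by rewrite abs2_0 mulr0 abs2_ge0.
    rewrite abs2M; have [Pbk|nPbk] := boolP (P b k).
      by rewrite ler_wpM2r ?abs2_ge0//; apply: hc0; exact: hgam.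
    by rewrite ha0 ?abs2_0 ?mulr0// (negbTE nPbk) bk.
  by rewrite /mass /bsum mulr_sumr; apply: ler_sum => k _; rewrite mulrDr lerD.
have F3 a : nrm2 `[p, q - del]%classic (modal s w (m a)) <= M * nrm2 `[p, q]%classic (modal s w a).
  have -> : modal s w (m a) = fun t => modal s w a t + modal s w (fun b k => - (kap b k * a b k)) t.
    apply/funext => t; rewrite /modal /bsum -big_split; apply: eq_bigr => k _.
    by rewrite /m /=; ring.
  apply: (le_trans (nrm2_itvD_le _ _ _ _)); try exact: ccontinuous_modal.
  rewrite /M [leRHS]mulrDl; apply: lerD.
    rewrite ler_wpM2l//; apply: nrm2_sub_itv => //; first exact: ccontinuous_modal.
    by rewrite gerBl ltW.
  rewrite -mulrA ler_wpM2l//.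
  rewrite [leRHS]mulrAC; apply: nrm2_le_bound => //; first exact: ccontinuous_modal.
  move=> t pt tq.
  have -> : modal s w (fun b k => - (kap b k * a b k)) t = - average del w0 (modal s w a) t.
    rewrite average_modal// /modal /bsum -sumrN; apply: eq_bigr => k _.
    by rewrite /kap; ring.
  rewrite abs2N; apply: abs2_average_le => //; first exact: ccontinuous_modal.
  by rewrite -lerBrDr.
set NU := nrm2 _ (modal s w au) + _.
have F5 : mass s (msk au) + mass s (msk av) <= M / (alpha * c0) * NU.
  have f1 : c0 * mass s (msk au) <= mass s (m au) by apply: F1 => b k /h0[].
  have f2 : c0 * mass s (msk av) <= mass s (m av) by apply: F1 => b k /h0[].
  have obs' : alpha * (mass s (m au) + mass s (m av)) <= M * NU.
    apply: (@le_trans _ _ (nrm2 `[p, q - del]%classic (modal s w (m au)) +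
       nrm2 `[p, q - del]%classic (modal s w (m av)))); last first.
      by rewrite mulrDr; apply: lerD; exact: F3.
    apply: ha => // b k Pbk; first by apply: VZ; apply: hV; rewrite Pbk.
    have [bk|bk] := boolP ((b == b0) && (k == k0)).
      by case/andP: bk => /eqP -> /eqP ->; rewrite /m kap0 !mul0r.
    have [e1 e2] : au b k = 0 /\ av b k = 0 by apply: h0; rewrite negb_or Pbk bk.
    by rewrite /m e1 e2 !mulr0.
  rewrite mulrAC ler_pdivlMr//; apply: le_trans obs'.
  have := ler_wpM2l (ltW a0) (lerD f1 f2); lra.
(* The new mode is the whole sum minus the old modes, whose norm is already bounded through [F5] and
   the upper inequality. *)
have F6 a : (q - p) * (if k0 \in s then abs2 (a b0 k0) else 0) <=
    2 * nrm2 `[p, q]%classic (modal s w a) + 2 * (beta * mass s (msk a)).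
  pose z := if k0 \in s then a b0 k0 else 0.
  have -> : (if k0 \in s then abs2 (a b0 k0) else 0) = abs2 z.
    by rewrite /z; case: ifP; rewrite ?abs2_0.
  pose g t := z * expi (w0 * t).
  have -> : (q - p) * abs2 z = nrm2 `[p, q]%classic g.
    rewrite /nrm2 (@eq_Rintegral _ _ _ _ _ (fun=> abs2 z)).
      by rewrite Rintegral_itv_cst ?ltW// mulrC.
    by move=> t _; rewrite /g abs2M abs2_expi mulr1.
  have -> : g = fun t => modal s w a t + modal s w (fun b k => - msk a b k) t.
    apply/funext => t; rewrite /modal (bsum_mask _ b0 k0 us) /=.
    have -> : (if k0 \in s then a b0 k0 * expi (w b0 k0 * t) else 0) = g t.
      by rewrite /g /z; case: ifP; rewrite ?mul0r.
    rewrite addrAC /bsum -big_split big1 ?add0r// => k _ /=.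
    by rewrite /msk; do 2 case: ifP => _; ring.
  apply: (le_trans (nrm2_itvD_le _ _ _ _)); try exact: ccontinuous_modal.
  rewrite lerD2l ler_wpM2l//.
  have := hbe s (fun b k => - msk a b k) us.
  by congr (_ <= beta * _); apply: eq_bigr => k _; rewrite !abs2N.
have mE a : mass s a = mass s (msk a) + (if k0 \in s then abs2 (a b0 k0) else 0).
  rewrite /mass (bsum_mask _ b0 k0 us); congr (_ + _); apply: eq_bigr => k _.
  by rewrite /msk; do 2 case: ifP => _; rewrite ?abs2_0.
rewrite (mE au) (mE av).
have := F6 au; have := F6 av; move: F5.
set x1 := mass s _; set x2 := mass s _; set y1 := (if _ then _ else _); set y2 := (if _ then _ else _).
rewrite /NU; set n1 := nrm2 _ _; set n2 := nrm2 _ _ => F5 F62 F61.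
have qp0 : 0 < q - p by rewrite subr_gt0.
have Y : y1 + y2 <= (2 + 2 * (beta * (M / (alpha * c0)))) / (q - p) * (n1 + n2).
  rewrite mulrAC ler_pdivlMr//.
  have : beta * (x1 + x2) <= beta * (M / (alpha * c0) * (n1 + n2)) by rewrite ler_wpM2l// ltW.
  lra.
rewrite /K mulrDl; lra.
Qed.


End low_frequencies.

(** * Observability of all the modes *)

Section full_observability.
Context {R : realType}.
Local Notation C := (R[i]).
Implicit Types (s : seq int) (w : bool -> int -> R) (V : bool -> int -> C -> C -> Prop).

(** Comparison with the single index N + 1: the distance to its frequency grows at least like
    |k|. *)
Lemma gapped_far (w : int -> R) (w0 : R) : gapped w ->
  exists M : nat, forall k : int, (M < absz k)%N -> 1 <= `|w k - w0|.
Proof.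
move=> gw; have [N hN] := gw 1.
pose k1 : int := N.+1%:Z; pose x := `|w k1 - w0| + 1 + k1%:~R.
have x0 : 0 <= x by rewrite !addr_ge0.
exists (maxn N.+1 (Num.bound x)) => k; rewrite gtn_max => /andP[Nk xk].
have kk1 : k != k1 by apply/eqP => kk; rewrite kk /k1 /= ltnn in Nk.
have := hN k k1 (ltnW Nk) (leqnn _) kk1; rewrite mul1r => h.
have kx : x < `|k%:~R|.
  apply: lt_trans (archi_boundP x0) _.
  rewrite -intr_norm (_ : (Num.bound x)%:R = (Num.bound x)%:Z%:~R)// ltr_int.
  by move: xk; lia.
have t1 : `|k%:~R| <= `|(k - k1)%:~R| + k1%:~R :> R.
  rewrite intrD mulrNz; have := ler_normD (k%:~R - k1%:~R : R) (k1%:~R).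
  by rewrite subrK [`|k1%:~R|]ger0_norm.
have t2 : `|w k - w k1| <= `|w k - w0| + `|w k1 - w0|.
  rewrite [`|w k1 - w0|]distrC; apply: le_trans (ler_normD _ _).
  by rewrite addrA subrK.
rewrite /x in kx; lra.
Qed.

Lemma finite_positive_bound (T : eqType) (r : seq T) (f : T -> R) :
  exists2 gam, 0 < gam & forall x, x \in r -> 0 < f x -> gam <= f x.
Proof.
elim: r => [|x r [gam g0 IH]]; first by exists 1.
have [fx|fx] := ltP 0 (f x).
  exists (Num.min gam (f x)); first by rewrite lt_min g0.
  move=> y; rewrite inE => /orP[/eqP ->|yr] fy; rewrite ge_min ?lexx ?orbT//.
  by rewrite IH.
exists gam => // y; rewrite inE => /orP[/eqP ->|yr]; last exact: IH.
by rewrite ltNge fx.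
Qed.

Lemma observable_ext w V (l : R) (P P' : bool -> int -> bool) :
  (forall b k, P b k = P' b k) -> observable w V l P -> observable w V l P'.
Proof.
by move=> PP; have -> : P = P' by apply/funext => b; apply/funext => k.
Qed.

(* The functional [v - m (~~ b) u] almost annihilates the branch [~~ b] at high
   frequencies, so the two branches decouple and each of them is a scalar sum
   with large gaps. *)
Lemma observable_high w V (l : R) (mu : bool -> int -> R) (m : bool -> R) :
  gapped (w true) -> gapped (w false) -> 0 < l -> m true != m false ->
  (forall b e, 0 < e -> exists N : nat, forall k : int, (N < absz k)%N -> `|mu b k - m b| <= e) ->
  (forall b k x y, k != 0 -> V b k x y -> y = (mu b k)%:C%C * x) ->
  exists N : nat, observable w V l (fun _ k => (N < absz k)%N).
Proof.
move=> g1 g2 l0 mtf hmu hV.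
have gw b : gapped (w b) by case: b.
pose D := `|m true - m false|; have D0 : 0 < D by rewrite normr_gt0 subr_eq0.
have D8 : 0 < D / 8 by rewrite divr_gt0.
have [N1 h1] := g1 (4 * pi / l); have [N2 h2] := g2 (4 * pi / l).
have [N3 h3] := hmu true _ D8; have [N4 h4] := hmu false _ D8.
pose N := maxn (maxn N1 N2) (maxn N3 N4); exists N.
have hw b k k' : (N < absz k)%N -> (N < absz k')%N -> k != k' ->
    4 * pi / l * `|(k - k')%:~R| <= `|w b k - w b k'|.
  rewrite /N !gtn_max => /andP[/andP[a1 a2] _] /andP[/andP[b1 b2] _] kk.
  by case: b; [exact: h1|exact: h2].
have hm b k : (N < absz k)%N -> `|mu b k - m b| <= D / 8.
  rewrite /N !gtn_max => /andP[_ /andP[a1 a2]].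
  by case: b; [exact: h3|exact: h4].
move=> p q lpq; pose L := q - p; have L0 : 0 < L by rewrite /L; lra.
have pq : p < q by rewrite -subr_gt0.
(* [Q] - 1 bounds the squared ratio v/u on high modes. In [K], 25/256 = 49/256 - 24/256: adding the
   two inequalities [key], the kept branch brings (7/8)^2 / 4 and the other, nearly annihilated
   branch costs 6 (1/8)^2. *)
pose Q := 1 + 2 * (m true ^+ 2 + m false ^+ 2 + D ^+ 2).
pose K := 4 * (2 + m true ^+ 2 + m false ^+ 2) / (L * D ^+ 2 * (25 / 256)).
have LD0 : 0 < L * D ^+ 2 * (25 / 256).
  by apply: mulr_gt0; [apply: mulr_gt0 => //; exact: exprn_gt0|rewrite divr_gt0 ?ltr0n].
have st := sqr_ge0 (m true); have sf := sqr_ge0 (m false); have sD := sqr_ge0 D.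
have Q0 : 0 < Q by rewrite /Q; lra.
have K0 : 0 < K by rewrite divr_gt0//; lra.
exists ((Q * K)^-1); first by rewrite invr_gt0 mulr_gt0.
move=> s au av us aV a0; rewrite ler_pdivrMl; last exact: mulr_gt0.
have avE b k : av b k = (mu b k)%:C%C * au b k.
  have [Nk|Nk] := boolP (N < absz k)%N; last by have [-> ->] := a0 b k Nk; rewrite mulr0.
  by apply: (hV b); [apply/eqP => k0; rewrite k0 in Nk|exact: aV].
set NU := nrm2 _ (modal s w au) + _.
pose X b := \sum_(k <- s) abs2 (au b k).
have X0 b : 0 <= X b by apply: sumr_ge0 => k _; exact: abs2_ge0.
have gapc b (c : int -> C) : (forall k, ~~ (N < absz k)%N -> c k = 0) ->
    forall k k', c k != 0 -> c k' != 0 -> k != k' ->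
     4 * pi / (q - p) * `|(k - k')%:~R| <= `|w b k - w b k'|.
  move=> c0 k k' ck ck' kk'.
  have Nk : (N < absz k)%N by apply: contraNT ck => /c0 ->.
  have Nk' : (N < absz k')%N by apply: contraNT ck' => /c0 ->.
  apply: le_trans (hw b k k' Nk Nk' kk').
  rewrite ler_wpM2r// ler_wpM2l ?mulr_ge0 ?pi_ge0//.
  by rewrite lef_pV2 ?posrE// ltW.
have key b : L / 4 * ((D * (7 / 8)) ^+ 2 * X b) <=
    4 * (1 + m (~~ b) ^+ 2) * NU + 6 * L * ((D / 8) ^+ 2 * X (~~ b)).
  pose ca k := (mu b k - m (~~ b))%:C%C * au b k.
  pose cb k := (mu (~~ b) k - m (~~ b))%:C%C * au (~~ b) k.
  pose A := expsum s (w b) ca; pose B := expsum s (w (~~ b)) cb.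
  have ca0 k : ~~ (N < absz k)%N -> ca k = 0 by move=> /(a0 b)[h _]; rewrite /ca h mulr0.
  have cb0 k : ~~ (N < absz k)%N -> cb k = 0 by move=> /(a0 (~~ b))[h _]; rewrite /cb h mulr0.
  have lowA : L / 4 * ((D * (7 / 8)) ^+ 2 * X b) <= nrm2 `[p, q]%classic A.
    apply: le_trans (ingham_lower pq us (gapc b ca ca0)).
    rewrite ler_wpM2l ?divr_ge0 ?(ltW L0)// /X mulr_sumr; apply: ler_sum => k _.
    have [Nk|Nk] := boolP (N < absz k)%N; last first.
      by have [-> _] := a0 b k Nk; rewrite abs2_0 mulr0 abs2_ge0.
    rewrite abs2M ler_wpM2r ?abs2_ge0// abs2_real.
    rewrite -[leRHS]real_normK ?num_real// ler_sqr ?nnegrE//; last by rewrite mulr_ge0 ?ltW.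
    have Db : D = `|m b - m (~~ b)| by case: (b); rewrite //= distrC.
    have := ler_normD (m b - mu b k) (mu b k - m (~~ b)).
    rewrite addrA subrK -Db [`|m b - mu b k|]distrC.
    have := hm b k Nk; lra.
  have upB : nrm2 `[p, q]%classic B <= 3 * L * ((D / 8) ^+ 2 * X (~~ b)).
    apply: (le_trans (ingham_upper pq us (gapc (~~ b) cb cb0))).
    rewrite ler_wpM2l ?mulr_ge0 ?(ltW L0)// /X mulr_sumr; apply: ler_sum => k _.
    have [Nk|Nk] := boolP (N < absz k)%N; last first.
      rewrite cb0// abs2_0 mulr_ge0 ?sqr_ge0 ?abs2_ge0//.
    rewrite abs2M ler_wpM2r ?abs2_ge0// abs2_real.
    rewrite -[leLHS]real_normK ?num_real// ler_sqr ?nnegrE//; last exact: ltW.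
    exact: hm.
  have cA : ccontinuous A by exact: ccontinuous_expsum.
  have cB : ccontinuous B by exact: ccontinuous_expsum.
  have ABE : (fun t => A t + B t) = (fun t => modal s w av t + (- m (~~ b))%:C%C * modal s w au t).
    have Ebs (z : bool -> int -> C) t : modal s w z t = expsum s (w b) (z b) t + expsum s (w (~~ b)) (z (~~ b)) t.
      by rewrite modalE; case: (b) => //=; rewrite addrC.
    apply/funext => t; rewrite !Ebs mulrDr addrACA; congr (_ + _).
      rewrite /A /expsum mulr_sumr -big_split; apply: eq_bigr => k _.
      by rewrite /ca avE /= rmorphB rmorphN /=; ring.
    rewrite /B /expsum mulr_sumr -big_split; apply: eq_bigr => k _.
    by rewrite /cb avE /= rmorphB rmorphN /=; ring.
  have AB : nrm2 `[p, q]%classic (fun t => A t + B t) <= 2 * (1 + m (~~ b) ^+ 2) * NU.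
    rewrite ABE; have cu := ccontinuous_modal s w au.
    apply: (le_trans (nrm2_itvD_le _ _ (ccontinuous_modal _ _ _) (ccontinuousZ _ cu))).
    rewrite nrm2Z//; last exact: ccontinuous_L2.
    rewrite abs2_real sqrrN /NU.
    have nu0 := nrm2_ge0 `[p, q]%classic (modal s w au).
    have nv0 := nrm2_ge0 `[p, q]%classic (modal s w av).
    have := mulr_ge0 (sqr_ge0 (m (~~ b))) nv0; lra.
  have AA : nrm2 `[p, q]%classic A <= 2 * nrm2 `[p, q]%classic (fun t => A t + B t) + 2 * nrm2 `[p, q]%classic B.
    rewrite -[X in _ <= _ + 2 * X]nrm2N.
    have := nrm2_itvD_le p q (ccontinuousD cA cB) (ccontinuousZ (-1) cB).
    rewrite (_ : (fun t => A t + B t + -1 * B t) = A); last first.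
      by apply/funext => t; rewrite mulN1r addrK.
    by have -> : (fun t => -1 * B t) = (fun t => - B t) by apply/funext => t; rewrite mulN1r.
  apply: (le_trans lowA); apply: (le_trans AA); lra.
have := key true; have := key false => /= k2 k1.
have XK : X true + X false <= K * NU.
  rewrite mulrAC ler_pdivlMr//; lra.
have massu : mass s au = X true + X false by rewrite /mass bsumE.
have massv : mass s av <= (Q - 1) * (X true + X false).
  have muQ b k : abs2 (av b k) <= (Q - 1) * abs2 (au b k).
    have [Nk|Nk] := boolP (N < absz k)%N; last first.
      by have [-> ->] := a0 b k Nk; rewrite abs2_0 mulr0.
    rewrite avE abs2M ler_wpM2r ?abs2_ge0// abs2_real.
    have : mu b k ^+ 2 <= 2 * m b ^+ 2 + 2 * (mu b k - m b) ^+ 2.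
      have := sqr_ge0 (mu b k - 2 * m b); nra.
    have : (mu b k - m b) ^+ 2 <= (D / 8) ^+ 2.
      rewrite -[leLHS]real_normK ?num_real// ler_sqr ?nnegrE//; [exact: hm|exact: ltW].
    have : m b ^+ 2 <= m true ^+ 2 + m false ^+ 2.
      by case: (b); rewrite ?lerDl ?lerDr sqr_ge0.
    rewrite /Q; lra.
  rewrite /mass bsumE mulrDr !mulr_sumr.
  by apply: lerD; apply: ler_sum => k _.
have := ler_wpM2l (ltW Q0) XK; rewrite massu; lra.
Qed.

(** The high modes are observable, and the finitely many low modes of [J] are added along a list.
    [J] may omit a branch at k = 0, which is where the frequencies of the two branches coincide. *)
Lemma observable_modes w V (l : R) (J : bool -> int -> bool) (mu : bool -> int -> R) (m : bool -> R) :
  gapped (w true) -> gapped (w false) -> 0 < l -> m true != m false ->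
  (forall b e, 0 < e -> exists N : nat, forall k : int, (N < absz k)%N -> `|mu b k - m b| <= e) ->
  (forall b k x y, k != 0 -> V b k x y -> y = (mu b k)%:C%C * x) ->
  (forall b k (z x y : C), V b k x y -> V b k (z * x) (z * y)) ->
  (forall b k, k != 0 -> J b k) ->
  (forall b k b' k', J b k -> J b' k' -> (b, k) != (b', k') -> w b k != w b' k') ->
  observable w V l J.
Proof.
move=> g1 g2 l0 mtf hmu hV VZ J0 dist.
have gw b : gapped (w b) by case: b.
have [N obsN] := observable_high g1 g2 l0 mtf hmu hV.
have step (r : seq (bool * int)) : uniq r ->
    (forall x, x \in r -> J x.1 x.2 && (absz x.2 <= N)%N) ->
    observable w V l (fun b k => (N < absz k)%N || ((b, k) \in r)).
  elim: r => [_ _|[b0 k0] r IH].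
    by apply: observable_ext obsN => b k; rewrite in_nil orbF.
  move=> /= /andP[xr ur] hr.
  have Jx : J b0 k0 && (absz k0 <= N)%N by apply: (hr (b0, k0)); rewrite inE eqxx.
  case/andP: Jx => J0' k0N.
  have {}IH := IH ur (fun x xr' => hr x (mem_behead (s := _ :: _) xr')).
  apply: (@observable_ext _ _ _ (fun b k => ((N < absz k)%N || ((b, k) \in r)) || ((b == b0) && (k == k0)))).
    by move=> b k; rewrite inE xpair_eqE -orbA; congr (_ || _); rewrite orbC.
  apply: observable_add => //.
    (* The new frequency is at a positive distance from all the present ones: at distance 1 from
       those of large index, and the others are finitely many and different from it. *)
    have [M1 far1] := gapped_far (w b0 k0) g1; have [M2 far2] := gapped_far (w b0 k0) g2.
    pose M := maxn M1 M2.
    pose r' : seq (bool * int) := [seq (b, k) | b <- [:: true; false], k <- ints M M].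
    have [gam gam0 hgam] := finite_positive_bound r' (fun x => `|w x.1 x.2 - w b0 k0|).
    exists (Num.min gam 1); first by rewrite lt_min gam0 ltr01.
    move=> b k Pbk; rewrite ge_min.
    have [kM|kM] := leqP (absz k) M; last first.
      apply/orP; right; move: kM; rewrite gtn_max => /andP[a1 a2].
      by case: (b); [exact: far1|exact: far2].
    apply/orP; left; apply: (hgam (b, k)).
      apply/allpairsP; exists (b, k); split => //=; first by case: (b).
      by rewrite mem_ints; lia.
    rewrite normr_gt0 subr_eq0; apply: dist => //.
      case/orP: Pbk => [Nk|bkr]; first by apply: J0; apply/eqP => /= kk; rewrite kk in Nk.
      by have /andP[] := hr (b, k) (mem_behead (s := _ :: _) bkr).
    apply/eqP => -[bb kk]; move: Pbk; rewrite bb kk.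
    by rewrite ltnNge k0N /= (negbTE xr).
pose r : seq (bool * int) := [seq x <- [seq (b, k) | b <- [:: true; false], k <- ints N N] | J x.1 x.2].
apply: (@observable_ext _ _ _ (fun b k => (N < absz k)%N || ((b, k) \in r))); last first.
  apply: step.
    apply: filter_uniq; apply: allpairs_uniq => //; first exact: ints_uniq.
    by move=> [? ?] [? ?].
  move=> x; rewrite mem_filter => /andP[jx /allpairsP[[b k] /= [_ kN xE]]].
  by move: jx kN; rewrite xE mem_ints /= => ->; lia.
move=> b k; have [kN|kN] := leqP (absz k) N; last first.
  by rewrite J0//; apply/eqP => kk; rewrite kk in kN.
rewrite orFb mem_filter andb_idr// => _.
by apply/allpairsP; exists (b, k); split => //=; [case: (b)|rewrite mem_ints; lia].
Qed.

End full_observability.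

(** * The spectrum *)

Lemma intr_dist_ge1 (R : realType) (k m : int) : k != m -> 1 <= `|(k - m)%:~R| :> R.
Proof. by move=> km; rewrite -intr_norm -[1]/(1%:~R) ler_int; lia. Qed.

Section spectrum.
Context {R : realType}.
Local Notation C := (R[i]).
Local Notation cre := (@complex.Re R).
Local Notation cim := (@complex.Im R).
Variables (a c d r : R).
Hypotheses (a0 : 0 < a) (c0 : 0 < c) (d0 : 0 < d) (r0 : 0 < r).

(* On the k-th Fourier mode the system reads U' = i k^3 A(r / k^2) U, where A(e)
   has the eigenvalues [lam true e], [lam false e] and the eigenvectors
   [(a, lam b e - 1)]. For k = 0 the convention 1 / 0 = 0 gives the right
   (zero) frequencies. *)
Definition disc (e : R) := (c - 1 + e) ^+ 2 + 4 * a * c * d.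
Definition lam (b : bool) (e : R) :=
  (c + 1 - e + (if b then 1 else -1) * Num.sqrt (disc e)) / (2 * c).
Definition small (k : int) : R := r / k%:~R ^+ 2.
Definition freq (b : bool) (k : int) : R := k%:~R ^+ 3 * lam b (small k).
Definition slope (b : bool) (k : int) : R := (lam b (small k) - 1) / a.
Definition slope_lim (b : bool) : R := (lam b 0 - 1) / a.

Let c2 : 2 * c != 0. Proof. by rewrite mulf_neq0// gt_eqF. Qed.
Let cn0 : c != 0. Proof. by rewrite gt_eqF. Qed.
Let an0 : a != 0. Proof. by rewrite gt_eqF. Qed.
Let dn0 : d != 0. Proof. by rewrite gt_eqF. Qed.

Lemma disc_gt0 e : 0 < disc e.
Proof.
have : 0 < 4 * a * c * d by rewrite !mulr_gt0.
have := sqr_ge0 (c - 1 + e); rewrite /disc; lra.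
Qed.

Lemma lam_eq e b : c * lam b e ^+ 2 - (c + 1 - e) * lam b e + (1 - e - a * d) = 0.
Proof.
have s2 : Num.sqrt (disc e) ^+ 2 = disc e by rewrite sqr_sqrtr// ltW// disc_gt0.
have -> : c * lam b e ^+ 2 - (c + 1 - e) * lam b e + (1 - e - a * d) =
   (Num.sqrt (disc e) ^+ 2 - disc e) / (4 * c).
  by rewrite /lam /disc; case: b; field.
by rewrite s2 subrr mul0r.
Qed.

Lemma lam_add e : lam true e + lam false e = (c + 1 - e) / c.
Proof. by rewrite /lam; field. Qed.

(** Orthogonality of the two eigenvectors: a^2 + (a c / d) (lam true e - 1) (lam false e - 1) =
    0. *)
Lemma lam_orth e : (lam true e - 1) * (lam false e - 1) = - (a * d / c).
Proof.
have s2 : Num.sqrt (disc e) ^+ 2 = disc e by rewrite sqr_sqrtr// ltW// disc_gt0.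
have -> : (lam true e - 1) * (lam false e - 1) = - (a * d / c) -
   (Num.sqrt (disc e) ^+ 2 - disc e) / (4 * c ^+ 2).
  by rewrite /lam /disc; field.
by rewrite s2 subrr mul0r subr0.
Qed.

Lemma lam_mul e : lam true e * lam false e = (1 - e - a * d) / c.
Proof.
have -> : lam true e * lam false e = (lam true e - 1) * (lam false e - 1) + (lam true e + lam false e) - 1.
  by ring.
by rewrite lam_orth lam_add; field.
Qed.

Lemma lam_gap e : 0 < lam true e - lam false e.
Proof.
have -> : lam true e - lam false e = Num.sqrt (disc e) / c by rewrite /lam; field.
by rewrite divr_gt0// sqrtr_gt0 disc_gt0.
Qed.

(** Multiply by the sum of the two roots: the difference of squares is |x - y| |x + y|, and each
    root dominates |x| or |y|. *)
Lemma sqrt_sqD_lip (x y K : R) : 0 < K ->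
  `|Num.sqrt (x ^+ 2 + K) - Num.sqrt (y ^+ 2 + K)| <= `|x - y|.
Proof.
move=> K0; have px : 0 < x ^+ 2 + K by have := sqr_ge0 x; lra.
have py : 0 < y ^+ 2 + K by have := sqr_ge0 y; lra.
have sx : Num.sqrt (x ^+ 2 + K) ^+ 2 = x ^+ 2 + K by rewrite sqr_sqrtr// ltW.
have sy : Num.sqrt (y ^+ 2 + K) ^+ 2 = y ^+ 2 + K by rewrite sqr_sqrtr// ltW.
have s1 : 0 < Num.sqrt (x ^+ 2 + K) by rewrite sqrtr_gt0.
have s2 : 0 < Num.sqrt (y ^+ 2 + K) by rewrite sqrtr_gt0.
have lx : `|x| <= Num.sqrt (x ^+ 2 + K).
  by rewrite -[`|x|]sqrtr_sqr ler_sqrt ?real_normK ?num_real//; lra.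
have ly : `|y| <= Num.sqrt (y ^+ 2 + K).
  by rewrite -[`|y|]sqrtr_sqr ler_sqrt ?real_normK ?num_real//; lra.
set p := Num.sqrt _ in sx s1 lx *; set q := Num.sqrt _ in sy s2 ly *.
have pq0 : 0 <= p + q by rewrite addr_ge0 ?ltW.
have E : `|p - q| * (p + q) = `|x - y| * `|x + y|.
  by rewrite -(ger0_norm pq0) -!normrM -!subr_sqr sx sy; congr (`|_|); ring.
rewrite -(@ler_pM2r _ (p + q)) ?addr_gt0// E; apply: ler_wpM2l => //.
by apply: (le_trans (ler_normD _ _)); exact: lerD.
Qed.

Lemma lam_lip b e : 0 <= e -> `|lam b e - lam b 0| <= e / c.
Proof.
move=> e0; have K0 : 0 < 4 * a * c * d by rewrite !mulr_gt0.
have := sqrt_sqD_lip (c - 1 + e) (c - 1 + 0) K0; rewrite -/(disc e) -/(disc 0).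
have -> : `|c - 1 + e - (c - 1 + 0)| = e by rewrite addr0 addrC addKr ger0_norm.
rewrite ler_norml => /andP[h1 h2].
have -> : lam b e - lam b 0 = (- e + (if b then 1 else -1) *
    (Num.sqrt (disc e) - Num.sqrt (disc 0))) / (2 * c).
  by rewrite /lam; case: b; field.
have -> : e / c = 2 * e / (2 * c) by field.
rewrite normrM [`|(2 * c)^-1|]ger0_norm ?invr_ge0 ?mulr_ge0 ?(ltW c0)//.
rewrite ler_wpM2r ?invr_ge0 ?mulr_ge0 ?(ltW c0)// ler_norml.
by case: b; apply/andP; split; lra.
Qed.

Lemma small_ge0 k : 0 <= small k.
Proof. by rewrite divr_ge0 ?sqr_ge0// ltW. Qed.

Lemma freqN0 b : freq b 0 = 0.
Proof. by rewrite /freq expr0n mul0r. Qed.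

(** With [dt2], the coefficients of the quadratic c X^2 - [tr k] X + [dt2 k] whose roots are the two
    frequencies of mode k. They are polynomial in the parameters, unlike the frequencies. *)
Definition tr (k : int) : R := (c + 1) * k%:~R ^+ 3 - r * k%:~R.
Definition dt2 (k : int) : R := (1 - a * d) * k%:~R ^+ 6 - r * k%:~R ^+ 4.

Lemma freq_char b k : c * freq b k ^+ 2 - tr k * freq b k + dt2 k = 0.
Proof.
have [->|k0] := eqVneq k 0.
  by rewrite freqN0 /dt2 !expr0n /= !mulr0 subr0 addr0.
have kR : k%:~R != 0 :> R by rewrite intr_eq0.
have := lam_eq (small k) b => /(congr1 (fun z => k%:~R ^+ 6 * z)); rewrite mulr0 => <-.
rewrite /freq /tr /dt2 /small; set l := lam _ _.
by field.
Qed.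

(** In this order: both limits [lam b 0] are non-zero; 0 is a frequency of the mode 0 only; the
    quadratics of two different non-zero modes have no common root, the displayed expression being
    their resultant divided by c. *)
Definition nonresonant :=
  [/\ a * d != 1,
      forall m : int, m != 0 -> (1 - a * d) * m%:~R ^+ 2 - r != 0
    & forall k m : int, k != 0 -> m != 0 -> k != m ->
        c * (dt2 k - dt2 m) ^+ 2 - tr k * (dt2 k - dt2 m) * (tr k - tr m)
          + dt2 k * (tr k - tr m) ^+ 2 != 0].

(** The frequency 0 of the mode k = 0 is counted once, on the branch [true]. *)
Definition allmodes (b : bool) (k : int) : bool := (k != 0) || b.

Lemma freq_neq0 b m : nonresonant -> m != 0 -> freq b m != 0.
Proof.
move=> [_ h _] m0; apply/eqP => f0; have := freq_char b m; rewrite f0 expr0n /= !mulr0 subr0 add0r.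
rewrite /dt2.
have -> : (1 - a * d) * m%:~R ^+ 6 - r * m%:~R ^+ 4 = m%:~R ^+ 4 * ((1 - a * d) * m%:~R ^+ 2 - r) by ring.
by move/eqP; rewrite mulf_eq0 expf_eq0 /= intr_eq0 (negbTE m0) (negbTE (h m m0)).
Qed.

Lemma freq_distinct b k b' k' : nonresonant -> allmodes b k -> allmodes b' k' ->
  (b, k) != (b', k') -> freq b k != freq b' k'.
Proof.
move=> NR; have [_ _ hres] := NR; rewrite /allmodes.
have [->|k0] := eqVneq k 0; have [->|k0'] := eqVneq k' 0 => /=.
- by move=> -> ->; rewrite eqxx.
- by move=> _ _ _; rewrite freqN0 eq_sym freq_neq0.
- by move=> _ _ _; rewrite freqN0 freq_neq0.
move=> _ _; have [<-|kk] := eqVneq k k'.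
  rewrite xpair_eqE eqxx andbT => bb; rewrite /freq.
  have kR : k%:~R ^+ 3 != 0 :> R by rewrite expf_eq0 /= intr_eq0.
  rewrite (inj_eq (mulfI kR)).
  have := lam_gap (small k); case: b b' bb => [] [] //= _ h; first by rewrite gt_eqF//; lra.
  by rewrite lt_eqF//; lra.
move=> _; apply/eqP => ff; have := hres k k' k0 k0' kk; apply/negP; rewrite negbK; apply/eqP.
have e1 := freq_char b k; have e2 := freq_char b' k'; rewrite -ff in e2.
set w := freq b k in e1 e2.
(* Subtracting the two characteristic equations eliminates the square of the common frequency;
   substitution into the resultant then gives a multiple of the first equation. *)
have D : dt2 k - dt2 k' = w * (tr k - tr k').
  have : (c * w ^+ 2 - tr k * w + dt2 k) - (c * w ^+ 2 - tr k' * w + dt2 k') = 0 by rewrite e1 e2 subrr.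
  by move=> h; apply/eqP; rewrite -subr_eq0 -h; apply/eqP; ring.
rewrite D.
have -> : c * (w * (tr k - tr k')) ^+ 2 - tr k * (w * (tr k - tr k')) * (tr k - tr k') +
   dt2 k * (tr k - tr k') ^+ 2 = (tr k - tr k') ^+ 2 * (c * w ^+ 2 - tr k * w + dt2 k) by ring.
by rewrite e1 mulr0.
Qed.

Lemma lam0_neq0 b : a * d != 1 -> lam b 0 != 0.
Proof.
move=> ad; have := lam_mul 0; rewrite subr0 => h.
have : lam true 0 * lam false 0 != 0.
  by rewrite h mulf_neq0// ?invr_eq0// subr_eq0 eq_sym.
by rewrite mulf_eq0 negb_or => /andP[h1 h2]; case: b.
Qed.

Lemma archi_nat (x : R) : exists N : nat, forall k : int, (N < absz k)%N -> x <= `|k%:~R|.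
Proof.
exists (Num.bound `|x|) => k Nk; apply: (le_trans (ler_norm x)).
apply: (le_trans (ltW (archi_boundP (normr_ge0 x)))).
rewrite -intr_norm (_ : (Num.bound `|x|)%:R = (Num.bound `|x|)%:Z%:~R)// ler_int.
by move: Nk; lia.
Qed.

Lemma freq_perturb b k : `|freq b k - lam b 0 * k%:~R ^+ 3| <= r / c * `|k%:~R|.
Proof.
have [->|k0] := eqVneq k 0; first by rewrite freqN0 expr0n mulr0 subr0 normr0 mulr_ge0// divr_ge0// ltW.
have kR : k%:~R != 0 :> R by rewrite intr_eq0.
have -> : freq b k - lam b 0 * k%:~R ^+ 3 = k%:~R ^+ 3 * (lam b (small k) - lam b 0) by rewrite /freq; ring.
rewrite normrM; apply: (le_trans (ler_wpM2l (normr_ge0 _) (lam_lip b (small_ge0 k)))).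
rewrite /small normrX -[k%:~R ^+ 2]real_normK ?num_real// le_eqVlt; apply/orP; left; apply/eqP.
by field; rewrite cn0 normr_eq0.
Qed.

(** The frequencies are [lam b 0] k^3 up to an error linear in k, and [lam b 0] is non-zero since a
    d differs from 1. The gaps of the cubes are at least |k - m| (k^2 + m^2) / 2, which absorbs the
    linear errors at high index because |k - m| >= 1. *)
Lemma gapped_freq b : a * d != 1 -> gapped (freq b).
Proof.
move=> ad gam; have l0 : 0 < `|lam b 0| by rewrite normr_gt0 lam0_neq0.
pose q := r / c; have q0 : 0 < q by rewrite divr_gt0.
have [N hN] := archi_nat (2 * (q + `|gam|) / `|lam b 0| + 1).
exists N => k m Nk Nm km.
have g0 := normr_ge0 gam; have gg := ler_norm gam.
have big (j : int) : (N < absz j)%N -> `|gam| <= `|lam b 0| / 2 * `|j%:~R| ^+ 2 - q * `|j%:~R|.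
  move=> /hN hj; set x := `|j%:~R| in hj *.
  have x1 : 1 <= x.
    apply: le_trans hj; rewrite lerDr divr_ge0// ?mulr_ge0// ?addr_ge0// ltW//.
  have : 2 * (q + `|gam|) / `|lam b 0| <= x by lra.
  rewrite ler_pdivrMr// => h.
  have -> : `|lam b 0| / 2 * x ^+ 2 - q * x = x * (`|lam b 0| / 2 * x - q) by ring.
  have h' : `|gam| <= `|lam b 0| / 2 * x - q by lra.
  apply: (le_trans h'); rewrite ler_peMl//; lra.
have bk := big k Nk; have bm := big m Nm.
have pk := freq_perturb b k; have pm := freq_perturb b m; rewrite -/q in pk pm.
have km1 : 1 <= `|(k - m)%:~R| :> R.
  exact: intr_dist_ge1.
rewrite intrD mulrNz in km1 *.
set x : R := k%:~R in bk pk km1 *; set y : R := m%:~R in bm pm km1 *.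
have cube : `|x - y| * ((`|x| ^+ 2 + `|y| ^+ 2) / 2) <= `|x ^+ 3 - y ^+ 3|.
  have -> : x ^+ 3 - y ^+ 3 = (x - y) * (x ^+ 2 + x * y + y ^+ 2) by ring.
  rewrite normrM ler_wpM2l// !real_normK ?num_real//.
  apply: le_trans (ler_norm _); have := sqr_ge0 (x + y); lra.
have tri : `|lam b 0| * `|x ^+ 3 - y ^+ 3| <= `|freq b k - freq b m| + q * `|x| + q * `|y|.
  rewrite -normrM.
  have -> : lam b 0 * (x ^+ 3 - y ^+ 3) = (freq b k - freq b m) - (freq b k - lam b 0 * x ^+ 3) +
    (freq b m - lam b 0 * y ^+ 3) by ring.
  apply: (le_trans (ler_normD _ _)); apply: lerD => //.
  by apply: (le_trans (ler_normB _ _)); apply: lerD.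
have e1 : `|lam b 0| * (`|x - y| * ((`|x| ^+ 2 + `|y| ^+ 2) / 2)) <= `|lam b 0| * `|x ^+ 3 - y ^+ 3|.
  by rewrite ler_wpM2l// ltW.
have e2 : q * `|x| + q * `|y| <= `|x - y| * (q * `|x| + q * `|y|).
  by rewrite ler_peMl// addr_ge0// mulr_ge0// ltW.
have e3 : `|x - y| * (`|gam| + `|gam|) <= `|x - y| *
   (`|lam b 0| * ((`|x| ^+ 2 + `|y| ^+ 2) / 2) - (q * `|x| + q * `|y|)).
  by rewrite ler_wpM2l//; lra.
have e4 : gam * `|x - y| <= `|x - y| * (`|gam| + `|gam|).
  by rewrite mulrC ler_wpM2l//; lra.
lra.
Qed.

Lemma slope_cvg b e : 0 < e ->
  exists N : nat, forall k : int, (N < absz k)%N -> `|slope b k - slope_lim b| <= e.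
Proof.
move=> e0; have [N hN] := archi_nat (r / (e * (a * c)) + 1); exists N => k /hN hk.
have eac : 0 < e * (a * c) by rewrite !mulr_gt0.
have rq : 0 < r / (e * (a * c)) by rewrite divr_gt0.
have k0 : 0 < `|k%:~R| :> R by lra.
have -> : slope b k - slope_lim b = (lam b (small k) - lam b 0) / a by rewrite /slope /slope_lim; field.
rewrite normrM normfV [`|a|]ger0_norm ?(ltW a0)// ler_pdivrMr//.
apply: (le_trans (lam_lip b (small_ge0 k))).
rewrite /small -[k%:~R ^+ 2]real_normK ?num_real// ler_pdivrMr// ler_pdivrMr ?exprn_gt0//.
set x := `|k%:~R| in hk k0 *.
have : r / (e * (a * c)) <= x by lra.
rewrite ler_pdivrMr// => h; apply: (le_trans h).
have -> : e * a * c * x ^+ 2 = x * (x * (e * (a * c))) by ring.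
apply: ler_peMl; last by lra.
by rewrite mulr_ge0 ?ltW.
Qed.

Lemma slope_lim_neq : slope_lim true != slope_lim false.
Proof.
rewrite /slope_lim; have := lam_gap 0 => h; rewrite gt_eqF//.
by rewrite ltr_pM2r ?invr_gt0//; lra.
Qed.

Lemma slope_gap k : 0 < slope true k - slope false k.
Proof.
rewrite /slope -mulrBl divr_gt0//; have := lam_gap (small k); lra.
Qed.

Lemma slope_orth k : 1 + a * c / d * (slope true k * slope false k) = 0.
Proof.
have -> : slope true k * slope false k = (lam true (small k) - 1) * (lam false (small k) - 1) / a ^+ 2.
  by rewrite /slope; field.
by rewrite lam_orth; field; rewrite an0 cn0 dn0.
Qed.

(** Amplitudes along the eigenvector of the branch; at k = 0 the pair is free, because u and v have
    independent constant means. *)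
Definition admissible (b : bool) (k : int) (x y : C) := k = 0 \/ y = (slope b k)%:C%C * x.

Lemma observable_spectrum (l : R) : nonresonant -> 0 < l -> observable freq admissible l allmodes.
Proof.
move=> NR l0; have [ad _ _] := NR.
apply: (@observable_modes R freq admissible l allmodes slope slope_lim) => //.
- exact: gapped_freq.
- exact: gapped_freq.
- exact: slope_lim_neq.
- by move=> b e; exact: slope_cvg.
- by move=> b k x y k0 [kk|//]; rewrite kk eqxx in k0.
- by move=> b k z x y [->|->]; [left|right; rewrite mulrCA].
- by move=> b k k0; rewrite /allmodes k0.
- by move=> b k b' k'; exact: freq_distinct.
Qed.

Lemma abs2_orth (K s s' : R) (f g : C) : 1 + K * (s * s') = 0 ->
  abs2 (f + g) + K * abs2 (s%:C%C * f + s'%:C%C * g) =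
  abs2 f + abs2 g + K * (s ^+ 2 * abs2 f + s' ^+ 2 * abs2 g).
Proof.
move=> o; case: f => f1 f2; case: g => g1 g2.
apply/subr0_eq; transitivity (2 * (f1 * g1 + f2 * g2) * (1 + K * (s * s'))).
  by rewrite /abs2 /=; ring.
by rewrite o mulr0.
Qed.

Section amplitudes.
Variables (x y : int -> C).

(* Amplitudes of the modes of the solution with initial Fourier coefficients
   x, y; at k = 0 the two frequencies coincide and everything is put on [true]. *)
Definition amp1 (b : bool) (k : int) : C :=
  if k == 0 then (if b then x k else 0)
  else ((if b then 1 else -1) / (slope true k - slope false k))%:C%C *
     (y k - (slope (~~ b) k)%:C%C * x k).
Definition amp2 (b : bool) (k : int) : C :=
  if k == 0 then (if b then y k else 0) else (slope b k)%:C%C * amp1 b k.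

Lemma amp_admissible b k : admissible b k (amp1 b k) (amp2 b k).
Proof. by rewrite /admissible /amp2; case: eqP => [->|_]; [left|right]. Qed.

Lemma amp_off b k : ~~ allmodes b k -> amp1 b k = 0 /\ amp2 b k = 0.
Proof.
by rewrite /allmodes negb_or negbK => /andP[/eqP -> /negbTE ->]; rewrite /amp1 /amp2 eqxx.
Qed.

Definition ucoef (k : int) (t : R) : C :=
  amp1 true k * expi (freq true k * t) + amp1 false k * expi (freq false k * t).
Definition vcoef (k : int) (t : R) : C :=
  amp2 true k * expi (freq true k * t) + amp2 false k * expi (freq false k * t).

Lemma ucoef0 k : ucoef k 0 = x k.
Proof.
rewrite /ucoef !mulr0 !expi0 !mulr1 /amp1; case: eqP => _; first by rewrite addr0.
have sg := slope_gap k; set s := slope true k in sg *; set s' := slope false k in sg *.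
have sn : s - s' != 0 by rewrite gt_eqF.
by case: (x k) => ? ?; case: (y k) => ? ?; apply: complexP => /=; field.
Qed.

Lemma vcoef0 k : vcoef k 0 = y k.
Proof.
rewrite /vcoef !mulr0 !expi0 !mulr1 /amp2 /amp1; case: eqP => _; first by rewrite addr0.
have sg := slope_gap k; set s := slope true k in sg *; set s' := slope false k in sg *.
have sn : s - s' != 0 by rewrite gt_eqF.
by case: (x k) => ? ?; case: (y k) => ? ?; apply: complexP => /=; field.
Qed.

(** The eigenvectors are orthogonal for the energy, so the two oscillating components contribute
    separately, each with constant modulus. At k = 0 a single component is present. *)
Lemma mode_energy k t : abs2 (ucoef k t) + a * c / d * abs2 (vcoef k t) =
  abs2 (amp1 true k) + abs2 (amp1 false k) + a * c / d * (abs2 (amp2 true k) + abs2 (amp2 false k)).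
Proof.
have [k0|k0] := eqVneq k 0.
  rewrite /ucoef /vcoef /amp1 /amp2 k0 eqxx !mul0r !addr0 !abs2M !abs2_expi !mulr1 !abs2_0 !addr0//.
rewrite /ucoef /vcoef /amp2 (negbTE k0).
rewrite -[_ * amp1 true k * _]mulrA -[_ * amp1 false k * _]mulrA.
have E b : abs2 (amp1 b k * expi (freq b k * t)) = abs2 (amp1 b k).
  by rewrite abs2M abs2_expi mulr1.
by rewrite abs2_orth ?slope_orth// !(abs2M _ (amp1 _ _)) !abs2_real !E.
Qed.

End amplitudes.

End spectrum.

(** * Test functions and weak solutions *)

Section smooth_functions.
Context {R : realType}.
Local Notation mu := (@lebesgue_measure R).
Local Notation C := (R[i]).
Local Notation cre := (@complex.Re R).
Local Notation cim := (@complex.Im R).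
Implicit Types (f g : R -> R).

Fixpoint diffn (n : nat) (f : R -> R) : Prop :=
  if n is n'.+1 then (forall x, derivable f x 1) /\ diffn n' (derive1 f) else True.

Definition smooth1 f := forall n, diffn n f.

Lemma smooth1_derive f : smooth1 f -> smooth1 (derive1 f).
Proof. by move=> sf n; have [] := sf n.+1. Qed.

Lemma is_derive_derive1 f x : derivable f x 1 -> is_derive x (1 : R) f (derive1 f x).
Proof. by move=> df; apply: DeriveDef => //; rewrite derive1E. Qed.

Lemma smooth1_is_derive f x : smooth1 f -> is_derive x (1 : R) f (derive1 f x).
Proof. by move=> sf; apply: is_derive_derive1; have [] := sf 1%N. Qed.

Lemma smooth1_continuous f : smooth1 f -> continuous f.
Proof. by move=> sf; apply: is_derive_continuous => x; exact: smooth1_is_derive. Qed.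

Lemma derive1_of f f' : (forall x, is_derive x (1 : R) f (f' x)) -> derive1 f = f'.
Proof. by move=> h; apply/funext => x; rewrite derive1E; have [] := h x. Qed.

(** Avoids explicit iterated derivatives: it is enough to exhibit a family that contains the
    function and is closed under differentiation. *)
Lemma smooth1_coind (P : (R -> R) -> Prop) :
  (forall f, P f -> exists2 f', forall x, is_derive x (1 : R) f (f' x) & P f') ->
  forall f, P f -> smooth1 f.
Proof.
move=> h f Pf n; elim: n f Pf => // n IH f /h[f' df' Pf'] /=; split.
  by move=> x; have [] := df' x.
by rewrite (derive1_of df'); exact: IH.
Qed.

Lemma diffn_le n f : diffn n.+1 f -> diffn n f.
Proof. by elim: n f => // n IH f /= [df h]; split => //; exact: IH. Qed.

Lemma diffnD n f g : diffn n f -> diffn n g -> diffn n (fun x => f x + g x).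
Proof.
elim: n f g => // n IH f g [df hf] [dg hg].
have h x : is_derive x (1 : R) (fun x => f x + g x) (derive1 f x + derive1 g x).
  by apply: is_deriveD1; exact: is_derive_derive1.
split; first by move=> x; have [] := h x.
by rewrite (derive1_of h); exact: IH.
Qed.

Lemma diffnM n f g : diffn n f -> diffn n g -> diffn n (fun x => f x * g x).
Proof.
elim: n f g => // n IH f g F G; have [df hf] := F; have [dg hg] := G.
have h x : is_derive x (1 : R) (fun x => f x * g x) (derive1 f x * g x + f x * derive1 g x).
  by apply: is_deriveM1; exact: is_derive_derive1.
split; first by move=> x; have [] := h x.
by rewrite (derive1_of h); apply: diffnD; apply: IH => //; exact: diffn_le.
Qed.

Lemma is_deriveV1 f x (l : R) : f x != 0 -> is_derive x (1 : R) f l ->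
  is_derive x (1 : R) (fun y => (f y)^-1) (- l * ((f x)^-1 * (f x)^-1)).
Proof.
move=> fx0 [df fl]; apply: DeriveDef; first exact: derivableV.
rewrite deriveV// fl /GRing.scale /=; field; exact: fx0.
Qed.

Lemma diffn_cst n (k : R) : diffn n (fun=> k).
Proof.
elim: n k => // n IH k.
have h x : is_derive x (1 : R) (fun _ : R => k) ((fun=> 0) x) by exact: is_derive_cst.
split; first by move=> x; have [] := h x.
by rewrite (derive1_of h); exact: IH.
Qed.

Lemma diffnN n f : diffn n f -> diffn n (fun x => - f x).
Proof.
move=> hf; have -> : (fun x => - f x) = (fun x => -1 * f x) by apply/funext => x; rewrite mulN1r.
by apply: diffnM => //; exact: diffn_cst.
Qed.

Lemma diffnV n f : (forall x, f x != 0) -> diffn n f -> diffn n (fun x => (f x)^-1).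
Proof.
move=> f0; elim: n => // n IH F; have [df hf] := F.
have h x : is_derive x (1 : R) (fun x => (f x)^-1) (- derive1 f x * ((f x)^-1 * (f x)^-1)).
  by apply: is_deriveV1 => //; exact: is_derive_derive1.
split; first by move=> x; have [] := h x.
rewrite (derive1_of h); have Fn := diffn_le F.
by apply: diffnM; [exact: diffnN|apply: diffnM; exact: IH].
Qed.

Lemma smooth1D f g : smooth1 f -> smooth1 g -> smooth1 (fun x => f x + g x).
Proof. by move=> sf sg n; apply: diffnD. Qed.
Lemma smooth1M f g : smooth1 f -> smooth1 g -> smooth1 (fun x => f x * g x).
Proof. by move=> sf sg n; apply: diffnM. Qed.
Lemma smooth1_cst (k : R) : smooth1 (fun=> k).
Proof. by move=> n; exact: diffn_cst. Qed.

Lemma smooth1_affine f (w b : R) : smooth1 f -> smooth1 (fun x => f (w * x + b)).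
Proof.
move=> sf; apply: (@smooth1_coind (fun h => exists k g, smooth1 g /\ h = fun x => k * g (w * x + b))); last first.
  by exists 1, f; split => //; apply/funext => x; rewrite mul1r.
move=> _ [k [g [sg ->]]]; exists (fun x => k * w * derive1 g (w * x + b)); last first.
  by exists (k * w), (derive1 g); split => //; exact: smooth1_derive.
move=> x; have hg := smooth1_is_derive (w * x + b) sg.
have := is_deriveM1 (is_derive_cst k x (1 : R)) (is_derive_comp1 (is_derive_affine w b x) hg).
by move=> /is_derive_eq; apply; rewrite mul0r add0r mulrA mulrAC.
Qed.

Lemma smooth1_cos (w : R) : smooth1 (fun x => cos (w * x)).
Proof.
apply: (@smooth1_coind (fun h => exists p q, h = fun x => p * cos (w * x) + q * sin (w * x))); last first.
  by exists 1, 0; apply/funext => x; rewrite mul1r mul0r addr0.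
move=> _ [p [q ->]]; exists (fun x => (q * w) * cos (w * x) + (- p * w) * sin (w * x)); last by exists (q * w), (- p * w).
move=> x; have ha : is_derive x (1 : R) (fun y => w * y) w.
  by have := is_derive_affine w 0 x; under eq_fun do rewrite addr0.
have h1 := is_derive_comp1 ha (is_derive_cos _); have h2 := is_derive_comp1 ha (is_derive_sin _).
have := is_deriveD1 (is_deriveM1 (is_derive_cst p x (1 : R)) h1) (is_deriveM1 (is_derive_cst q x (1 : R)) h2).
by move=> /is_derive_eq; apply; rewrite /cst; ring.
Qed.

Lemma derive1_cos_lin (w : R) : derive1 (fun x => cos (w * x)) = fun x => - w * sin (w * x).
Proof.
apply: derive1_of => x; have ha : is_derive x (1 : R) (fun y => w * y) w.
  by have := is_derive_affine w 0 x; under eq_fun do rewrite addr0.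
have := is_derive_comp1 ha (is_derive_cos _).
by move=> /is_derive_eq; apply; ring.
Qed.

Lemma derive1_sin_lin (w : R) : derive1 (fun x => sin (w * x)) = fun x => w * cos (w * x).
Proof.
apply: derive1_of => x; have ha : is_derive x (1 : R) (fun y => w * y) w.
  by have := is_derive_affine w 0 x; under eq_fun do rewrite addr0.
have := is_derive_comp1 ha (is_derive_sin _).
by move=> /is_derive_eq; apply; ring.
Qed.

Lemma smooth1_sin (w : R) : smooth1 (fun x => sin (w * x)).
Proof.
have [->|w0] := eqVneq w 0.
  by under eq_fun do rewrite mul0r; exact: smooth1_cst.
have := smooth1M (smooth1_cst (- w^-1)) (smooth1_derive (smooth1_cos w)).
rewrite derive1_cos_lin; under eq_fun do rewrite mulrA mulrNN mulVf// mul1r.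
by [].
Qed.

Lemma poly_le_expR (p : {poly R}) (m : nat) :
  exists2 K, 0 <= K & forall y, 0 <= y -> `|p.[y]| * y ^+ m <= K * expR y.
Proof.
elim/poly_ind: p m => [|p c IH] m.
  by exists 0 => // y _; rewrite horner0 normr0 !mul0r.
have [K K0 hK] := IH m.+1.
exists (K + `|c| * m`!%:R); first by rewrite addr_ge0// mulr_ge0.
move=> y y0; rewrite !hornerE.
have hm : y ^+ m <= m`!%:R * expR y.
  case: m {K K0 hK} => [|m]; first by rewrite expr0 fact0 mul1r; have := expR_ge1Dx y; lra.
  have := expR_ge1Dxn m y0; have f0 : 0 < m.+1`!%:R :> R by rewrite ltr0n fact_gt0.
  move=> h; rewrite mulrC -ler_pdivrMr//; lra.
have := hK y y0; rewrite exprS mulrA => h1.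
apply: (@le_trans _ _ ((`|p.[y] * y| + `|c|) * y ^+ m)).
  by rewrite ler_wpM2r ?exprn_ge0// ler_normD.
rewrite normrM [`|y|]ger0_norm// !mulrDl lerD// -mulrA ler_wpM2l//.
Qed.

(** The functions p(1/x) e^(-1/x) extended by 0. The family is closed under differentiation, [p]
    being replaced by X^2 (p - p'), which gives smoothness by [smooth1_coind]. *)
Definition flat (p : {poly R}) (x : R) : R :=
  if 0 < x then p.[x^-1] * expR (- x^-1) else 0.

Lemma flat_quadratic p : exists2 K, 0 <= K & forall x, `|flat p x| <= K * x ^+ 2.
Proof.
have [K K0 hK] := poly_le_expR p 2; exists K => // x; rewrite /flat.
case: ifPn => x0; last by rewrite normr0 mulr_ge0 ?sqr_ge0.
have := hK x^-1; rewrite invr_ge0 (ltW x0) => /(_ isT).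
rewrite normrM [`|expR _|]ger0_norm ?expR_ge0// expRN ler_pdivrMr ?expR_gt0// exprVn ler_pdivrMr ?exprn_gt0//.
by rewrite mulrAC.
Qed.

(** Handles the junction point 0 of the [flat] functions, where neither formula holds on a
    neighbourhood. *)
Lemma is_derive_quadratic f (K : R) : 0 <= K -> (forall x, `|f x| <= K * x ^+ 2) ->
  is_derive (0 : R) (1 : R) f 0.
Proof.
move=> K0 fK; have f0 : f 0 = 0.
  by apply/eqP; rewrite -normr_le0; apply: le_trans (fK 0) _; rewrite expr0n mulr0.
have L : h^-1 *: ((f \o shift (0 : R)) (h *: (1 : R)) - f 0) @[h --> 0^'] --> (0 : R).
  apply/cvgrPdist_le => e e0.
  have K1 : 0 < K + 1 by lra.
  near=> h; rewrite sub0r normrN /= f0 subr0 addr0 /GRing.scale /= mulr1.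
  have h0 : h != 0 by near: h; exact: nbhs_dnbhs_neq.
  rewrite normrM normfV ler_pdivrMl ?normr_gt0//.
  apply: (le_trans (fK h)); rewrite -[h ^+ 2]real_normK ?num_real// expr2 mulrCA ler_wpM2l//.
  have hh : `|h| <= e / (K + 1).
    near: h; apply: dnbhs0_le; exact: divr_gt0.
  apply: (@le_trans _ _ ((K + 1) * `|h|)); first by rewrite ler_wpM2r// lerDl.
  by rewrite -ler_pdivlMl// mulrC.
apply: DeriveDef; first by apply/cvg_ex; exists 0.
exact: cvg_lim.
Unshelve. all: by end_near. Qed.

Lemma is_derive_flat p x : is_derive x (1 : R) (flat p) (flat ('X^2 * (p - deriv p)) x).
Proof.
have [x0|x0|<-] := ltgtP 0 x.
- rewrite (_ : flat ('X^2 * _) x = ('X^2 * (p - deriv p)).[x^-1] * expR (- x^-1)); last by rewrite /flat x0.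
  apply: (@near_eq_is_derive R R^o R^o (fun y => p.[y^-1] * expR (- y^-1))).
    near=> y; rewrite /flat ifT//.
    near: y; exact: lt_nbhsr.
  have xn0 : x != 0 by rewrite gt_eqF.
  have hV := is_deriveV1 xn0 (is_derive_id x (1 : R)).
  have hp := is_derive_comp1 hV (is_derive_poly p x^-1).
  have he := is_derive_comp1 (is_deriveN1 hV) (is_derive_expR (- x^-1)).
  have := is_deriveM1 hp he.
  move=> /is_derive_eq; apply; rewrite hornerM hornerXn hornerD hornerN; ring.
- have nx : (0 < x) = false by apply/negbTE; rewrite -leNgt ltW.
  rewrite (_ : flat ('X^2 * _) x = 0); last by rewrite /flat nx.
  have h0 : is_derive x (1 : R) (fun _ : R => (0 : R)) 0 by exact: is_derive_cst.
  apply: near_eq_is_derive h0.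
  near=> y; rewrite /flat ifF//; apply/negbTE; rewrite -leNgt ltW//.
  near: y; exact: lt_nbhsl.
- have [K K0 hK] := flat_quadratic p.
  rewrite (_ : flat ('X^2 * _) 0 = 0); last by rewrite /flat ltxx.
  exact: is_derive_quadratic hK.
Unshelve. all: by end_near. Qed.

Lemma smooth1_flat p : smooth1 (flat p).
Proof.
apply: (@smooth1_coind (fun h => exists p, h = flat p)); last by exists p.
move=> _ [q ->]; exists (flat ('X^2 * (q - deriv q))); last by eexists.
by move=> x; exact: is_derive_flat.
Qed.

Definition bump0 : R -> R := flat 1.

Lemma bump0_gt0 x : 0 < x -> 0 < bump0 x.
Proof. by move=> x0; rewrite /bump0 /flat x0 hornerE mul1r expR_gt0. Qed.

Lemma bump0_le0 x : x <= 0 -> bump0 x = 0.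
Proof. by move=> x0; rewrite /bump0 /flat ltNge x0. Qed.

Lemma bump0_ge0 x : 0 <= bump0 x.
Proof. by have [/bump0_le0 ->//|/bump0_gt0/ltW] := leP x 0. Qed.

Lemma derive_bump0_ge0 x : 0 <= derive1 bump0 x.
Proof.
rewrite (derive1_of (is_derive_flat 1)) /flat; case: ifPn => // x0.
by rewrite derivC subr0 mulr1 hornerXn mulr_ge0 ?expR_ge0// exprn_ge0// invr_ge0 ltW.
Qed.

(** The standard smooth transition from 0 to 1 across [0, 1]; its derivative is a non-negative bump
    of integral 1. *)
Definition sstep (x : R) : R := bump0 x / (bump0 x + bump0 (1 - x)).

Lemma sstep_den x : 0 < bump0 x + bump0 (1 - x).
Proof.
have [x0|x0] := ltP 0 x; first by rewrite ltr_pwDl ?bump0_gt0 ?bump0_ge0.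
by rewrite ltr_wpDl ?bump0_ge0// bump0_gt0//; lra.
Qed.

Lemma bump1E : (fun x => bump0 (1 - x)) = (fun x => bump0 (-1 * x + 1)).
Proof. by apply/funext => x; rewrite mulN1r addrC. Qed.

Lemma smooth1_sstep : smooth1 sstep.
Proof.
have s0 : smooth1 bump0 by exact: smooth1_flat.
have s1 : smooth1 (fun x => bump0 (1 - x)) by rewrite bump1E; exact: smooth1_affine.
apply: smooth1M => // n; apply: diffnV; first by move=> x; rewrite gt_eqF// sstep_den.
by apply: diffnD; [exact: s0|exact: s1].
Qed.

Lemma sstep_le0 x : x <= 0 -> sstep x = 0.
Proof. by move=> x0; rewrite /sstep bump0_le0// mul0r. Qed.

Lemma sstep_ge1 x : 1 <= x -> sstep x = 1.
Proof.
move=> x1; rewrite /sstep [bump0 (1 - x)]bump0_le0 ?addr0 ?subr_le0// divff//.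
by rewrite gt_eqF// bump0_gt0//; lra.
Qed.

Lemma derive_sstep_ge0 x : 0 <= derive1 sstep x.
Proof.
have s0 : smooth1 bump0 by exact: smooth1_flat.
have h0 := smooth1_is_derive x s0.
have h1 : is_derive x (1 : R) (fun x => bump0 (1 - x)) (derive1 bump0 (1 - x) * -1).
  rewrite bump1E; have := is_derive_comp1 (is_derive_affine (-1) 1 x) (smooth1_is_derive (-1 * x + 1) s0).
  by rewrite mulN1r [- x + 1]addrC.
have den0 : bump0 x + bump0 (1 - x) != 0 by rewrite gt_eqF// sstep_den.
have hd := is_deriveM1 h0 (is_deriveV1 (f := fun x => bump0 x + bump0 (1 - x)) den0 (is_deriveD1 h0 h1)).
rewrite derive1E; have [_ ->] := hd.
set A := bump0 x in den0 *; set B := bump0 (1 - x) in den0 *.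
have -> : derive1 bump0 x * (A + B)^-1 + A * (- (derive1 bump0 x + derive1 bump0 (1 - x) * -1) * ((A + B)^-1 * (A + B)^-1)) =
  (derive1 bump0 x * B + A * derive1 bump0 (1 - x)) / (A + B) ^+ 2 by field.
by rewrite divr_ge0 ?sqr_ge0// addr_ge0// mulr_ge0 ?derive_bump0_ge0 ?bump0_ge0.
Qed.

Definition test1 f := smooth1 f /\ exists M : R, forall t, M < `|t| -> f t = 0.

Lemma Rintegral_support f (p q : R) : (forall t, (t < p) || (q < t) -> f t = 0) ->
  \int[mu]_t f t = \int[mu]_(t in `[p, q]) f t.
Proof.
move=> hf; rewrite [RHS]Rintegral_mkcond; congr Rintegral; apply/funext => t.
rewrite patchE; case: ifPn => //; rewrite mem_setE in_itv /= negb_and -!ltNge => /hf.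
by [].
Qed.

Lemma weighted_le (p q k : R) (rho h : R -> R) : continuous rho -> continuous h ->
  (forall t, 0 <= rho t) -> (forall t, p <= t -> t <= q -> h t <= k) ->
  \int[mu]_(t in `[p, q]) (rho t * h t) <= (\int[mu]_(t in `[p, q]) rho t) * k.
Proof.
move=> cr ch r0 hk; rewrite -RintegralZr//; last exact: continuous_integrable.
apply: le_Rintegral => //.
- by apply: continuous_integrable => t; apply: cvgM; [exact: cr|exact: ch].
- by apply: continuous_integrable => t; apply: cvgM; [exact: cr|exact: cvg_cst].
- by move=> t /=; rewrite in_itv /= => /andP[h1 h2]; rewrite ler_wpM2l// hk.
Qed.

Lemma weighted_ge (p q k : R) (rho h : R -> R) : continuous rho -> continuous h ->
  (forall t, 0 <= rho t) -> (forall t, p <= t -> t <= q -> k <= h t) ->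
  (\int[mu]_(t in `[p, q]) rho t) * k <= \int[mu]_(t in `[p, q]) (rho t * h t).
Proof.
move=> cr ch r0 hk; rewrite -RintegralZr//; last exact: continuous_integrable.
apply: le_Rintegral => //.
- by apply: continuous_integrable => t; apply: cvgM; [exact: cr|exact: cvg_cst].
- by apply: continuous_integrable => t; apply: cvgM; [exact: cr|exact: ch].
- by move=> t /=; rewrite in_itv /= => /andP[h1 h2]; rewrite ler_wpM2l// hk.
Qed.

Lemma quarters_lt (p q : R) : p < q -> p + (q - p) / 4 + (q - p) / 4 < q.
Proof. by lra. Qed.

Lemma far_away (x y e t : R) : 0 < e -> `|x| + `|y| + e < `|t| ->
  x + e <= t /\ y + e <= t \/ t <= x /\ t <= y.
Proof.
have := ler_norm x; have := ler_norm y; have := ler_norm (- x); have := ler_norm (- y); rewrite !normrN.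
by have [tp|tn] := ger0P t => *; [left|right]; split; lra.
Qed.

Lemma osc_right (h : R -> R) (x e e1 g : R) : e < e1 ->
  (forall t, `|x - t| < e1 -> `|h x - h t| < g) ->
  forall t, x <= t -> t <= x + e -> h x - g <= h t /\ h t <= h x + g.
Proof.
move=> ee hx t xt tx; have : `|h x - h t| < g by apply: hx; rewrite ltr_norml; apply/andP; split; lra.
by rewrite ltr_norml => /andP[h1 h2]; split; lra.
Qed.

(* Testing against the difference of two steps compares local averages of [h]
   near x and y. *)
Lemma du_bois_reymond (h : R -> R) : continuous h ->
  (forall f, test1 f -> \int[mu]_t (derive1 f t * h t) = 0) ->
  forall x y, h x = h y.
Proof.
move=> ch H; suff key x y : ~ (h x < h y).
  move=> x y; apply/eqP; rewrite eq_le.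
  by apply/andP; split; rewrite leNgt; apply/negP; exact: key.
(* A quarter of the gap: local averages within [g] of [h x] and of [h y] cannot be equal. *)
move=> hxy; pose m := (h x + h y) / 2; pose g := (h y - h x) / 4.
have g0 : 0 < g by rewrite divr_gt0// subr_gt0.
have [e1 e10 he1] : exists2 e, 0 < e & forall t, `|x - t| < e -> `|h x - h t| < g.
  have /cvgrPdist_lt/(_ _ g0) := ch x.
  by rewrite -[X in X -> _]/(\forall t \near x, `|h x - h t| < g) => /nbhs_ballP[e e0 he]; exists e.
have [e2 e20 he2] : exists2 e, 0 < e & forall t, `|y - t| < e -> `|h y - h t| < g.
  have /cvgrPdist_lt/(_ _ g0) := ch y.
  by rewrite -[X in X -> _]/(\forall t \near y, `|h y - h t| < g) => /nbhs_ballP[e e0 he]; exists e.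
pose e := Num.min e1 e2 / 2; have e0 : 0 < e by rewrite divr_gt0// lt_min e10.
have ee1 : e < e1.
  have : Num.min e1 e2 <= e1 by rewrite ge_min lexx.
  rewrite /e; lra.
have ee2 : e < e2.
  have : Num.min e1 e2 <= e2 by rewrite ge_min lexx orbT.
  rewrite /e; lra.
pose S z t := sstep (e^-1 * t + - (e^-1 * z)).
have Sarg z t : e^-1 * t + - (e^-1 * z) = (t - z) / e by rewrite mulrBl mulrC [z / e]mulrC.
have sS z : smooth1 (S z) by exact: smooth1_affine smooth1_sstep.
have S0 z t : t <= z -> S z t = 0.
  by move=> tz; rewrite /S sstep_le0// Sarg ler_pdivrMr// mul0r subr_le0.
have S1 z t : z + e <= t -> S z t = 1.
  by move=> tz; rewrite /S sstep_ge1// Sarg ler_pdivlMr// mul1r; lra.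
have dS z t : is_derive t (1 : R) (S z) (derive1 (S z) t) by exact: smooth1_is_derive.
have dS0 z t : 0 <= derive1 (S z) t.
  rewrite derive1E.
  have [_ ->] := is_derive_comp1 (is_derive_affine e^-1 (- (e^-1 * z)) t) (smooth1_is_derive _ smooth1_sstep).
  by rewrite mulr_ge0 ?derive_sstep_ge0// invr_ge0 ltW.
have dSout z t : (t < z) || (z + e < t) -> derive1 (S z) t = 0.
  move=> zt; rewrite derive1E; case/orP: zt => zt.
    have -> : 'D_1 (S z) t = 'D_1 (cst (0 : R)) t.
      apply: near_eq_derive; near=> u; apply: S0; apply: ltW.
      by near: u; exact: lt_nbhsl.
    by rewrite derive_cst.
  have -> : 'D_1 (S z) t = 'D_1 (cst (1 : R)) t.
    apply: near_eq_derive; near=> u; apply: S1; apply: ltW.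
    by near: u; exact: lt_nbhsr.
  by rewrite derive_cst.
have cdS z : continuous (derive1 (S z)) by apply: smooth1_continuous; exact: smooth1_derive.
have ie z : z <= z + e by rewrite lerDl ltW.
have int1 z : \int[mu]_(t in `[z, z + e]) derive1 (S z) t = 1.
  rewrite (FTC2_Rintegral (dS z) (cdS z) (ie z)) S1// S0//; exact: subr0.
have supp z : \int[mu]_t (derive1 (S z) t * h t) = \int[mu]_(t in `[z, z + e]) (derive1 (S z) t * h t).
  by apply: Rintegral_support => t /dSout ->; rewrite mul0r.
have cM z : continuous (fun t => derive1 (S z) t * h t).
  by move=> t; apply: cvgM; [exact: cdS|exact: ch].
have ibig z : mu.-integrable setT (EFin \o (fun t => derive1 (S z) t * h t)).
  have i0 := continuous_integrable z (z + e) (cM z).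
  have := (@integrable_mkcond _ _ R mu `[z, z + e]%classic (EFin \o (fun t => derive1 (S z) t * h t)) (measurable_itv _)).1 i0.
  apply: eq_integrable => // t _; rewrite patchE; case: ifPn => //.
  rewrite mem_setE in_itv /= negb_and -!ltNge => /dSout ->; by rewrite mul0r.
have tst : test1 (fun t => S x t + -1 * S y t).
  split; first by apply: smooth1D => //; apply: smooth1M => //; exact: smooth1_cst.
  exists (`|x| + `|y| + e) => t /(far_away e0)[[h1 h2]|[h1 h2]].
    by rewrite !S1// mulr1 subrr.
  by rewrite !S0// mulr0 addr0.
have dSxy : derive1 (fun t => S x t + -1 * S y t) = fun t => derive1 (S x) t + -1 * derive1 (S y) t.
  have D u : is_derive u (1 : R) (fun t => S x t + -1 * S y t) (derive1 (S x) u + -1 * derive1 (S y) u).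
    have := is_deriveD1 (dS x u) (is_deriveM1 (is_derive_cst (-1 : R) u (1 : R)) (dS y u)).
    by rewrite mul0r add0r.
  exact: derive1_of D.
have E : \int[mu]_(t in `[x, x + e]) (derive1 (S x) t * h t) =
    \int[mu]_(t in `[y, y + e]) (derive1 (S y) t * h t).
  rewrite -(supp x) -(supp y); apply/eqP; rewrite -subr_eq0.
  rewrite -(@RintegralB _ _ R mu _ _ _ measurableT (ibig x) (ibig y)) -(H _ tst) dSxy.
  by apply/eqP; apply: eq_Rintegral => t _; rewrite mulrDl mulN1r mulNr.
have up : \int[mu]_(t in `[x, x + e]) (derive1 (S x) t * h t) <= h x + g.
  have W : forall t, x <= t -> t <= x + e -> h t <= h x + g.
    by move=> t xt tx; have [] := osc_right ee1 he1 xt tx.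
  by have := weighted_le (cdS x) ch (dS0 x) W; rewrite int1 mul1r.
have lo : h y - g <= \int[mu]_(t in `[y, y + e]) (derive1 (S y) t * h t).
  have W : forall t, y <= t -> t <= y + e -> h y - g <= h t.
    by move=> t xt tx; have [] := osc_right ee2 he2 xt tx.
  by have := weighted_ge (cdS y) ch (dS0 y) W; rewrite int1 mul1r.
have := le_trans lo (eq_ind _ (fun z => z <= h x + g) up _ E).
by rewrite lerBlDr leNgt => /negP; apply; exact: quarters_lt.
Unshelve. all: by end_near. Qed.

End smooth_functions.

(** * Test functions in product form *)

Section product_test_functions.
Context {R : realType}.
Implicit Types (f g : R -> R) (F : R * R -> R).

Lemma derive_fst F z : 'D_((1, 0) : R * R) F z = 'D_(1 : R) (fun s => F (s, z.2)) z.1 /\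
  (derivable F z ((1, 0) : R * R) <-> derivable (fun s => F (s, z.2)) z.1 1).
Proof.
have E : (fun h : R => h^-1 *: ((F \o shift z) (h *: ((1, 0) : R * R)) - F z)) =
    (fun h : R => h^-1 *: (((fun s => F (s, z.2)) \o shift z.1) (h *: (1 : R)) - F (z.1, z.2))).
  apply/funext => h; case: z => z1 z2 /=; congr (_ *: (F _ - _)).
  transitivity (h *: (1 : R) + z1, h *: (0 : R) + z2) => //; by rewrite scaler0 add0r.
by rewrite /derive /derivable E.
Qed.

Lemma derive_snd F z : 'D_((0, 1) : R * R) F z = 'D_(1 : R) (fun s => F (z.1, s)) z.2 /\
  (derivable F z ((0, 1) : R * R) <-> derivable (fun s => F (z.1, s)) z.2 1).
Proof.
have E : (fun h : R => h^-1 *: ((F \o shift z) (h *: ((0, 1) : R * R)) - F z)) =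
    (fun h : R => h^-1 *: (((fun s => F (z.1, s)) \o shift z.2) (h *: (1 : R)) - F (z.1, z.2))).
  apply/funext => h; case: z => z1 z2 /=; congr (_ *: (F _ - _)).
  transitivity (h *: (0 : R) + z1, h *: (1 : R) + z2) => //; by rewrite scaler0 add0r.
by rewrite /derive /derivable E.
Qed.

Definition tensor f g : R * R -> R := fun z => f z.1 * g z.2.

Lemma derivable_tensor f g z : smooth1 f -> smooth1 g ->
  [/\ derivable (tensor f g) z ((1, 0) : R * R), derivable (tensor f g) z ((0, 1) : R * R),
      dt (tensor f g) z = tensor (derive1 f) g z & dx (tensor f g) z = tensor f (derive1 g) z].
Proof.
move=> sf sg.
have [E1 D1] := derive_fst (tensor f g) z; have [E2 D2] := derive_snd (tensor f g) z.
have h1 : is_derive z.1 (1 : R) (fun s => f s * g z.2) (derive1 f z.1 * g z.2).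
  have := is_deriveM1 (smooth1_is_derive z.1 sf) (is_derive_cst (g z.2) z.1 (1 : R)).
  by rewrite mulr0 addr0.
have h2 : is_derive z.2 (1 : R) (fun s => f z.1 * g s) (f z.1 * derive1 g z.2).
  have := is_deriveM1 (is_derive_cst (f z.1) z.2 (1 : R)) (smooth1_is_derive z.2 sg).
  by rewrite mul0r add0r.
split.
- by apply/D1; have [] := h1.
- by apply/D2; have [] := h2.
- by rewrite /dt E1; have [_ ->] := h1.
- by rewrite /dx E2; have [_ ->] := h2.
Qed.

Lemma dt_tensor f g : smooth1 f -> smooth1 g -> dt (tensor f g) = tensor (derive1 f) g.
Proof. by move=> sf sg; apply/funext => z; have [] := derivable_tensor z sf sg. Qed.

Lemma dx_tensor f g : smooth1 f -> smooth1 g -> dx (tensor f g) = tensor f (derive1 g).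
Proof. by move=> sf sg; apply/funext => z; have [] := derivable_tensor z sf sg. Qed.

(** Every iterated partial derivative of a product f(t) g(x) is again such a product. *)
Lemma smooth_tensor f g : smooth1 f -> smooth1 g -> smooth (tensor f g).
Proof.
move=> sf sg s.
have [f' [g' [sf' sg' ->]]] : exists f' g', [/\ smooth1 f', smooth1 g' & partials s (tensor f g) = tensor f' g'].
  elim: s => [|b s [f' [g' [sf' sg' E]]]]; first by exists f, g.
  rewrite /= -/(partials s (tensor f g)) E; case: b.
    by exists (derive1 f'), g'; split => //; [exact: smooth1_derive|exact: dt_tensor].
  by exists f', (derive1 g'); split => //; [exact: smooth1_derive|exact: dx_tensor].
split; last 2 first.
- by move=> z; have [] := derivable_tensor z sf' sg'.
- by move=> z; have [] := derivable_tensor z sf' sg'.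
move=> z; apply: cvgM.
  by apply: (cvg_comp fst f'); [exact: cvg_fst|exact: smooth1_continuous].
by apply: (cvg_comp snd g'); [exact: cvg_snd|exact: smooth1_continuous].
Qed.

Lemma test_tensor f g : test1 f -> smooth1 g -> (forall x, g (x + 2 * pi) = g x) ->
  test_function (tensor f g).
Proof.
move=> [sf [M hM]] sg pg; split.
- exact: smooth_tensor.
- by move=> t x; rewrite /tensor /= pg.
- by exists M => t x tM; rewrite /tensor /= hM// mul0r.
Qed.

Lemma test1_derive f : test1 f -> test1 (derive1 f).
Proof.
move=> [sf [M hM]]; split; first exact: smooth1_derive.
exists M => t tM; rewrite derive1E.
have -> : 'D_1 f t = 'D_1 (cst (0 : R)) t.
  apply: near_eq_derive; near=> u; apply: hM.
  by near: u; apply: (cvgr_gt `|t|) tM; exact: norm_continuous.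
by rewrite derive_cst.
Unshelve. all: by end_near. Qed.

Lemma test1Ml f g : test1 f -> smooth1 g -> test1 (fun t => f t * g t).
Proof.
move=> [sf [M hM]] sg; split; first exact: smooth1M.
by exists M => t /hM ->; rewrite mul0r.
Qed.

End product_test_functions.

(** * Weak solutions of scalar linear equations in time *)

Section weak_exponentials.
Context {R : realType}.
Local Notation mu := (@lebesgue_measure R).
Local Notation C := (R[i]).
Local Notation cre := (@complex.Re R).
Local Notation cim := (@complex.Im R).
Implicit Types (f g : R -> R) (y : R -> C).

Lemma ccontinuous_real f : continuous f -> ccontinuous (fun t => (f t)%:C%C).
Proof. by move=> cf; split=> //= t; exact: cvg_cst. Qed.

Lemma compact_cintegrable y (M : R) : ccontinuous y -> (forall t, M < `|t| -> y t = 0) ->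
  cintegrable setT y.
Proof.
move=> cy hM.
have [h1 h2] := ccontinuous_cintegrable (- M) M cy.
have out t : t \notin `[- M, M]%classic -> y t = 0.
  rewrite mem_setE in_itv /= => tM; apply: hM; rewrite ltNge ler_norml; exact: tM.
split.
  have := (@integrable_mkcond _ _ R mu `[- M, M]%classic _ (measurable_itv _)).1 h1.
  apply: eq_integrable => // t _; rewrite patchE; case: ifPn => // /out.
  by rewrite /= => ->.
have := (@integrable_mkcond _ _ R mu `[- M, M]%classic _ (measurable_itv _)).1 h2.
apply: eq_integrable => // t _; rewrite patchE; case: ifPn => // /out.
by rewrite /= => ->.
Qed.

Lemma test1_cintegrable f y : test1 f -> ccontinuous y -> cintegrable setT (fun t => (f t)%:C%C * y t).
Proof.
move=> [sf [M hM]] cy; apply: (@compact_cintegrable _ M).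
  by apply: ccontinuousM => //; apply: ccontinuous_real; exact: smooth1_continuous.
by move=> t /hM ->; rewrite mul0r.
Qed.

Lemma weak_constant y : ccontinuous y ->
  (forall f, test1 f -> cintegral setT (fun t => (derive1 f t)%:C%C * y t) = 0) ->
  forall t, y t = y 0.
Proof.
move=> [c1 c2] H t; apply: complexP.
  apply: (du_bois_reymond c1) => f /H /(congr1 cre) /= <-.
  by apply: eq_Rintegral => x _; rewrite creM /= mul0r subr0.
apply: (du_bois_reymond c2) => f /H /(congr1 cim) /= <-.
by apply: eq_Rintegral => x _; rewrite cimM /= mul0r addr0.
Qed.

Lemma linear_comb0 (k w A B A' B' : C) : A + w * A' = 0 -> B + w * B' = 0 ->
  A + k * B + w * (A' + k * B') = 0.
Proof.
move=> hA hB; have -> : A + k * B + w * (A' + k * B') = (A + w * A') + k * (B + w * B') by ring.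
by rewrite hA hB mulr0 addr0.
Qed.

Lemma cintegral_comb4 (D : set R) (k w : C) (f g h l : R -> C) : measurable D ->
  cintegrable D f -> cintegrable D g -> cintegrable D h -> cintegrable D l ->
  cintegral D (fun t => f t + k * g t + w * (h t + k * l t)) =
  cintegral D f + k * cintegral D g + w * (cintegral D h + k * cintegral D l).
Proof.
move=> mD fD gD hD lD.
have kg := cintegrableZ k mD gD; have kl := cintegrableZ k mD lD.
have hl := cintegrableD mD hD kl; have fg := cintegrableD mD fD kg.
by rewrite cintegralD ?cintegralD ?cintegralZ ?cintegralD ?cintegralZ//; exact: cintegrableZ.
Qed.

(** The function y(t) e^(-i w t) has zero weak derivative: the equation tested with f cos(wt), minus
    i times the equation tested with f sin(wt), is the equation tested with the complex function f
    e^(-i w t). *)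
Lemma weak_exponential (w : R) y : ccontinuous y ->
  (forall f, test1 f -> cintegral setT (fun t => (derive1 f t)%:C%C * y t)
     + (0 +i* w)%C * cintegral setT (fun t => (f t)%:C%C * y t) = 0) ->
  forall t, y t = y 0 * expi (w * t).
Proof.
move=> cy H t.
have ce : ccontinuous (fun t => expi (- w * t)) by exact: ccontinuous_expiZ.
have key : forall t, y t * expi (- w * t) = y 0 * expi (- w * 0).
  apply: (@weak_constant (fun t => y t * expi (- w * t))); first exact: ccontinuousM.
  move=> f tf; have sf := tf.1.
  have t1 : test1 (fun t => f t * cos (w * t)) by apply: test1Ml => //; exact: smooth1_cos.
  have t2 : test1 (fun t => f t * sin (w * t)) by apply: test1Ml => //; exact: smooth1_sin.
  have D1 : derive1 (fun t => f t * cos (w * t)) = fun t => derive1 f t * cos (w * t) + f t * (- w * sin (w * t)).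
    apply: derive1_of => s; apply: is_deriveM1; first exact: smooth1_is_derive.
    by have := smooth1_is_derive s (smooth1_cos w); rewrite derive1_cos_lin.
  have D2 : derive1 (fun t => f t * sin (w * t)) = fun t => derive1 f t * sin (w * t) + f t * (w * cos (w * t)).
    apply: derive1_of => s; apply: is_deriveM1; first exact: smooth1_is_derive.
    by have := smooth1_is_derive s (smooth1_sin w); rewrite derive1_sin_lin.
  have i1 := test1_cintegrable t1 cy; have i2 := test1_cintegrable t2 cy.
  have j1 := test1_cintegrable (test1_derive t1) cy; have j2 := test1_cintegrable (test1_derive t2) cy.
  have mT : measurable [set: R] by exact: measurableT.
  pose A := cintegral setT (fun t => (derive1 (fun t => f t * cos (w * t)) t)%:C%C * y t).
  pose B := cintegral setT (fun t => (derive1 (fun t => f t * sin (w * t)) t)%:C%C * y t).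
  pose A' := cintegral setT (fun t => (f t * cos (w * t))%:C%C * y t).
  pose B' := cintegral setT (fun t => (f t * sin (w * t))%:C%C * y t).
  have hA : A + (0 +i* w)%C * A' = 0 := H _ t1.
  have hB : B + (0 +i* w)%C * B' = 0 := H _ t2.
  pose ii : C := (0 -i* 1)%C.
  have K : A + ii * B + ((0 +i* w)%C * (A' + ii * B')) = 0.
    exact: linear_comb0 hA hB.
  rewrite -K -cintegral_comb4//.
  apply: eq_cintegral => s _; rewrite D1 D2 mulNr expiN /expi.
  by case: (y s) => p q; apply: complexP => /=; ring.
rewrite -[LHS]mulr1 -(expi0 (R := R)).
have -> : expi (0 : R) = expi (- w * t) * expi (w * t) by rewrite -expiD mulNr addNr.
by rewrite mulrA key mulr0 expi0 mulr1.
Qed.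

End weak_exponentials.

(** * The energy norm and the continuity of scalar functionals along trajectories *)

Section energy_norm.
Context {R : realType}.
Local Notation mu := (@lebesgue_measure R).
Local Notation C := (R[i]).
Local Notation cre := (@complex.Re R).
Local Notation cim := (@complex.Im R).
Variables (a c d : R).
Hypotheses (a0 : 0 < a) (c0 : 0 < c) (d0 : 0 < d).
Implicit Types (z : @state R) (w : @trajectory R).

Lemma acd_gt0 : 0 < a * c / d.
Proof. by rewrite divr_gt0// mulr_gt0. Qed.

Lemma sqnormHE z : inH z -> sqnormH a c d z = nrm2 circle z.1 + a * c / d * nrm2 circle z.2.
Proof.
move=> [[_ _ i1] [_ _ i2]]; have mC := @measurable_circle R.
rewrite /sqnormH RintegralD ?RintegralZl//.
exact: integrableZlR.
Qed.

Lemma sqnormH_ge0 z : 0 <= sqnormH a c d z.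
Proof.
apply: Rintegral_ge0 => x _; rewrite addr_ge0 ?abs2_ge0// mulr_ge0 ?abs2_ge0//.
exact/ltW/acd_gt0.
Qed.

Lemma normH_sqr z : normH a c d z ^+ 2 = sqnormH a c d z.
Proof. by rewrite sqr_sqrtr// sqnormH_ge0. Qed.

Lemma inH_sub z z' : inH z -> inH z' -> inH (subH z z').
Proof. by move=> [h1 h2] [h3 h4]; split; apply: L2B => //; exact: measurable_circle. Qed.

Lemma nrm2_fst_le z : inH z -> nrm2 circle z.1 <= sqnormH a c d z.
Proof.
by move=> zH; rewrite sqnormHE// lerDl mulr_ge0 ?nrm2_ge0// ltW// acd_gt0.
Qed.

Lemma nrm2_snd_le z : inH z -> nrm2 circle z.2 <= (a * c / d)^-1 * sqnormH a c d z.
Proof.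
move=> zH; rewrite sqnormHE// mulrDr mulrA mulVf ?gt_eqF ?acd_gt0// mul1r lerDr.
by rewrite mulr_ge0 ?nrm2_ge0// invr_ge0 ltW// acd_gt0.
Qed.

(** Transfers the continuity of a trajectory, with [N] the norm of an increment, to bounded linear
    functionals of it. *)
Lemma abs2_dominated_continuous (y : R -> C) (N : R -> R -> R) (K : R) : 0 <= K ->
  (forall t, N s t @[s --> t] --> (0 : R)) ->
  (forall s t, abs2 (y s - y t) <= K * N s t ^+ 2) -> ccontinuous y.
Proof.
move=> K0 cN hy.
have aux (h : R -> R) : (forall s t, (h s - h t) ^+ 2 <= abs2 (y s - y t)) -> continuous h.
  move=> hh t; apply/cvgrPdist_le => e e0.
  have k1 : 0 < Num.sqrt K + 1 by rewrite ltr_wpDl ?sqrtr_ge0.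
  have /cvgrPdist_le/(_ (e / (Num.sqrt K + 1)))/(_ (divr_gt0 e0 k1)) H := cN t.
  near=> s; have : `|0 - N s t| <= e / (Num.sqrt K + 1) by near: s.
  rewrite sub0r normrN ler_pdivlMr// => Ns.
  rewrite -sqrtr_sqr; apply: (@le_trans _ _ (Num.sqrt (K * N s t ^+ 2))).
    rewrite ler_sqrt; last by rewrite mulr_ge0// sqr_ge0.
    by rewrite -sqrrN opprB; exact: le_trans (hh s t) (hy s t).
  rewrite sqrtrM// sqrtr_sqr mulrC; apply: le_trans Ns.
  by rewrite ler_wpM2l// lerDl.
split; apply: aux => s t.
  by have := Re_sqr_le_abs2 (y s - y t); rewrite creB.
by have := Im_sqr_le_abs2 (y s - y t); rewrite cimB.
Unshelve. all: by end_near. Qed.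

Lemma inCb_pairing_continuous w (g : R -> C) : inCb a c d w -> L2 circle g ->
  ccontinuous (fun t => cintegral circle (fun x => (w t).1 x * g x)) /\
  ccontinuous (fun t => cintegral circle (fun x => (w t).2 x * g x)).
Proof.
move=> [wH wc _] gL; have mC := @measurable_circle R.
have E (u v : R -> C) : L2 circle u -> L2 circle v ->
    cintegral circle (fun x => u x * g x) - cintegral circle (fun x => v x * g x) =
    cintegral circle (fun x => (u x - v x) * g x).
  move=> uL vL; have i1 := cintegrable_L2M mC uL gL; have i2 := cintegrable_L2M mC vL gL.
  rewrite -[X in _ - X]mul1r -mulNr -cintegralZ// -cintegralD//; last exact: cintegrableZ.
  by apply: eq_cintegral => x _; ring.
have b2 := acd_gt0.
split.
  apply: (@abs2_dominated_continuous _ (fun s t => normH a c d (subH (w s) (w t))) (nrm2 circle g)) => //.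
    exact: nrm2_ge0.
  move=> s t; have [h1 _] := wH s; have [h2 _] := wH t; rewrite E//.
  apply: (le_trans (cauchy_schwarz mC (L2B mC h1 h2) gL)).
  rewrite mulrC ler_wpM2l ?nrm2_ge0// normH_sqr.
  exact: (nrm2_fst_le (inH_sub (wH s) (wH t))).
apply: (@abs2_dominated_continuous _ (fun s t => normH a c d (subH (w s) (w t))) (nrm2 circle g * (a * c / d)^-1)) => //.
  by rewrite mulr_ge0 ?nrm2_ge0// invr_ge0 ltW.
move=> s t; have [_ h1] := wH s; have [_ h2] := wH t; rewrite E//.
apply: (le_trans (cauchy_schwarz mC (L2B mC h1 h2) gL)).
rewrite mulrC -mulrA ler_wpM2l ?nrm2_ge0// normH_sqr.
exact: (nrm2_snd_le (inH_sub (wH s) (wH t))).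
Qed.

End energy_norm.

(** * Pairings with trigonometric test functions *)

Section trigonometric_tests.
Context {R : realType}.
Local Notation mu := (@lebesgue_measure R).
Local Notation C := (R[i]).
Implicit Types (f g : R -> R) (u : R -> R -> C) (k : int).

(** Test functions are real, so e^(-i k x) is reached through its real and imaginary parts. The span
    of the two is closed under differentiation, which only changes the coefficients. *)
Definition trig k (p q : R) (x : R) : R := p * cos (k%:~R * x) + q * sin (k%:~R * x).

Lemma smooth1_trig k p q : smooth1 (trig k p q).
Proof.
apply: smooth1D; apply: smooth1M; [exact: smooth1_cst|exact: smooth1_cos|
  exact: smooth1_cst|exact: smooth1_sin].
Qed.

Lemma derive1_trig k p q : derive1 (trig k p q) = trig k (q * k%:~R) (- p * k%:~R).
Proof.
apply: derive1_of => x; set K : R := k%:~R.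
have h1 := smooth1_is_derive x (smooth1_cos K); rewrite derive1_cos_lin in h1.
have h2 := smooth1_is_derive x (smooth1_sin K); rewrite derive1_sin_lin in h2.
have := is_deriveD1 (is_deriveM1 (is_derive_cst p x (1 : R)) h1) (is_deriveM1 (is_derive_cst q x (1 : R)) h2).
by move=> /is_derive_eq; apply; rewrite /trig /cst; ring.
Qed.

Lemma trig_periodic k p q x : trig k p q (x + 2 * pi) = trig k p q x.
Proof.
have E : expi (k%:~R * (x + 2 * pi)) = expi (k%:~R * x) :> C.
  by rewrite mulrDr expiD expi_2pi mulr1.
by rewrite /trig; have := congr1 (@complex.Re R) E; have := congr1 (@complex.Im R) E => /= -> ->.
Qed.

Lemma test_trig f k p q : test1 f -> test_function (tensor f (trig k p q)).
Proof. by move=> tf; apply: test_tensor => //; [exact: smooth1_trig|exact: trig_periodic]. Qed.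

Lemma dt_trig f k p q : smooth1 f -> dt (tensor f (trig k p q)) = tensor (derive1 f) (trig k p q).
Proof. by move=> sf; apply: dt_tensor => //; exact: smooth1_trig. Qed.

Lemma dx_trig f k p q : smooth1 f ->
  dx (tensor f (trig k p q)) = tensor f (trig k (q * k%:~R) (- p * k%:~R)).
Proof. by move=> sf; rewrite dx_tensor ?derive1_trig//; exact: smooth1_trig. Qed.

Lemma dx3_trig f k p q : smooth1 f ->
  iter 3 dx (tensor f (trig k p q)) = tensor f (trig k (- q * k%:~R ^+ 3) (p * k%:~R ^+ 3)).
Proof. by move=> sf; rewrite /= !dx_trig//; congr (tensor _ (trig _ _ _)); ring. Qed.

Definition wcos u k t : C := cintegral circle (fun x => u t x * (cos (k%:~R * x))%:C%C).
Definition wsin u k t : C := cintegral circle (fun x => u t x * (sin (k%:~R * x))%:C%C).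

Lemma L2_real_continuous f : continuous f -> L2 circle (fun x => (f x)%:C%C).
Proof. by move=> cf; apply: ccontinuous_L2_circle; exact: ccontinuous_real. Qed.

Lemma L2_cosk k : L2 circle (fun x => (cos (k%:~R * x))%:C%C : C).
Proof. by apply: L2_real_continuous; apply: smooth1_continuous; exact: smooth1_cos. Qed.
Lemma L2_sink k : L2 circle (fun x => (sin (k%:~R * x))%:C%C : C).
Proof. by apply: L2_real_continuous; apply: smooth1_continuous; exact: smooth1_sin. Qed.

Lemma pairing_trig u f k (p q : R) : (forall t, L2 circle (u t)) -> test1 f ->
  ccontinuous (wcos u k) -> ccontinuous (wsin u k) ->
  pairing u (tensor f (trig k p q)) =
    p%:C%C * cintegral setT (fun t => (f t)%:C%C * wcos u k t) +
    q%:C%C * cintegral setT (fun t => (f t)%:C%C * wsin u k t).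
Proof.
move=> uL tf cc cs; have mC := @measurable_circle R.
have i1 := test1_cintegrable tf cc; have i2 := test1_cintegrable tf cs.
rewrite -!cintegralZ// -cintegralD//; last 2 first.
- exact: cintegrableZ.
- exact: cintegrableZ.
apply: eq_cintegral => t _.
have j1 := cintegrable_L2M mC (uL t) (L2_cosk k); have j2 := cintegrable_L2M mC (uL t) (L2_sink k).
rewrite /wcos /wsin -!cintegralZ//; try by [exact: cintegrableZ].
rewrite -cintegralD//; last 2 first.
- by do 2 apply: cintegrableZ => //.
- by do 2 apply: cintegrableZ => //.
apply: eq_cintegral => x _; rewrite /tensor /trig /=.
by case: (u t x) => ? ?; apply: complexP => /=; ring.
Qed.

Lemma fourier_coef_trig (g : R -> C) k : L2 circle g ->
  cintegral circle (fun x => g x * (cos (k%:~R * x))%:C%C) +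
    (0 -i* 1)%C * cintegral circle (fun x => g x * (sin (k%:~R * x))%:C%C) =
  (2 * pi)%:C%C * fourier_coef g k.
Proof.
move=> gL; have mC := @measurable_circle R.
have j1 := cintegrable_L2M mC gL (L2_cosk k); have j2 := cintegrable_L2M mC gL (L2_sink k).
rewrite -cintegralZ// -cintegralD//; last exact: cintegrableZ.
have -> : (2 * pi)%:C%C * fourier_coef g k = cintegral circle (fun x => g x * expi (- (k%:~R * x))).
  by rewrite /fourier_coef mulrA -rmorphM /= mulfV ?rmorph1 ?mul1r// gt_eqF// pi2_gt0.
apply: eq_cintegral => x _; rewrite expiN /expi.
by case: (g x) => ? ?; apply: complexP => /=; ring.
Qed.

End trigonometric_tests.

(** * The Fourier coefficients of a weak solution *)

Section weak_modes.
Context {R : realType}.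
Local Notation mu := (@lebesgue_measure R).
Local Notation C := (R[i]).
Variables (a c d r : R).
Hypotheses (a0 : 0 < a) (c0 : 0 < c) (d0 : 0 < d) (r0 : 0 < r).
Implicit Types (z : @state R) (w : @trajectory R) (k : int).

(** The equation tested with cos, minus i times the one tested with sin, is the equation for the
    k-th coefficient, up to a constant factor. The P are pairings with cos and the Q with sin; their
    coefficients are left in the unsimplified form that differentiating [trig] produces. *)
Lemma weak_combine1 (K : R) (p A' B' A B AV BV X' X Y P1 P2 P3 Q1 Q2 Q3 : C) :
  P1 = 1%:C%C * A' + 0%:C%C * B' -> P2 = (- 0 * K ^+ 3)%:C%C * A + (1 * K ^+ 3)%:C%C * B ->
  P3 = (- 0 * K ^+ 3)%:C%C * AV + (1 * K ^+ 3)%:C%C * BV ->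
  Q1 = 0%:C%C * A' + 1%:C%C * B' -> Q2 = (- 1 * K ^+ 3)%:C%C * A + (0 * K ^+ 3)%:C%C * B ->
  Q3 = (- 1 * K ^+ 3)%:C%C * AV + (0 * K ^+ 3)%:C%C * BV ->
  X' = p * (A' + (0 -i* 1)%C * B') -> X = p * (A + (0 -i* 1)%C * B) ->
  Y = p * (AV + (0 -i* 1)%C * BV) ->
  - P1 + (-1) ^+ 3 * P2 + a%:C%C * ((-1) ^+ 3 * P3) = 0 ->
  - Q1 + (-1) ^+ 3 * Q2 + a%:C%C * ((-1) ^+ 3 * Q3) = 0 ->
  X' + (0 +i* K ^+ 3)%C * (X + a%:C%C * Y) = 0.
Proof.
move=> -> -> -> -> -> -> -> -> -> e1 e2.
have := congr2 (fun x y : C => p * (- x + (0 +i* 1)%C * y)) e1 e2; rewrite /= !(oppr0, mulr0, addr0) => <-.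
case: p {e1 e2} => ? ?; case: A' => ? ?; case: B' => ? ?; case: A => ? ?; case: B => ? ?; case: AV => ? ?; case: BV => ? ?.
by apply: complexP => /=; ring.
Qed.

Lemma weak_combine2 (K : R) (p A' B' A B AV BV X' X Y P1 P2 P3 P4 Q1 Q2 Q3 Q4 : C) :
  P1 = 1%:C%C * A' + 0%:C%C * B' -> P2 = (0 * K)%:C%C * AV + (- 1 * K)%:C%C * BV ->
  P3 = (- 0 * K ^+ 3)%:C%C * AV + (1 * K ^+ 3)%:C%C * BV ->
  P4 = (- 0 * K ^+ 3)%:C%C * A + (1 * K ^+ 3)%:C%C * B ->
  Q1 = 0%:C%C * A' + 1%:C%C * B' -> Q2 = (1 * K)%:C%C * AV + (- 0 * K)%:C%C * BV ->
  Q3 = (- 1 * K ^+ 3)%:C%C * AV + (0 * K ^+ 3)%:C%C * BV ->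
  Q4 = (- 1 * K ^+ 3)%:C%C * A + (0 * K ^+ 3)%:C%C * B ->
  X' = p * (A' + (0 -i* 1)%C * B') -> X = p * (A + (0 -i* 1)%C * B) ->
  Y = p * (AV + (0 -i* 1)%C * BV) ->
  c%:C%C * - P1 + r%:C%C * ((-1) ^+ 1 * P2) + (-1) ^+ 3 * P3 + d%:C%C * ((-1) ^+ 3 * P4) = 0 ->
  c%:C%C * - Q1 + r%:C%C * ((-1) ^+ 1 * Q2) + (-1) ^+ 3 * Q3 + d%:C%C * ((-1) ^+ 3 * Q4) = 0 ->
  c%:C%C * X' + (0 +i* (K ^+ 3 - r * K))%C * Y + (0 +i* (d * K ^+ 3))%C * X = 0.
Proof.
move=> -> -> -> -> -> -> -> -> -> -> -> e1 e2.
have := congr2 (fun x y : C => p * (- x + (0 +i* 1)%C * y)) e1 e2; rewrite /= !(oppr0, mulr0, addr0) => <-.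
case: p {e1 e2} => ? ?; case: A' => ? ?; case: B' => ? ?; case: A => ? ?; case: B => ? ?; case: AV => ? ?; case: BV => ? ?.
by apply: complexP => /=; ring.
Qed.

(* Testing with f(t) cos(kx) and f(t) sin(kx). *)
Lemma solution_weak_ode z w k f : solution a c d r z w -> test1 f ->
  let U t := fourier_coef (w t).1 k in let V t := fourier_coef (w t).2 k in
  let I (g : R -> R) (y : R -> C) := cintegral setT (fun t => (g t)%:C%C * y t) in
  [/\ ccontinuous U, ccontinuous V,
   I (derive1 f) U + (0 +i* k%:~R ^+ 3)%C * (I f U + a%:C%C * I f V) = 0 &
   c%:C%C * I (derive1 f) V + (0 +i* (k%:~R ^+ 3 - r * k%:~R))%C * I f V
      + (0 +i* (d * k%:~R ^+ 3))%C * I f U = 0].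
Proof.
move=> [wC h1 h2 _] tf U V I; have mC := @measurable_circle R; have tf' := test1_derive tf.
have wH : forall t, inH (w t) by case: wC.
have uL t : L2 circle ((w t).1) by case: (wH t).
have vL t : L2 circle ((w t).2) by case: (wH t).
have [Ccu Ccv] := inCb_pairing_continuous a0 c0 d0 wC (L2_cosk k).
have [Csu Csv] := inCb_pairing_continuous a0 c0 d0 wC (L2_sink k).
pose u t := (w t).1; pose v t := (w t).2.
have Upi t : wcos u k t + (0 -i* 1)%C * wsin u k t = (2 * pi)%:C%C * U t := fourier_coef_trig k (uL t).
have Vpi t : wcos v k t + (0 -i* 1)%C * wsin v k t = (2 * pi)%:C%C * V t := fourier_coef_trig k (vL t).
have div2 (A B : C) : A = (2 * pi)%:C%C * B -> B = (2 * pi)^-1%:C%C * A.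
  by move=> ->; rewrite mulrA -rmorphM /= mulVf ?rmorph1 ?mul1r// gt_eqF// pi2_gt0.
have cU : ccontinuous U.
  rewrite (_ : U = fun t => (2 * pi)^-1%:C%C * (wcos u k t + (0 -i* 1)%C * wsin u k t)).
    by apply: ccontinuousZ; apply: ccontinuousD => //; exact: ccontinuousZ.
  by apply/funext => t; apply: div2.
have cV : ccontinuous V.
  rewrite (_ : V = fun t => (2 * pi)^-1%:C%C * (wcos v k t + (0 -i* 1)%C * wsin v k t)).
    by apply: ccontinuousZ; apply: ccontinuousD => //; exact: ccontinuousZ.
  by apply/funext => t; apply: div2.
have toC (g : R -> R) (p q y : R -> C) : test1 g -> ccontinuous p -> ccontinuous q ->
    (forall t, p t + (0 -i* 1)%C * q t = (2 * pi)%:C%C * y t) ->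
    I g y = (2 * pi)^-1%:C%C * (I g p + (0 -i* 1)%C * I g q).
  move=> tg cp cq pq; have ip := test1_cintegrable tg cp; have iq := test1_cintegrable tg cq.
  rewrite /I -cintegralZ// -cintegralD//; last exact: cintegrableZ.
  rewrite -cintegralZ//; last by apply: cintegrableD => //; exact: cintegrableZ.
  by apply: eq_cintegral => t _; rewrite (div2 _ _ (pq t)); ring.
have eU := toC f _ _ _ tf Ccu Csu Upi; have eV := toC f _ _ _ tf Ccv Csv Vpi.
have eU' := toC _ _ _ _ tf' Ccu Csu Upi; have eV' := toC _ _ _ _ tf' Ccv Csv Vpi.
have pu p q := pairing_trig p q uL tf Ccu Csu; have pv p q := pairing_trig p q vL tf Ccv Csv.
have pu' p q := pairing_trig p q uL tf' Ccu Csu; have pv' p q := pairing_trig p q vL tf' Ccv Csv.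
clear div2 toC Upi Vpi; split => //.
  have e1 := h1 _ (test_trig k 1 0 tf); have e2 := h1 _ (test_trig k 0 1 tf).
  move: e1 e2; rewrite /dist_dt /dist_dx !dt_trig ?dx3_trig; try exact: tf.1.
  exact: weak_combine1 (pu' _ _) (pu _ _) (pv _ _) (pu' _ _) (pu _ _) (pv _ _) eU' eU eV.
have e1 := h2 _ (test_trig k 1 0 tf); have e2 := h2 _ (test_trig k 0 1 tf).
move: e1 e2; rewrite /dist_dt /dist_dx !dt_trig ?dx3_trig ?dx_trig; try exact: tf.1.
rewrite /iter !dx_trig; try exact: tf.1.
exact: weak_combine2 (pv' _ _) (pv _ _) (pv _ _) (pu _ _) (pv' _ _) (pv _ _) (pv _ _) (pu _ _) eV' eU eV.
Qed.

(** V - [slope (~~ b)] U annihilates the component on the branch [~~ b], so it is one exponential of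
    frequency [freq b]. The two slopes differ, hence the two combinations determine U and V. *)
Lemma modes_of_exponentials (U V : R -> C) (x y : int -> C) k : U 0 = x k -> V 0 = y k ->
  (forall b t, V t - (slope a c d r (~~ b) k)%:C%C * U t =
     (V 0 - (slope a c d r (~~ b) k)%:C%C * U 0) * expi (freq a c d r b k * t)) ->
  forall t, U t = ucoef a c d r x y k t /\ V t = vcoef a c d r x y k t.
Proof.
move=> U0 V0 E t; have := E true t; have := E false t; rewrite U0 V0 /= => Ef Et.
have sg := slope_gap r a0 c0 d0 k; rewrite /ucoef /vcoef /amp2 /amp1.
case: eqP => [k0|_].
  (* Both combinations are constant here. The slopes are those of e = 0, as [small 0] = 0, and still
     differ, so U and V are constant. *)
  have f0 b : freq a c d r b k = 0 by rewrite k0 freqN0.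
  rewrite !f0 !mul0r !expi0 !mulr1 !addr0 in Ef Et *.
  set s := slope a c d r true k in sg Ef Et; set s' := slope a c d r false k in sg Ef Et.
  have sn : s - s' != 0 by rewrite gt_eqF.
  have EU : U t = x k.
    have : (s - s')%:C%C * (U t - x k) = 0.
      have := congr2 (fun p q : C => p - q) Et Ef.
      move=> /eqP; rewrite -subr_eq0 => /eqP <-; rewrite rmorphB; ring.
    move/eqP; rewrite mulf_eq0 subr_eq0 => /orP[|/eqP//].
    by rewrite -(rmorph0 (real_complex R)) (inj_eq (@complexI R)) (negbTE sn).
  by split=> //; move: Et; rewrite EU => /addIr.
set s := slope a c d r true k in sg Ef Et *; set s' := slope a c d r false k in sg Ef Et *.
have sn : s - s' != 0 by rewrite gt_eqF.
set e1 := expi _ in Et *; set e2 := expi _ in Ef *.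
have EU : U t = (s - s')^-1%:C%C * ((y k - s'%:C%C * x k) * e1 - (y k - s%:C%C * x k) * e2).
  rewrite -Et -Ef.
  by case: (U t) => ? ?; case: (V t) => ? ?; apply: complexP => /=; field.
have EV : V t = s'%:C%C * U t + (y k - s'%:C%C * x k) * e1 by rewrite -Et; ring.
split; last rewrite EV; rewrite EU.
  case: (x k) => ? ?; case: (y k) => ? ?; case: e1 {EU EV Et} => ? ?; case: e2 {Ef} => ? ?.
  by apply: complexP => /=; field.
case: (x k) => ? ?; case: (y k) => ? ?; case: e1 {EU EV Et} => ? ?; case: e2 {Ef} => ? ?.
by apply: complexP => /=; field.
Qed.

(** The two components of a left eigenvector equation: the row (- [slope (~~ b)], 1) is an
    eigenvector of the matrix of mode k for [freq b]. Both follow from the sum of the eigenvalues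
    and the product in [lam_orth]. *)
Lemma slope_recurrence b k : let K : R := k%:~R in
  (K ^+ 3 - r * K) / c = a * slope a c d r (~~ b) k * K ^+ 3 + freq a c d r b k /\
  d * K ^+ 3 / c = slope a c d r (~~ b) k * (K ^+ 3 - freq a c d r b k).
Proof.
move=> K; have [k0|k0] := eqVneq k 0.
  by rewrite /K k0 freqN0 !expr0n /= !mulr0 !subr0 !mul0r mulr0 addr0.
have K0 : K != 0 by rewrite intr_eq0.
have cn := lt0r_neq0 c0; have an := lt0r_neq0 a0.
have es : small r k * K ^+ 2 = r by rewrite /small divfK// expf_neq0.
have hadd := lam_add a d c0 (small r k); have horth := lam_orth a0 c0 d0 (small r k).
rewrite /slope /freq -/K; set e := small r k in hadd horth es *; set lt := lam _ _ _ true e in hadd horth *.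
set lf := lam _ _ _ false e in hadd horth *.
have hadd' : c * (lt + lf) = c + 1 - e by rewrite hadd; field.
have horth' : c * ((lt - 1) * (lf - 1)) = - (a * d) by rewrite horth; field.
have rK : r * K = e * K ^+ 3 by rewrite -es; ring.
rewrite rK; split.
  apply: (mulfI cn); transitivity (K ^+ 3 * (1 - e)); first by field.
  have -> : 1 - e = c * (lt + lf) - c by rewrite hadd'; ring.
  by case: b => /=; rewrite -/lt -/lf; field.
apply: (mulfI cn); apply: (mulfI an); transitivity (K ^+ 3 * (a * d)); first by field.
have -> : a * d = - (c * ((lt - 1) * (lf - 1))) by rewrite horth'; ring.
by case: b => /=; rewrite -/lt -/lf; field.
Qed.

Lemma combine_modes (s om K : R) (U V U' V' : C) :
  (K ^+ 3 - r * K) / c = a * s * K ^+ 3 + om -> d * K ^+ 3 / c = s * (K ^+ 3 - om) ->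
  U' + (0 +i* K ^+ 3)%C * (U + a%:C%C * V) = 0 ->
  c%:C%C * V' + (0 +i* (K ^+ 3 - r * K))%C * V + (0 +i* (d * K ^+ 3))%C * U = 0 ->
  V' + (- s)%:C%C * U' + (0 +i* om)%C * (V + (- s)%:C%C * U) = 0.
Proof.
move=> h1 h2 e1 e2; have cn := lt0r_neq0 c0.
have k1 : K ^+ 3 - r * K = c * (a * s * K ^+ 3 + om) by rewrite -h1; field.
have k2 : d * K ^+ 3 = c * (s * (K ^+ 3 - om)) by rewrite -h2; field.
have := congr2 (fun p q : C => c^-1%:C%C * q - s%:C%C * p) e1 e2; rewrite !mulr0 subr0 => <-.
rewrite k1 k2; clear -cn.
case: U => ? ?; case: V => ? ?; case: U' => ? ?; case: V' => ? ?.
by apply: complexP => /=; field.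
Qed.

(** The left eigenvectors decouple the two weak equations of mode k into scalar ones, solved by
    [weak_exponential]. Uniqueness, conservation of energy and the form of the traces all rest on
    this identification. *)
Lemma solution_coef z w k : inH z -> solution a c d r z w -> forall t,
  fourier_coef (w t).1 k = ucoef a c d r (fourier_coef z.1) (fourier_coef z.2) k t /\
  fourier_coef (w t).2 k = vcoef a c d r (fourier_coef z.1) (fourier_coef z.2) k t.
Proof.
move=> zH sol; have [wC _ _ w0] := sol; have wH : forall t, inH (w t) by case: wC.
apply: (modes_of_exponentials (U := fun t => fourier_coef (w t).1 k) (V := fun t => fourier_coef (w t).2 k)).
- apply: fourier_coef_ae_eq; [exact: (wH 0).1|exact: zH.1|].
  by apply: (@filterS _ _ (ae_filter_ringOfSetsType mu) _ _ _ w0) => x h /h[].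
- apply: fourier_coef_ae_eq; [exact: (wH 0).2|exact: zH.2|].
  by apply: (@filterS _ _ (ae_filter_ringOfSetsType mu) _ _ _ w0) => x h /h[].
move=> b; set s := slope _ _ _ _ _ _.
(* Any test function serves here, only the continuity of the coefficients being extracted. *)
have t0 : test1 (fun _ : R => 0 : R) by split; [exact: smooth1_cst|exists 0].
have [cU cV _ _] := solution_weak_ode k sol t0.
apply: (weak_exponential (y := fun t => fourier_coef (w t).2 k - s%:C%C * fourier_coef (w t).1 k)).
  by apply: ccontinuousB => //; exact: ccontinuousZ.
move=> f tf; have [_ _ e1 e2] := solution_weak_ode k sol tf.
have [h1 h2] := slope_recurrence b k; rewrite -/s in h1 h2.
have split2 g : test1 g -> cintegral setT (fun t => (g t)%:C%C * (fourier_coef (w t).2 k - s%:C%C * fourier_coef (w t).1 k)) =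
    cintegral setT (fun t => (g t)%:C%C * fourier_coef (w t).2 k) + (- s)%:C%C * cintegral setT (fun t => (g t)%:C%C * fourier_coef (w t).1 k).
  move=> tg; have i1 := test1_cintegrable tg cU; have i2 := test1_cintegrable tg cV.
  rewrite -cintegralZ// -cintegralD//; last exact: cintegrableZ.
  by apply: eq_cintegral => t _; rewrite rmorphN; ring.
rewrite (split2 _ tf) (split2 _ (test1_derive tf)).
exact: combine_modes h1 h2 e1 e2.
Qed.

End weak_modes.

(** * Existence and uniqueness *)

Section test_calculus.
Context {R : realType}.
Local Notation mu := (@lebesgue_measure R).
Local Notation C := (R[i]).
Local Notation cre := (@complex.Re R).
Local Notation cim := (@complex.Im R).
Implicit Types (phi psi : R * R -> R) (g F : R -> C).

(** The head of the list in [partials] is the outermost derivative, so a derivative taken first goes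
    at the end of the list. *)
Lemma smooth_partial (b : bool) phi : smooth phi -> smooth (if b then dt phi else dx phi).
Proof.
move=> sp s; have := sp (rcons s b).
rewrite /partials -cats1 foldr_cat /= -/(partials s _).
by case: b.
Qed.

Lemma smooth_dt phi : smooth phi -> smooth (dt phi). Proof. exact: (@smooth_partial true). Qed.
Lemma smooth_dx phi : smooth phi -> smooth (dx phi). Proof. exact: (@smooth_partial false). Qed.

Lemma smooth_continuous phi : smooth phi -> continuous phi.
Proof. by move=> /(_ [::])[]. Qed.

Lemma is_derive_dt phi t x : smooth phi -> is_derive t (1 : R) (fun s => phi (s, x)) (dt phi (t, x)).
Proof.
move=> /(_ [::])[_ h _]; have [E D] := derive_fst phi (t, x).
exact: (DeriveDef (D.1 (h (t, x))) (esym E)).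
Qed.

Lemma is_derive_dx phi t x : smooth phi -> is_derive x (1 : R) (fun s => phi (t, s)) (dx phi (t, x)).
Proof.
move=> /(_ [::])[_ _ h]; have [E D] := derive_snd phi (t, x).
exact: (DeriveDef (D.1 (h (t, x))) (esym E)).
Qed.

Lemma continuous_slice phi t : continuous phi -> continuous (fun x => phi (t, x)).
Proof.
move=> cp x; apply: (cvg_comp (fun x : R => (t, x)) phi); last exact: cp.
exact: (cvg_pair (cvg_cst t) (@cvg_id _ (nbhs x))).
Qed.

Lemma test_dt phi : test_function phi -> test_function (dt phi).
Proof.
move=> [sp pp [M hM]]; split; first exact: smooth_dt.
- move=> t x; have h := is_derive_dt t (x + 2 * pi) sp; have h' := is_derive_dt t x sp.
  have [_ <-] := h; have [_ <-] := h'; congr ('D_1 _ t).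
  by apply/funext => s; rewrite pp.
- exists M => t x tM; have [_ <-] := is_derive_dt t x sp.
  have -> : 'D_1 (fun s => phi (s, x)) t = 'D_1 (cst (0 : R)) t.
    apply: near_eq_derive; near=> u; apply: hM.
    by near: u; apply: (cvgr_gt `|t|) tM; exact: norm_continuous.
  by rewrite derive_cst.
Unshelve. all: by end_near. Qed.

Lemma test_dx phi : test_function phi -> test_function (dx phi).
Proof.
move=> [sp pp [M hM]]; split; first exact: smooth_dx.
- move=> t x; have h := is_derive_dx t (x + 2 * pi) sp; have h' := is_derive_dx t x sp.
  have ha : is_derive x (1 : R) (fun y => y + 2 * pi) 1.
    by have := is_derive_affine 1 (2 * pi) x; under eq_fun do rewrite mul1r.
  have := is_derive_comp1 ha h; rewrite mulr1 => -[_ <-].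
  have [_ <-] := h'; congr ('D_1 _ x).
  by apply/funext => s; rewrite pp.
- exists M => t x tM; have [_ <-] := is_derive_dx t x sp.
  have -> : (fun s => phi (t, s)) = cst (0 : R) by apply/funext => s; rewrite hM.
  by rewrite derive_cst.
Qed.

(** Compactness of the closed period makes continuity in time uniform in x. *)
Lemma near_slice psi t (e : R) : continuous psi -> 0 < e ->
  \forall s \near t, forall x, 0 <= x <= 2 * pi -> `|psi (s, x) - psi (t, x)| <= e.
Proof.
move=> cp e0; have e2 : 0 < e / 2 by rewrite divr_gt0.
have /compact_near_coveringP cov := @segment_compact R 0 (2 * pi).
have := cov R (nbhs t) (fun s x => `|psi (s, x) - psi (t, x)| <= e).
have key (x : R) : `[0, 2 * pi]%classic x ->
    \forall x' \near x & s \near t, `|psi (s, x') - psi (t, x')| <= e.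
  move=> _; have /cvgrPdist_lt/(_ _ e2) := cp (t, x).
  move=> /nbhs_ballP[del d0 hd]; exists (ball x del, ball t del) => /=.
    by split; exact: nbhsx_ballx.
  move=> [x' s] /= [bx bs].
  have h1 : `|psi (t, x) - psi (s, x')| < e / 2 by apply: hd; split.
  have h2 : `|psi (t, x) - psi (t, x')| < e / 2 by apply: hd; split => //; exact: ballxx.
  have -> : psi (s, x') - psi (t, x') = (psi (t, x) - psi (t, x')) - (psi (t, x) - psi (s, x')) by ring.
  by apply: (le_trans (ler_normB _ _)); lra.
move=> /(_ _ key); apply: filterS => s hs x xI.
by apply: hs; rewrite /= in_itv.
Qed.

Lemma bounded_slices psi (M : R) : continuous psi -> exists2 B, 0 <= B &
  forall t x, `|t| <= M -> 0 <= x <= 2 * pi -> `|psi (t, x)| <= B.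
Proof.
move=> cp; have [M0|M0] := ltP M 0.
  by exists 0 => // t x tM; have := le_lt_trans tM M0; rewrite normr_lt0.
have cA : compact (`[- M, M] `*` `[0, 2 * pi] : set (R * R)).
  by apply: compact_setX; exact: segment_compact.
have A0 : (`[- M, M] `*` `[0, 2 * pi] : set (R * R)) !=set0.
  exists (0, 0); split; rewrite /= in_itv /= ?lexx ?oppr_le0 ?M0//.
  exact/ltW/pi2_gt0.
have [|c _ hc] := @compact_EVT_max _ R (fun z => `|psi z|) _ A0 cA.
  by apply: continuous_subspaceT => z; apply: cvg_norm; exact: cp.
exists `|psi c| => // t x tM xI; apply: (hc (t, x)); rewrite inE; split => /=.
  by rewrite in_itv /= -ler_norml.
by rewrite in_itv.
Qed.

Lemma nrm2_circle_le F (K : R) : ccontinuous F ->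
  (forall x, 0 <= x <= 2 * pi -> abs2 (F x) <= K) -> nrm2 circle F <= 2 * pi * K.
Proof.
move=> cF hF; have p0 := @pi2_gt0 R.
have -> : nrm2 circle F = nrm2 `[0, 2 * pi]%classic F.
  have [_ _ i] := ccontinuous_L2_circle cF.
  by rewrite /nrm2 /circle Rintegral_itv_bndo_bndc.
have -> : 2 * pi * K = K * (2 * pi - 0) by rewrite subr0 mulrC.
apply: nrm2_le_bound => //; first exact: ltW.
by move=> x xI x2; apply: hF; rewrite xI.
Qed.

Lemma ccontinuous_slice psi t : continuous psi -> ccontinuous (fun x => (psi (t, x))%:C%C).
Proof. by move=> cp; apply: ccontinuous_real; exact: continuous_slice. Qed.

Definition xint g psi t : C := cintegral circle (fun x => g x * (psi (t, x))%:C%C).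

Lemma xint_bound g F (e : R) : L2 circle g -> ccontinuous F -> 0 <= e ->
  (forall x, 0 <= x <= 2 * pi -> abs2 (F x) <= e) ->
  abs2 (cintegral circle (fun x => g x * F x)) <= nrm2 circle g * (2 * pi * e).
Proof.
move=> gL cF e0 hF; have mC := @measurable_circle R.
apply: (le_trans (cauchy_schwarz mC gL (ccontinuous_L2_circle cF))).
by rewrite ler_wpM2l ?nrm2_ge0// nrm2_circle_le.
Qed.

Lemma cintegrable_slice g psi t : L2 circle g -> continuous psi ->
  cintegrable circle (fun x => g x * (psi (t, x))%:C%C).
Proof.
move=> gL cp; apply: cintegrable_L2M => //; first exact: measurable_circle.
by apply: ccontinuous_L2_circle; exact: ccontinuous_slice.
Qed.

Lemma xint_comb g psi psi' psi'' (k : R) s t t' : L2 circle g ->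
  continuous psi -> continuous psi' -> continuous psi'' ->
  k%:C%C * (xint g psi s - xint g psi' t) - xint g psi'' t' =
  cintegral circle (fun x => g x * (k * (psi (s, x) - psi' (t, x)) - psi'' (t', x))%:C%C).
Proof.
move=> gL c1 c2 c3; have mC := @measurable_circle R.
have i1 := cintegrable_slice s gL c1; have i2 := cintegrable_slice t gL c2.
have i3 := cintegrable_slice t' gL c3.
have i2' := cintegrableZ (-1) mC i2; have i12 := cintegrableD mC i1 i2'.
have k12 := cintegrableZ k%:C%C mC i12; have i3' := cintegrableZ (-1) mC i3.
transitivity (k%:C%C * (xint g psi s + (-1) * xint g psi' t) + (-1) * xint g psi'' t'); first by ring.
rewrite /xint -!cintegralZ// -cintegralD// -cintegralZ// -cintegralD//.
apply: eq_cintegral => x _; case: (g x) => p q; apply: complexP => /=; ring.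
Qed.

Lemma xint_continuous g psi : L2 circle g -> continuous psi -> ccontinuous (xint g psi).
Proof.
move=> gL cp; have p0 := @pi2_gt0 R.
pose N s t := Num.sqrt (abs2 (xint g psi s - xint g psi t)).
apply: (@abs2_dominated_continuous _ _ N 1) => //; last first.
  by move=> s t; rewrite mul1r sqr_sqrtr// abs2_ge0.
move=> t; apply/cvgrPdist_le => e e0.
have b0 : 0 < nrm2 circle g * (2 * pi) + 1 by rewrite ltr_wpDl// mulr_ge0 ?nrm2_ge0// ltW.
have E0 : 0 < e / (nrm2 circle g * (2 * pi) + 1 + 1).
  by rewrite divr_gt0//; lra.
have de : 0 < Num.sqrt (e ^+ 2 / (nrm2 circle g * (2 * pi) + 1)) by rewrite sqrtr_gt0 divr_gt0// exprn_gt0.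
have := near_slice t cp de; apply: filterS => s hs.
rewrite sub0r normrN ger0_norm ?sqrtr_ge0// -[leRHS]ger0_norm ?(ltW e0)// -sqrtr_sqr.
rewrite ler_sqrt ?sqr_ge0//.
have -> : xint g psi s - xint g psi t = cintegral circle (fun x => g x * (psi (s, x) - psi (t, x))%:C%C).
  have cc : continuous (fun _ : R * R => 0 : R) by move=> z; exact: cvg_cst.
  have := xint_comb 1 s t t gL cp cp cc.
  rewrite {3}/xint (eq_cintegral (g := fun=> 0)) ?cintegral0 ?subr0 ?mul1r; last by move=> x _; rewrite mulr0.
  by move=> ->; apply: eq_cintegral => x _; rewrite mul1r subr0.
apply: (@le_trans _ _ (nrm2 circle g * (2 * pi * (e ^+ 2 / (nrm2 circle g * (2 * pi) + 1))))).
  apply: xint_bound => //.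
  - by apply: ccontinuous_real => x; apply: cvgB; exact: continuous_slice.
  - by rewrite divr_ge0 ?sqr_ge0// ltW.
  - move=> x /hs h; rewrite abs2_real -[leRHS]sqr_sqrtr ?divr_ge0 ?sqr_ge0 ?(ltW b0)//.
    by rewrite -[leLHS]real_normK ?num_real// lerXn2r// ?nnegrE ?sqrtr_ge0.
rewrite mulrA mulrCA ler_piMr ?sqr_ge0// ler_pdivrMr// mul1r lerDl//.
Qed.

Lemma cderive_from F (l : C) t : (forall e, 0 < e ->
    \forall h \near 0^', abs2 ((h^-1)%:C%C * (F (h + t) - F t) - l) <= e) -> cderive F l t.
Proof.
move=> H; have aux (p : C -> R) : (forall z, p z ^+ 2 <= abs2 z) ->
    (forall (h : R) y z w, p (h%:C%C * (y - z) - w) = h * (p y - p z) - p w) ->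
    is_derive t (1 : R) (fun s => p (F s)) (p l).
  move=> p2 pl.
  have L : h^-1 *: (((fun s => p (F s)) \o shift t) (h *: (1 : R)) - p (F t)) @[h --> 0^'] --> p l.
    apply/cvgrPdist_le => e e0; have := H _ (exprn_gt0 2 e0); apply: filterS => h hh.
    rewrite distrC /GRing.scale /= mulr1 -pl -[leRHS]ger0_norm ?(ltW e0)//.
    rewrite -sqrtr_sqr -[leRHS]sqrtr_sqr ler_sqrt ?sqr_ge0//.
    exact: le_trans (p2 _) hh.
  apply: DeriveDef; first by apply/cvg_ex; exists (p l).
  exact: cvg_lim.
split; apply: aux.
- exact: Re_sqr_le_abs2.
- by move=> h [? ?] [? ?] [? ?] /=; ring.
- exact: Im_sqr_le_abs2.
- by move=> h [? ?] [? ?] [? ?] /=; ring.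
Qed.

(** The mean value theorem, for h of either sign: with [near_slice] applied to the time derivative,
    difference quotients converge uniformly in x. *)
Lemma mvt_quotient (f f' : R -> R) (t l h del e : R) : (forall s, is_derive s (1 : R) f (f' s)) ->
  (forall s, `|t - s| < del -> `|f' s - l| <= e) -> h != 0 -> `|h| < del ->
  `|h^-1 * (f (h + t) - f t) - l| <= e.
Proof.
move=> df hf h0 hd; have cf := is_derive_continuous df.
have [c ct E] : exists2 c, `|t - c| < del & f (h + t) - f t = f' c * h.
  have [hp|hn] := ltP 0 h.
    have th : t <= h + t by rewrite lerDr ltW.
    have [c cI E] := @MVT_segment R f f' t (h + t) th (fun x _ => df x) (continuous_subspaceT cf).
    exists c; last by rewrite E addrK.
    move: cI hd; rewrite in_itv /= (ger0_norm (ltW hp)) ltr_norml => /andP[? ?] ?.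
    by apply/andP; split; lra.
  have th : h + t <= t by rewrite gerDr.
  have [c cI E] := @MVT_segment R f f' (h + t) t th (fun x _ => df x) (continuous_subspaceT cf).
  exists c; last by rewrite -opprB E -mulrN opprB addrK.
  move: cI hd; rewrite in_itv /= (ler0_norm hn) ltr_norml => /andP[? ?] ?.
  by apply/andP; split; lra.
by rewrite E mulrC mulfK//; exact: hf.
Qed.

(** Differentiation under the integral sign: the difference quotients converge uniformly in x on the
    period, and Cauchy-Schwarz against [g] turns this into convergence of the integrals. *)
Lemma xint_derive g phi t : L2 circle g -> smooth phi ->
  cderive (xint g phi) (xint g (dt phi) t) t.
Proof.
move=> gL sp; have p0 := @pi2_gt0 R.
have c1 := smooth_continuous sp; have c2 := smooth_continuous (smooth_dt sp).
apply: cderive_from => e e0.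
have b0 : 0 < nrm2 circle g * (2 * pi) + 1 by rewrite ltr_wpDl// mulr_ge0 ?nrm2_ge0// ltW.
have de : 0 < Num.sqrt (e / (nrm2 circle g * (2 * pi) + 1)) by rewrite sqrtr_gt0 divr_gt0.
have /nbhs_ballP[del d0 hd] := near_slice t c2 de.
near=> h; have h0 : h != 0 by near: h; exact: nbhs_dnbhs_neq.
have hh : `|h| < del by near: h; exact: dnbhs0_lt.
rewrite xint_comb//.
apply: (@le_trans _ _ (nrm2 circle g * (2 * pi * (e / (nrm2 circle g * (2 * pi) + 1))))).
  apply: xint_bound => //.
  - apply: ccontinuous_real => x; apply: cvgB; last exact: continuous_slice.
    by apply: cvgM; [exact: cvg_cst|apply: cvgB; exact: continuous_slice].
  - by rewrite divr_ge0 ?ltW.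
  - move=> x xI; rewrite abs2_real -[leRHS]sqr_sqrtr ?divr_ge0 ?(ltW b0) ?(ltW e0)//.
    rewrite -[leLHS]real_normK ?num_real// lerXn2r// ?nnegrE ?sqrtr_ge0//.
    apply: (@mvt_quotient (fun s => phi (s, x)) (fun s => dt phi (s, x)) t _ h del) => //.
      by move=> s; exact: is_derive_dt.
    by move=> s ts; apply: hd.
rewrite mulrA mulrCA ler_piMr ?(ltW e0)// ler_pdivrMr// mul1r lerDl//.
Unshelve. all: by end_near. Qed.

(** Integration by parts over one period, whose boundary terms cancel by periodicity. *)
Lemma xint_dx k phi t : smooth phi -> (forall t x, phi (t, x + 2 * pi) = phi (t, x)) ->
  xint (fexp k) (dx phi) t = - (0 +i* k%:~R)%C * xint (fexp k) phi t.
Proof.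
move=> sp pp; have p0 := @pi2_gt0 R; have mC := @measurable_circle R.
have c1 := smooth_continuous sp; have c2 := smooth_continuous (smooth_dx sp).
have D x : cderive (fun x => fexp k x * (phi (t, x))%:C%C)
    ((0 +i* k%:~R)%C * (fexp k x * (phi (t, x))%:C%C) + fexp k x * (dx phi (t, x))%:C%C) x.
  have h : cderive (fun x => (phi (t, x))%:C%C) (dx phi (t, x))%:C%C x.
    by split; [exact: is_derive_dx|exact: is_derive_cst].
  have := cderiveM (cderive_expiZ k%:~R x) h.
  by rewrite -/(fexp k x) mulrA.
have cc : ccontinuous (fun x => (0 +i* k%:~R)%C * (fexp k x * (phi (t, x))%:C%C) + fexp k x * (dx phi (t, x))%:C%C).
  apply: ccontinuousD; first apply: ccontinuousZ.
    by apply: ccontinuousM; [exact: ccontinuous_fexp|exact: ccontinuous_slice].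
  by apply: ccontinuousM; [exact: ccontinuous_fexp|exact: ccontinuous_slice].
have := cFTC2 D cc (ltW p0).
rewrite -cintegral_circle; last exact: ccontinuous_circle.
have i1 := cintegrable_slice t (L2_fexp k) c1; have i2 := cintegrable_slice t (L2_fexp k) c2.
rewrite cintegralD//; last exact: cintegrableZ.
rewrite cintegralZ//.
have -> : phi (t, 2 * pi) = phi (t, 0) by rewrite -(pp t 0) add0r.
have -> : fexp k (2 * pi) = fexp k 0 :> C.
  by rewrite /fexp expi_2pi mulr0 expi0.
by rewrite subrr -/(xint _ _ _) -/(xint _ _ _) => /eqP; rewrite addrC addr_eq0 mulNr => /eqP.
Qed.

End test_calculus.

(** * Truncated Fourier series with tails uniform in time *)

Section approximation.
Context {R : realType}.
Local Notation mu := (@lebesgue_measure R).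
Local Notation C := (R[i]).
Local Notation cre := (@complex.Re R).
Local Notation cim := (@complex.Im R).

Definition ccvg (S : nat -> C) (X : C) := abs2 (S n - X) @[n --> \oo] --> (0 : R).

Lemma ccvg_le (S : nat -> C) X (e : nat -> R) : (forall n, abs2 (S n - X) <= e n) ->
  e n @[n --> \oo] --> (0 : R) -> ccvg S X.
Proof.
move=> h e0; apply: (squeeze_cvgr _ (cvg_cst 0) e0).
by near=> n; rewrite abs2_ge0 h.
Unshelve. all: by end_near. Qed.

Lemma ccvgD (S T : nat -> C) X Y : ccvg S X -> ccvg T Y -> ccvg (fun n => S n + T n) (X + Y).
Proof.
move=> SX TY; apply: (@ccvg_le _ _ (fun n => 2 * abs2 (S n - X) + 2 * abs2 (T n - Y))).
  by move=> n; rewrite opprD addrACA; exact: abs2D_le.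
rewrite -[X in _ --> X](addr0 (0 : R)) -[X in _ --> X + _](mulr0 2) -[X in _ --> _ + X](mulr0 2).
by apply: cvgD; apply: cvgMr.
Qed.

Lemma ccvgZ (k : C) (S : nat -> C) X : ccvg S X -> ccvg (fun n => k * S n) (k * X).
Proof.
move=> SX; apply: (@ccvg_le _ _ (fun n => abs2 k * abs2 (S n - X))).
  by move=> n; rewrite -mulrBr abs2M.
by rewrite -[X in _ --> X](mulr0 (abs2 k)); apply: cvgMr.
Qed.

Lemma ccvg_cst0 X : ccvg (fun=> 0) X -> X = 0.
Proof.
move=> h; apply: abs2_eq0; rewrite -abs2N -sub0r.
by apply: (cvg_unique _ (cvg_cst (abs2 (0 - X))) h).
Qed.

Lemma ccvg_zero (S : nat -> C) X : (forall n, S n = 0) -> ccvg S X -> X = 0.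
Proof. by move=> S0 h; apply: ccvg_cst0; rewrite -(_ : S = fun=> 0)//; apply/funext. Qed.

Lemma uniform_ccontinuous (F : R -> C) (G : nat -> R -> C) (e : nat -> R) :
  (forall n, ccontinuous (G n)) -> (forall n t, abs2 (F t - G n t) <= e n) ->
  e n @[n --> \oo] --> (0 : R) -> ccontinuous F.
Proof.
move=> cG FG e0.
have aux (p : C -> R) : (forall y z, p (y - z) = p y - p z) -> (forall z, p z ^+ 2 <= abs2 z) ->
    (forall n, continuous (fun t => p (G n t))) -> continuous (fun t => p (F t)).
  move=> pB p2 cp t; apply/cvgrPdist_le => eps eps0.
  have e3 : 0 < eps / 3 by rewrite divr_gt0.
  have [n _ /(_ n (leqnn n)) hn] : \forall n \near \oo, `|0 - e n| <= (eps / 3) ^+ 2.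
    by move: e0 => /cvgrPdist_le; apply; exact: exprn_gt0.
  have close s : `|p (F s) - p (G n s)| <= eps / 3.
    rewrite -pB -(ger0_norm (ltW e3)) -sqrtr_sqr -[leRHS]sqrtr_sqr ler_sqrt ?sqr_ge0//.
    apply: (le_trans (p2 _)); apply: (le_trans (FG n s)).
    by apply: le_trans hn; rewrite sub0r normrN ler_norm.
  have /cvgrPdist_le/(_ _ e3) := cp n t; apply: filterS => s hs.
  have -> : p (F t) - p (F s) = (p (F t) - p (G n t)) + (p (G n t) - p (G n s)) - (p (F s) - p (G n s)) by ring.
  apply: (le_trans (ler_normB _ _)).
  have := close s; have := close t; have := ler_normD (p (F t) - p (G n t)) (p (G n t) - p (G n s)); lra.
split; apply: aux.
- exact: creB.
- exact: Re_sqr_le_abs2.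
- by move=> n; have [] := cG n.
- exact: cimB.
- exact: Im_sqr_le_abs2.
- by move=> n; have [] := cG n.
Qed.

Lemma cintegral_support (F : R -> C) (M : R) : (forall t, M < `|t| -> F t = 0) ->
  cintegral setT F = cintegral `[- M, M]%classic F.
Proof.
move=> hM; have out t : (t < - M) || (M < t) -> F t = 0.
  by move=> h; apply: hM; rewrite ltNge ler_norml negb_and -!ltNge.
apply: complexP; rewrite /cintegral /=; apply: Rintegral_support => t /out -> //.
Qed.

Lemma three_term_bound (e X Y a b h t : R) : 0 <= e -> X <= 2 * a + 2 * Y ->
  Y <= 2 * h + 2 * b -> a <= t -> b <= t -> t <= e / 16 -> h <= e / 16 -> X <= e.
Proof. by lra. Qed.

Section tails.
Variables (u : R -> R -> C) (tau : nat -> R).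
Hypothesis uL : forall t, L2 circle (u t).
Hypothesis cu : forall k, ccontinuous (fun t => fourier_coef (u t) k).
Hypothesis utau : forall n t,
  nrm2 circle (fun x => u t x - fsum (ints n n) (fourier_coef (u t)) x) <= tau n.
Hypothesis tau0 : tau n @[n --> \oo] --> (0 : R).

(** Three-term splitting: the tails at times s and t are small uniformly in time, and the truncated
    sum has finitely many continuous coefficients. *)
Lemma nrm2_tails_continuous t : nrm2 circle (fun x => u s x - u t x) @[s --> t] --> (0 : R).
Proof.
have mC := @measurable_circle R; have p0 := @pi2_gt0 R.
apply/cvgrPdist_le => e e0; have e8 : 0 < e / 16 by rewrite divr_gt0.
have [n _ /(_ n (leqnn n)) hn] : \forall n \near \oo, `|0 - tau n| <= e / 16.
  by move: tau0 => /cvgrPdist_le; apply.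
have tn : tau n <= e / 16 by apply: le_trans hn; rewrite sub0r normrN ler_norm.
pose P s := fsum (ints n n) (fourier_coef (u s)).
have PL s : L2 circle (P s) by exact/ccontinuous_L2_circle/ccontinuous_fsum.
pose h s := 2 * pi * \sum_(k <- ints n n) abs2 (fourier_coef (u s) k - fourier_coef (u t) k).
have PP s : nrm2 circle (fun x => P s x - P t x) = h s.
  rewrite /h -nrm2_fsum ?ints_uniq//; apply: eq_Rintegral => x _; congr abs2.
  by rewrite /P /fsum -sumrB; apply: eq_bigr => k _; rewrite mulrBl.
have ch : h s @[s --> t] --> h t.
  apply: cvgMr; apply: cvg_big => //; first exact: add_continuous.
  move=> k _; have cc : ccontinuous (fun s => fourier_coef (u s) k - fourier_coef (u t) k).
    by apply: ccontinuousB => //; exact: ccontinuous_cst.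
  exact: (continuous_abs2 cc).
have ht : h t = 0 by rewrite /h big1 ?mulr0// => k _; rewrite subrr abs2_0.
move: ch; rewrite ht => /cvgrPdist_le/(_ _ e8); apply: filterS => s hs.
have hs' : h s <= e / 16 by apply: le_trans hs; rewrite sub0r normrN ler_norm.
rewrite sub0r normrN ger0_norm ?nrm2_ge0//.
have E : nrm2 circle (fun x => u s x - u t x) =
    nrm2 circle (fun x => (u s x - P s x) + ((P s x - P t x) + (P t x - u t x))).
  by apply: eq_Rintegral => x _; congr abs2; ring.
rewrite E; have L1 := L2B mC (uL s) (PL s); have L2' := L2B mC (PL s) (PL t); have L3 := L2B mC (PL t) (uL t).
have h1 := nrm2D_le mC L1 (L2D mC L2' L3); have h2 := nrm2D_le mC L2' L3; rewrite PP (nrm2B_sym _ (P t)) in h2.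
exact: (three_term_bound (ltW e0) h1 h2 (utau n s) (utau n t) tn hs').
Qed.

(** The inner integrals of the truncations converge uniformly in time because [tau] bounds the tails
    at every time, and the compact support in time carries this over to the outer integral. Uniform
    convergence also makes the limiting inner integral continuous. *)
Lemma pairing_modes psi (M : R) : continuous psi -> (forall t x, M < `|t| -> psi (t, x) = 0) ->
  ccvg (fun n => \sum_(k <- ints n n) cintegral setT (fun t => fourier_coef (u t) k * xint (fexp k) psi t))
    (pairing u psi).
Proof.
move=> cp hM0; have mC := @measurable_circle R; have p0 := @pi2_gt0 R.
pose M' := Num.max M 0; have M'0 : 0 <= M' by rewrite le_max lexx orbT.
have hM t x : M' < `|t| -> psi (t, x) = 0.
  by rewrite gt_max => /andP[h _]; exact: hM0.
have [B B0 hB] := bounded_slices M' cp.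
pose G n t := \sum_(k <- ints n n) fourier_coef (u t) k * xint (fexp k) psi t.
pose F t := cintegral circle (fun x => u t x * (psi (t, x))%:C%C).
have X0 g t : M' < `|t| -> xint g psi t = 0.
  move=> tM; rewrite /xint (eq_cintegral (g := fun=> 0)) ?cintegral0// => x _.
  by rewrite hM// mulr0.
have F0 t : M' < `|t| -> F t = 0 by exact: X0.
have cX k : ccontinuous (xint (fexp k) psi) by apply: xint_continuous => //; exact: L2_fexp.
have G0 n t : M' < `|t| -> G n t = 0 by move=> tM; rewrite /G big1// => k _; rewrite X0// mulr0.
have cG n : ccontinuous (G n) by apply: ccontinuous_sum => k; exact: ccontinuousM.
have GE n t : G n t = cintegral circle (fun x => fsum (ints n n) (fourier_coef (u t)) x * (psi (t, x))%:C%C).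
  have ik k := cintegrable_slice t (L2_fexp k) cp.
  rewrite /G; under eq_bigr do rewrite -cintegralZ//.
  rewrite -cintegral_sum//; last by move=> k; exact: cintegrableZ.
  by apply: eq_cintegral => x _; rewrite /fsum mulr_suml; apply: eq_bigr => k _; rewrite mulrA.
have FG n t : abs2 (F t - G n t) <= tau n * (2 * pi * B ^+ 2).
  have [tM|tM] := ltP M' `|t|.
    rewrite F0// G0// subr0 abs2_0 mulr_ge0//; first exact: le_trans (nrm2_ge0 _ _) (utau n t).
    by rewrite mulr_ge0 ?sqr_ge0// ltW.
  have sL : L2 circle (fsum (ints n n) (fourier_coef (u t))) by exact/ccontinuous_L2_circle/ccontinuous_fsum.
  have i1 := cintegrable_slice t (uL t) cp; have i2 := cintegrable_slice t sL cp.
  have -> : F t - G n t = cintegral circle (fun x => (u t x - fsum (ints n n) (fourier_coef (u t)) x) * (psi (t, x))%:C%C).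
    rewrite GE -[X in _ - X]mul1r -mulNr -cintegralZ// -cintegralD//; last exact: cintegrableZ.
    by apply: eq_cintegral => x _; ring.
  apply: (le_trans (@xint_bound R _ (fun x => (psi (t, x))%:C%C) (B ^+ 2) (L2B mC (uL t) sL) _ (sqr_ge0 _) _)).
  - exact: ccontinuous_slice.
  - move=> x xI; rewrite abs2_real -[leLHS]real_normK ?num_real// lerXn2r ?nnegrE//; exact: hB.
  - by rewrite ler_wpM2r// mulr_ge0 ?sqr_ge0// ltW.
have ce : tau n * (2 * pi * B ^+ 2) @[n --> \oo] --> (0 : R).
  by rewrite -[X in _ --> X](mul0r (2 * pi * B ^+ 2)); apply: cvgMl.
have cF : ccontinuous F by exact: uniform_ccontinuous cG FG ce.
apply: (@ccvg_le _ _ (fun n => tau n * (2 * pi * B ^+ 2) * ((M' - - M') * (1 * (M' - - M'))))).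
  move=> n; have iX k : cintegrable setT (fun t => fourier_coef (u t) k * xint (fexp k) psi t).
    by apply: (@compact_cintegrable _ _ M'); [exact: ccontinuousM|move=> t /X0 ->; rewrite mulr0].
  rewrite -cintegral_sum//.
  rewrite -/(G n) (cintegral_support (G0 n)) /pairing -/F (cintegral_support F0).
  have iF := ccontinuous_cintegrable (- M') M' cF; have iG := ccontinuous_cintegrable (- M') M' (cG n).
  have mI : measurable (`[- M', M']%classic : set R) by exact: measurable_itv.
  have -> : cintegral `[- M', M']%classic (G n) - cintegral `[- M', M']%classic F =
      cintegral `[- M', M']%classic (fun t => (G n t - F t) * 1).
    rewrite -[X in _ - X]mul1r -mulNr -cintegralZ// -cintegralD//; last exact: cintegrableZ.
    by apply: eq_cintegral => x _; ring.
  have cD : ccontinuous (fun t => G n t - F t) by exact: ccontinuousB.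
  apply: (le_trans (cauchy_schwarz mI (ccontinuous_L2 _ _ cD) (ccontinuous_L2 _ _ (ccontinuous_cst 1)))).
  have MM : - M' <= M' by lra.
  rewrite mulrA; apply: ler_pM; rewrite ?nrm2_ge0//.
    by apply: nrm2_le_bound => // t _ _; rewrite -abs2N opprB.
  by apply: nrm2_le_bound => //; [exact: ccontinuous_cst|move=> t _ _; rewrite abs2_1].
by rewrite -[X in _ --> X](mul0r ((M' - - M') * (1 * (M' - - M')))); apply: cvgMl.
Qed.

End tails.

Lemma cintegral_by_parts (F G f g : R -> C) (M : R) :
  (forall t, cderive F (f t) t) -> (forall t, cderive G (g t) t) ->
  ccontinuous f -> ccontinuous g ->
  (forall t, M < `|t| -> G t = 0) -> (forall t, M < `|t| -> g t = 0) ->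
  cintegral setT (fun t => F t * g t) + cintegral setT (fun t => f t * G t) = 0.
Proof.
move=> dF dG cf cg G0 g0; have cF := cderive_continuous dF; have cG := cderive_continuous dG.
have i1 : cintegrable setT (fun t => F t * g t).
  by apply: (@compact_cintegrable _ _ M); [exact: ccontinuousM|move=> t /g0 ->; rewrite mulr0].
have i2 : cintegrable setT (fun t => f t * G t).
  by apply: (@compact_cintegrable _ _ M); [exact: ccontinuousM|move=> t /G0 ->; rewrite mulr0].
rewrite -cintegralD//.
pose M' := `|M| + 1; have MM' : M < M' by have := ler_norm M; rewrite /M'; lra.
have M'0 : 0 < M' by have := normr_ge0 M; rewrite /M'; lra.
rewrite (@cintegral_support _ M'); last first.
  by move=> t tM; rewrite g0 ?G0 ?mulr0 ?addr0//; exact: lt_trans tM.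
under eq_cintegral do rewrite addrC.
rewrite (@cFTC2 R (fun t => F t * G t)) ?G0 ?mulr0 ?subrr//.
- by rewrite normrN gtr0_norm.
- by rewrite gtr0_norm.
- by move=> t; exact: cderiveM.
- by apply: ccontinuousD; exact: ccontinuousM.
- lra.
Qed.

End approximation.

(** * Energy conservation and the solution map *)

Section well_posedness_proof.
Context {R : realType}.
Local Notation mu := (@lebesgue_measure R).
Local Notation C := (R[i]).
Variables (a c d r : R).
Hypotheses (a0 : 0 < a) (c0 : 0 < c) (d0 : 0 < d) (r0 : 0 < r).
Implicit Types (z : @state R) (w : @trajectory R) (k : int) (x y : int -> C).

Local Notation K := (a * c / d).

(** The two amplitudes on the branch [b] form an eigenvector of the matrix of mode k for [freq b],
    which makes [ucoef] and [vcoef] solve the system of that mode. *)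
Lemma amp_ode x y b k :
  (0 +i* freq a c d r b k)%C * amp1 a c d r x y b k =
    (0 +i* k%:~R ^+ 3)%C * (amp1 a c d r x y b k + a%:C%C * amp2 a c d r x y b k) /\
  c%:C%C * ((0 +i* freq a c d r b k)%C * amp2 a c d r x y b k) =
    (0 +i* (k%:~R ^+ 3 - r * k%:~R))%C * amp2 a c d r x y b k
      + (0 +i* (d * k%:~R ^+ 3))%C * amp1 a c d r x y b k.
Proof.
have an := lt0r_neq0 a0; have cn := lt0r_neq0 c0.
have [k0|k0] := eqVneq k 0.
  rewrite k0 freqN0 !expr0n /= !mulr0 !subr0.
  have -> : (0 +i* 0)%C = 0 :> C by [].
  by rewrite !mul0r mulr0 addr0.
have [] := slope_recurrence r a0 c0 d0 b k; rewrite /amp2 (negbTE k0).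
have fE : freq a c d r b k = k%:~R ^+ 3 * (1 + a * slope a c d r b k).
  by rewrite /freq /slope; field.
rewrite fE; set s := slope a c d r b k; set s' := slope _ _ _ _ (~~ b) k; set L : R := k%:~R.
move=> h1 h2.
have k1 : L ^+ 3 - r * L = c * (a * s' * L ^+ 3 + L ^+ 3 * (1 + a * s)) by rewrite -h1; field.
have k2 : d * L ^+ 3 = c * (s' * (L ^+ 3 - L ^+ 3 * (1 + a * s))) by rewrite -h2; field.
rewrite k1 k2; move: (amp1 a c d r x y b k) => [p q].
by split; apply: complexP => /=; ring.
Qed.

Lemma ucoef_derive x y k t : cderive (ucoef a c d r x y k)
  ((0 +i* k%:~R ^+ 3)%C * (ucoef a c d r x y k t + a%:C%C * vcoef a c d r x y k t)) t.
Proof.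
have h b := cderiveZ (amp1 a c d r x y b k) (cderive_expiZ (freq a c d r b k) t).
have := cderiveD (h true) (h false).
rewrite ![amp1 _ _ _ _ _ _ _ _ * (_ * expi _)]mulrA ![amp1 _ _ _ _ _ _ _ _ * (_ +i* _)%C]mulrC.
rewrite !(amp_ode x y _ k).1 /ucoef /vcoef.
by congr cderive; ring.
Qed.

Lemma vcoef_derive x y k t : cderive (vcoef a c d r x y k)
  (c^-1%:C%C * ((0 +i* (k%:~R ^+ 3 - r * k%:~R))%C * vcoef a c d r x y k t
    + (0 +i* (d * k%:~R ^+ 3))%C * ucoef a c d r x y k t)) t.
Proof.
have h b := cderiveZ (amp2 a c d r x y b k) (cderive_expiZ (freq a c d r b k) t).
have := cderiveD (h true) (h false).
have E b : amp2 a c d r x y b k * ((0 +i* freq a c d r b k)%C * expi (freq a c d r b k * t)) =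
   c^-1%:C%C * (c%:C%C * ((0 +i* freq a c d r b k)%C * amp2 a c d r x y b k)) * expi (freq a c d r b k * t).
  rewrite [c^-1%:C%C * (_ * _)]mulrA -rmorphM /= mulVf ?gt_eqF// rmorph1 mul1r.
  by rewrite mulrA [amp2 _ _ _ _ _ _ _ _ * _]mulrC.
rewrite !E !(amp_ode x y _ k).2 /ucoef /vcoef.
by congr cderive; ring.
Qed.

Lemma ccontinuous_ucoef x y k : ccontinuous (ucoef a c d r x y k).
Proof. exact: cderive_continuous (ucoef_derive x y k). Qed.

Lemma ccontinuous_vcoef x y k : ccontinuous (vcoef a c d r x y k).
Proof. exact: cderive_continuous (vcoef_derive x y k). Qed.

Lemma mode_conserved x y k t :
  abs2 (ucoef a c d r x y k t) + K * abs2 (vcoef a c d r x y k t) = abs2 (x k) + K * abs2 (y k).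
Proof.
rewrite mode_energy// -(mode_energy r a0 c0 d0 x y k 0) ucoef0// vcoef0//.
Qed.

Lemma weighted_sum (s : seq int) (p q : int -> R) :
  2 * pi * (\sum_(k <- s) (p k + K * q k)) =
  2 * pi * (\sum_(k <- s) p k) + K * (2 * pi * (\sum_(k <- s) q k)).
Proof. by rewrite big_split /= -mulr_sumr mulrDr [_ * (K * _)]mulrCA. Qed.

Lemma parsevalH z : inH z ->
  2 * pi * (\sum_(k <- ints n n) (abs2 (fourier_coef z.1 k) + K * abs2 (fourier_coef z.2 k)))
    @[n --> \oo] --> sqnormH a c d z.
Proof.
move=> [h1 h2]; rewrite sqnormHE//.
apply: cvg_trans (cvgD (parseval h1) (cvgM (cvg_cst K) (parseval h2))).
apply: near_eq_cvg; near=> n.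
exact/esym/weighted_sum.
Unshelve. all: by end_near. Qed.

Lemma sqnormH_coef z z' : inH z -> inH z' ->
  (forall k, abs2 (fourier_coef z'.1 k) + K * abs2 (fourier_coef z'.2 k) =
     abs2 (fourier_coef z.1 k) + K * abs2 (fourier_coef z.2 k)) ->
  sqnormH a c d z' = sqnormH a c d z.
Proof.
move=> zH zH' E; have h' := parsevalH zH'.
rewrite (eq_cvg _ _ (fun n => congr1 (fun s => 2 * pi * s) (eq_bigr _ (fun k _ => E k)))) in h'.
exact: cvg_unique h' (parsevalH zH).
Qed.

(** Parseval's identity reduces this to the conservation of the energy of each mode, available for
    any weak solution through [solution_coef]. *)
Lemma solution_energy z w : inH z -> solution a c d r z w -> forall t,
  energy a c d w t = sqnormH a c d z.
Proof.
move=> zH sol t; have [[wH _ _] _ _ _] := sol.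
apply: sqnormH_coef => // k; have [-> ->] := solution_coef a0 c0 d0 k zH sol t.
exact: mode_conserved.
Qed.

Lemma eqH_coef z z' : inH z -> inH z' -> (forall k, fourier_coef z.1 k = fourier_coef z'.1 k) ->
  (forall k, fourier_coef z.2 k = fourier_coef z'.2 k) -> eqH z z'.
Proof.
move=> [h1 h2] [h1' h2'] e1 e2.
have k1 := fourier_inj h1 h1' e1; have k2 := fourier_inj h2 h2' e2.
apply: (@filterS2 _ _ (ae_filter_ringOfSetsType mu) _ _ _ _ k1 k2) => x p q Dx.
by rewrite p ?q.
Qed.

Lemma sum_coef_le z s : inH z -> uniq s ->
  2 * pi * \sum_(k <- s) (abs2 (fourier_coef z.1 k) + K * abs2 (fourier_coef z.2 k)) <= sqnormH a c d z.
Proof.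
move=> [h1 h2] us; rewrite sqnormHE// big_split /= -mulr_sumr mulrDr mulrCA.
by rewrite lerD ?bessel// ler_wpM2l ?bessel// ltW// acd_gt0.
Qed.

Lemma tested_algebra1 (L : R) (U' U V U3 V3 : C) :
  U3 = (0 +i* L ^+ 3)%C * U -> V3 = (0 +i* L ^+ 3)%C * V ->
  U' + (0 +i* L ^+ 3)%C * (U + a%:C%C * V) = 0 ->
  -1 * U' + (-1) ^+ 3 * U3 + a%:C%C * ((-1) ^+ 3 * V3) = 0.
Proof. by move=> -> -> h; apply: (can_inj (@opprK C)); rewrite oppr0 -[RHS]h; ring. Qed.

Lemma tested_algebra2 (L : R) (V' U V U3 V3 V1 : C) :
  U3 = (0 +i* L ^+ 3)%C * U -> V3 = (0 +i* L ^+ 3)%C * V -> V1 = - (0 +i* L)%C * V ->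
  c%:C%C * V' + (0 +i* (L ^+ 3 - r * L))%C * V + (0 +i* (d * L ^+ 3))%C * U = 0 ->
  c%:C%C * (-1 * V') + r%:C%C * ((-1) ^+ 1 * V1) + (-1) ^+ 3 * V3
    + d%:C%C * ((-1) ^+ 3 * U3) = 0.
Proof.
move=> -> -> -> h; apply: (can_inj (@opprK C)); rewrite oppr0 -[RHS]h.
by clear h; move: V' V U => [? ?] [? ?] [? ?]; apply: complexP => /=; ring.
Qed.

Lemma sum_comb4 (s : seq int) (p p' q q' e e' g : C) (F1 F2 F3 F4 : int -> C) :
  p * (p' * \sum_(k <- s) F1 k) + q * (q' * \sum_(k <- s) F2 k) + e * \sum_(k <- s) F3 k
    + e' * (g * \sum_(k <- s) F4 k) =
  \sum_(k <- s) (p * (p' * F1 k) + q * (q' * F2 k) + e * F3 k + e' * (g * F4 k)).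
Proof. by rewrite !mulr_sumr -!big_split. Qed.

(** * A single mode satisfies the tested equations exactly *)

Section tested.
Variables (x y : int -> C) (phi : R * R -> R).
Hypothesis tphi : test_function phi.
Local Notation uc := (ucoef a c d r x y).
Local Notation vc := (vcoef a c d r x y).
Local Notation X k := (xint (fexp k) phi).
Local Notation X' k := (xint (fexp k) (dt phi)).
Local Notation I f g := (cintegral setT (fun t => f t * g t)).

Let sphi : smooth phi. Proof. by case: tphi. Qed.

Let support (psi : R * R -> R) : test_function psi -> exists M : R, forall k t, M < `|t| -> xint (fexp k) psi t = 0.
Proof.
move=> [_ _ [M hM]]; exists M => k t tM.
rewrite /xint (eq_cintegral (g := fun=> 0)) ?cintegral0// => s _.
by rewrite hM// mulr0.
Qed.

Let cX k : ccontinuous (X k).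
Proof. by apply: xint_continuous; [exact: L2_fexp|exact: smooth_continuous]. Qed.

Let cX' k : ccontinuous (X' k).
Proof. by apply: xint_continuous; [exact: L2_fexp|exact/smooth_continuous/smooth_dt]. Qed.

Let intX f k : ccontinuous f -> cintegrable setT (fun t => f t * X k t).
Proof.
move=> cf; have [M hM] := support tphi; apply: (@compact_cintegrable _ _ M); first exact: ccontinuousM.
by move=> t tM; rewrite hM// mulr0.
Qed.

Let parts f f' k : (forall t, cderive f (f' t) t) -> ccontinuous f' -> I f (X' k) + I f' (X k) = 0.
Proof.
move=> df cf'; have [M hM] := support tphi; have [M' hM'] := support (test_dt tphi).
apply: (@cintegral_by_parts _ f (X k) f' (X' k) (Num.max M M')) => //.
- by move=> t; apply: xint_derive => //; exact: L2_fexp.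
- by move=> t; rewrite gt_max => /andP[tM _]; exact: hM.
- by move=> t; rewrite gt_max => /andP[_ tM]; exact: hM'.
Qed.

Let mode_weak1 k : I (uc k) (X' k) + (0 +i* k%:~R ^+ 3)%C * (I (uc k) (X k) + a%:C%C * I (vc k) (X k)) = 0.
Proof.
have cu := ccontinuous_ucoef x y k; have cv := ccontinuous_vcoef x y k.
pose f' t := (0 +i* k%:~R ^+ 3)%C * (uc k t + a%:C%C * vc k t).
have c' : ccontinuous f'.
  by apply: ccontinuousZ; apply: ccontinuousD => //; exact: ccontinuousZ.
have iu := intX k cu; have iv := intX k cv; have mT : measurable [set: R] by exact: measurableT.
rewrite -[RHS](@parts (uc k) f' k (ucoef_derive x y k) c'); congr (_ + _).
have jv := cintegrableZ a%:C%C mT iv.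
rewrite -(cintegralZ a%:C%C mT iv) -(cintegralD mT iu jv) -(cintegralZ _ mT (cintegrableD mT iu jv)).
by apply: eq_cintegral => t _; rewrite /f'; ring.
Qed.

Let mode_weak2 k : c%:C%C * I (vc k) (X' k) + (0 +i* (k%:~R ^+ 3 - r * k%:~R))%C * I (vc k) (X k)
  + (0 +i* (d * k%:~R ^+ 3))%C * I (uc k) (X k) = 0.
Proof.
have cu := ccontinuous_ucoef x y k; have cv := ccontinuous_vcoef x y k.
pose g t := (0 +i* (k%:~R ^+ 3 - r * k%:~R))%C * vc k t + (0 +i* (d * k%:~R ^+ 3))%C * uc k t.
have cg : ccontinuous g by apply: ccontinuousD; exact: ccontinuousZ.
have iu := intX k cu; have iv := intX k cv; have mT : measurable [set: R] by exact: measurableT.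
have ig := intX k cg.
have ju := cintegrableZ (0 +i* (d * k%:~R ^+ 3))%C mT iu.
have jv := cintegrableZ (0 +i* (k%:~R ^+ 3 - r * k%:~R))%C mT iv.
have := @parts (vc k) (fun t => c^-1%:C%C * g t) k (vcoef_derive x y k) (ccontinuousZ _ cg).
move=> /(congr1 (fun p => c%:C%C * p)); rewrite mulr0 => <-.
rewrite mulrDr -addrA; congr (_ + _).
rewrite -(cintegralZ _ mT iu) -(cintegralZ _ mT iv) -(cintegralD mT jv ju).
have -> : (fun t => c^-1%:C%C * g t * X k t) = (fun t => c^-1%:C%C * (g t * X k t)).
  by apply/funext => t; rewrite mulrA.
rewrite (cintegralZ _ mT ig) mulrA -rmorphM /= mulfV ?gt_eqF// rmorph1 mul1r.
by apply: eq_cintegral => t _; rewrite /g; ring.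
Qed.

Let X3 k t : xint (fexp k) (iter 3 dx phi) t = (0 +i* k%:~R ^+ 3)%C * X k t.
Proof.
have t1 := test_dx tphi; have t2 := test_dx t1.
have [s1 p1 _] := t1; have [s2 p2 _] := t2; have [s0 p0 _] := tphi.
rewrite /iter !xint_dx//; move: (xint _ _ _) => [p q]; apply: complexP => /=; ring.
Qed.

Let X1 k t : xint (fexp k) (iter 1 dx phi) t = - (0 +i* k%:~R)%C * X k t.
Proof. by have [s0 p0 _] := tphi; rewrite /iter xint_dx. Qed.

Let IZ (q : C) f k g : ccontinuous f -> (forall t, g t = q * X k t) -> I f g = q * I f (X k).
Proof.
move=> cf gE; rewrite -cintegralZ//; last exact: intX.
by apply: eq_cintegral => t _; rewrite gE; ring.
Qed.

Lemma tested_mode1 k : -1 * I (uc k) (X' k)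
  + (-1) ^+ 3 * I (uc k) (xint (fexp k) (iter 3 dx phi))
  + a%:C%C * ((-1) ^+ 3 * I (vc k) (xint (fexp k) (iter 3 dx phi))) = 0.
Proof.
have e1 : I (uc k) (xint (fexp k) (iter 3 dx phi)) = (0 +i* k%:~R ^+ 3)%C * I (uc k) (X k).
  by apply: IZ; [exact: ccontinuous_ucoef|exact: X3].
have e2 : I (vc k) (xint (fexp k) (iter 3 dx phi)) = (0 +i* k%:~R ^+ 3)%C * I (vc k) (X k).
  by apply: IZ; [exact: ccontinuous_vcoef|exact: X3].
exact: tested_algebra1 e1 e2 (mode_weak1 k).
Qed.

Lemma tested_mode2 k : c%:C%C * (-1 * I (vc k) (X' k))
  + r%:C%C * ((-1) ^+ 1 * I (vc k) (xint (fexp k) (iter 1 dx phi)))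
  + (-1) ^+ 3 * I (vc k) (xint (fexp k) (iter 3 dx phi))
  + d%:C%C * ((-1) ^+ 3 * I (uc k) (xint (fexp k) (iter 3 dx phi))) = 0.
Proof.
have e1 : I (uc k) (xint (fexp k) (iter 3 dx phi)) = (0 +i* k%:~R ^+ 3)%C * I (uc k) (X k).
  by apply: IZ; [exact: ccontinuous_ucoef|exact: X3].
have e2 : I (vc k) (xint (fexp k) (iter 3 dx phi)) = (0 +i* k%:~R ^+ 3)%C * I (vc k) (X k).
  by apply: IZ; [exact: ccontinuous_vcoef|exact: X3].
have e3 : I (vc k) (xint (fexp k) (iter 1 dx phi)) = - (0 +i* k%:~R)%C * I (vc k) (X k).
  by apply: IZ; [exact: ccontinuous_vcoef|exact: X1].
exact: tested_algebra2 e1 e2 e3 (mode_weak2 k).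
Qed.

End tested.

Lemma mode_sum_le z s t : inH z -> uniq s ->
  \sum_(k <- s) (abs2 (ucoef a c d r (fourier_coef z.1) (fourier_coef z.2) k t)
    + K * abs2 (vcoef a c d r (fourier_coef z.1) (fourier_coef z.2) k t)) <= sqnormH a c d z / (2 * pi).
Proof.
move=> zH us; rewrite ler_pdivlMr ?pi2_gt0// mulrC.
under eq_bigr do rewrite mode_conserved.
exact: sum_coef_le.
Qed.

Section existence.
Variable z : @state R.
Hypothesis zH : inH z.
Let x := fourier_coef z.1.
Let y := fourier_coef z.2.
Let uc := ucoef a c d r x y.
Let vc := vcoef a c d r x y.
(** The energy of the data beyond the modes |k| <= n. Since each mode conserves its energy, it is
    also the energy of the tail at every time: this is where uniformity in time comes from. *)
Let tau n := sqnormH a c d z - 2 * pi * \sum_(k <- ints n n) (abs2 (x k) + K * abs2 (y k)).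

Let K0 : 0 < K. Proof. exact: acd_gt0. Qed.

Let tau0 : tau n @[n --> \oo] --> (0 : R).
Proof.
rewrite -[X in _ --> X](subrr (sqnormH a c d z)).
by apply: cvgB; [exact: cvg_cst|exact: parsevalH].
Qed.

Variables U V : R -> R -> C.
Hypothesis UL : forall t, L2 circle (U t).
Hypothesis VL : forall t, L2 circle (V t).
Hypothesis Uc : forall t k, fourier_coef (U t) k = uc k t.
Hypothesis Vc : forall t k, fourier_coef (V t) k = vc k t.

Let wH t : inH (U t, V t). Proof. by split; [exact: UL|exact: VL]. Qed.

Let energyE t : sqnormH a c d (U t, V t) = sqnormH a c d z.
Proof. by apply: sqnormH_coef => // k; rewrite /= Uc Vc mode_conserved. Qed.

Let tailE n t : nrm2 circle (fun s => U t s - fsum (ints n n) (fourier_coef (U t)) s) +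
  K * nrm2 circle (fun s => V t s - fsum (ints n n) (fourier_coef (V t)) s) = tau n.
Proof.
rewrite !nrm2_sub_fsum ?ints_uniq// /tau -(energyE t) sqnormHE//=.
have -> : \sum_(k <- ints n n) (abs2 (x k) + K * abs2 (y k)) =
  \sum_(k <- ints n n) abs2 (fourier_coef (U t) k) + K * \sum_(k <- ints n n) abs2 (fourier_coef (V t) k).
  rewrite mulr_sumr -big_split; apply: eq_bigr => k _.
  by rewrite Uc Vc; exact/esym/mode_conserved.
by ring.
Qed.

Let Utail n t : nrm2 circle (fun s => U t s - fsum (ints n n) (fourier_coef (U t)) s) <= tau n.
Proof. by rewrite -(tailE n t) lerDl mulr_ge0 ?nrm2_ge0// ltW. Qed.

Let Vtail n t : nrm2 circle (fun s => V t s - fsum (ints n n) (fourier_coef (V t)) s) <= K^-1 * tau n.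
Proof. by rewrite -ler_pdivrMl ?invr_gt0// invrK -(tailE n t) lerDr nrm2_ge0. Qed.

Let tau0' : K^-1 * tau n @[n --> \oo] --> (0 : R).
Proof. by rewrite -[X in _ --> X](mulr0 K^-1); apply: cvgMr. Qed.

Let cU k : ccontinuous (fun t => fourier_coef (U t) k).
Proof. by under eq_fun do rewrite Uc; exact: ccontinuous_ucoef. Qed.

Let cV k : ccontinuous (fun t => fourier_coef (V t) k).
Proof. by under eq_fun do rewrite Vc; exact: ccontinuous_vcoef. Qed.

Lemma modes_inCb : inCb a c d (fun t => (U t, V t)).
Proof.
split => //.
- move=> t; have h1 := nrm2_tails_continuous UL cU Utail tau0 t.
  have h2 := nrm2_tails_continuous VL cV Vtail tau0' t.
  have : sqnormH a c d (subH (U s, V s) (U t, V t)) @[s --> t] --> (0 : R).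
    have -> : (fun s => sqnormH a c d (subH (U s, V s) (U t, V t))) =
       (fun s => nrm2 circle (fun p => U s p - U t p) + K * nrm2 circle (fun p => V s p - V t p)).
      by apply/funext => s; rewrite sqnormHE//; exact: inH_sub.
    rewrite -[X in _ --> X](addr0 (0 : R)) -[X in _ --> _ + X](mulr0 K).
    by apply: cvgD => //; exact: cvgMr.
  move=> h; have := cvg_comp _ _ h (@sqrt_continuous R 0); rewrite sqrtr0; exact.
- exists (normH a c d z) => t; rewrite /normH energyE//.
Qed.

Let pairU (psi : R * R -> R) : test_function psi ->
  ccvg (fun n => \sum_(k <- ints n n) cintegral setT (fun t => uc k t * xint (fexp k) psi t)) (pairing U psi).
Proof.
move=> [sp _ [M hM]].
have := pairing_modes UL cU Utail tau0 (smooth_continuous sp) hM.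
apply: cvg_trans; apply: near_eq_cvg; near=> n; congr (abs2 (_ - _)).
by apply: eq_bigr => k _; apply: eq_cintegral => t _; rewrite Uc.
Unshelve. all: by end_near. Qed.

Let pairV (psi : R * R -> R) : test_function psi ->
  ccvg (fun n => \sum_(k <- ints n n) cintegral setT (fun t => vc k t * xint (fexp k) psi t)) (pairing V psi).
Proof.
move=> [sp _ [M hM]].
have := pairing_modes VL cV Vtail tau0' (smooth_continuous sp) hM.
apply: cvg_trans; apply: near_eq_cvg; near=> n; congr (abs2 (_ - _)).
by apply: eq_bigr => k _; apply: eq_cintegral => t _; rewrite Vc.
Unshelve. all: by end_near. Qed.

Lemma modes_weak1 phi : test_function phi -> dist_dt U phi + dist_dx 3 U phi + a%:C%C * dist_dx 3 V phi = 0.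
Proof.
move=> tphi; have t3 : test_function (iter 3 dx phi) by do 3 apply: test_dx.
have := ccvgD (ccvgD (ccvgZ (-1) (pairU (test_dt tphi))) (ccvgZ ((-1) ^+ 3) (pairU t3)))
  (ccvgZ a%:C%C (ccvgZ ((-1) ^+ 3) (pairV t3))).
rewrite mulN1r => h; apply: (ccvg_zero _ h) => n {h}.
rewrite !mulr_sumr -!big_split /= big1// => k _.
exact: tested_mode1.
Qed.

Lemma modes_weak2 phi : test_function phi -> c%:C%C * dist_dt V phi + r%:C%C * dist_dx 1 V phi + dist_dx 3 V phi
  + d%:C%C * dist_dx 3 U phi = 0.
Proof.
move=> tphi; have t3 : test_function (iter 3 dx phi) by do 3 apply: test_dx.
have t1 : test_function (iter 1 dx phi) by exact: test_dx.
have h := ccvgD (ccvgD (ccvgD (ccvgZ c%:C%C (ccvgZ (-1) (pairV (test_dt tphi))))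
   (ccvgZ r%:C%C (ccvgZ ((-1) ^+ 1) (pairV t1)))) (ccvgZ ((-1) ^+ 3) (pairV t3)))
  (ccvgZ d%:C%C (ccvgZ ((-1) ^+ 3) (pairU t3))).
have E : - pairing V (dt phi) = -1 * pairing V (dt phi) by rewrite mulN1r.
rewrite /dist_dt E /dist_dx; apply: (ccvg_zero _ h) => n {h E}.
rewrite sum_comb4 big1// => k _; exact: tested_mode2.
Qed.


Lemma modes_solution : solution a c d r z (fun t => (U t, V t)).
Proof.
split; [exact: modes_inCb|exact: modes_weak1|exact: modes_weak2|].
apply: eqH_coef => // k /=; first by rewrite Uc /uc ucoef0.
by rewrite Vc /vc vcoef0.
Qed.

End existence.
(** At each time separately the prescribed coefficients are square summable, by conservation of
    energy, and Riesz-Fischer with choice provides functions having them; [modes_solution] accepts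
    any such representatives. *)
Lemma solution_exists z : inH z -> exists w, solution a c d r z w.
Proof.
move=> zH; have K0 := acd_gt0 a0 c0 d0.
have bu t s : uniq s -> \sum_(k <- s) abs2 (ucoef a c d r (fourier_coef z.1) (fourier_coef z.2) k t)
    <= sqnormH a c d z / (2 * pi).
  move=> us; apply: le_trans (mode_sum_le t zH us); apply: ler_sum => k _.
  by rewrite lerDl mulr_ge0 ?abs2_ge0// ltW.
have bv t s : uniq s -> \sum_(k <- s) abs2 (vcoef a c d r (fourier_coef z.1) (fourier_coef z.2) k t)
    <= K^-1 * (sqnormH a c d z / (2 * pi)).
  move=> us; rewrite -ler_pdivrMl ?invr_gt0// invrK mulr_sumr; apply: le_trans (mode_sum_le t zH us).
  by apply: ler_sum => k _; rewrite lerDr abs2_ge0.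
have [U hU] := choice (fun t => riesz_fischer (bu t)).
have [V hV] := choice (fun t => riesz_fischer (bv t)).
exists (fun t => (U t, V t)); apply: (@modes_solution _ zH).
- by move=> t; have [] := hU t.
- by move=> t; have [] := hV t.
- by move=> t; have [] := hU t.
- by move=> t; have [] := hV t.
Qed.

Lemma ucoef_lin (q : C) x y x' y' x'' y'' k t :
  x'' k = q * x k + x' k -> y'' k = q * y k + y' k ->
  ucoef a c d r x'' y'' k t = q * ucoef a c d r x y k t + ucoef a c d r x' y' k t.
Proof. by move=> hx hy; rewrite /ucoef /amp1 hx hy; case: eqP => _ /=; ring. Qed.

Lemma vcoef_lin (q : C) x y x' y' x'' y'' k t :
  x'' k = q * x k + x' k -> y'' k = q * y k + y' k ->
  vcoef a c d r x'' y'' k t = q * vcoef a c d r x y k t + vcoef a c d r x' y' k t.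
Proof. by move=> hx hy; rewrite /vcoef /amp2 /amp1 hx hy; case: eqP => _ /=; ring. Qed.

(** Uniqueness and linearity are read off the coefficients. The solution map is an isometry: the
    difference of two solutions has the coefficients evolved from the difference of the data, hence
    constant norm, and delta = epsilon works. *)
Lemma well_posed_holds : well_posed a c d r.
Proof.
have mC := @measurable_circle R.
have [S hS] : {S : @state R -> @trajectory R & forall z, inH z -> solution a c d r z (S z)}.
  (* Data outside H receive an arbitrary constant trajectory. *)
  apply: (@choice _ _ (fun z w => inH z -> solution a c d r z w)) => z; have [zH|nz] := pselect (inH z); last by exists (fun=> z).
  by have [w sw] := solution_exists zH; exists w.
have SH z t : inH z -> inH (S z t) by move=> /hS[[]].
have SC z t k (zH : inH z) := solution_coef a0 c0 d0 k zH (hS _ zH) t.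
exists S; split.
- move=> z zH; split; first exact: hS.
  move=> w sw t; have wH : inH (w t) by case: sw => -[].
  apply: eqH_coef; [exact: wH|exact: SH| |] => k;
    have [e1 e2] := solution_coef a0 c0 d0 k zH sw t; have [e1' e2'] := SC z t k zH.
    by rewrite e1 e1'.
  by rewrite e2 e2'.
- move=> q z z' zH z'H t.
  have cH (p p' : @state R) : inH p -> inH p' -> inH (combH q p p').
    by move=> [h1 h2] [h1' h2']; split; apply: L2D => //; exact: L2Z.
  have cf (f g : R -> C) k : L2 circle f -> L2 circle g ->
      fourier_coef (fun p => q * f p + g p) k = q * fourier_coef f k + fourier_coef g k.
    by move=> fL gL; rewrite fourier_coefD ?fourier_coefZ//; exact: L2Z.
  have [z1 z2] := zH; have [z1' z2'] := z'H.
  have [s1 s2] := SH z t zH; have [s1' s2'] := SH z' t z'H.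
  apply: eqH_coef; [by apply: SH; exact: cH|by apply: cH; exact: SH| |] => k.
    have [-> _] := SC (combH q z z') t k (cH _ _ zH z'H).
    rewrite /= cf//; have [-> _] := SC z t k zH; have [-> _] := SC z' t k z'H.
    by apply: ucoef_lin; rewrite /= cf.
  have [_ ->] := SC (combH q z z') t k (cH _ _ zH z'H).
  rewrite /= cf//; have [_ ->] := SC z t k zH; have [_ ->] := SC z' t k z'H.
  by apply: vcoef_lin; rewrite /= cf.
- move=> z zH e e0; exists e => // z' z'H; suff E : normCb a c d (fun t => subH (S z' t) (S z t)) = normH a c d (subH z' z).
    by rewrite E.
  have Et t : normH a c d (subH (S z' t) (S z t)) = normH a c d (subH z' z).
    congr Num.sqrt; apply: sqnormH_coef; [exact: inH_sub|by apply: inH_sub; exact: SH|] => k.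
    have [z1 z2] := zH; have [z1' z2'] := z'H.
    have [s1 s2] := SH z t zH; have [s1' s2'] := SH z' t z'H.
    rewrite /= !fourier_coefB//; have [-> ->] := SC z t k zH; have [-> ->] := SC z' t k z'H.
    rewrite -(mode_conserved (fun k => fourier_coef z'.1 k - fourier_coef z.1 k)
       (fun k => fourier_coef z'.2 k - fourier_coef z.2 k) k t).
    congr (abs2 _ + _ * abs2 _); apply/esym.
      by rewrite (ucoef_lin (q := -1) (x := fourier_coef z.1) (y := fourier_coef z.2) (x' := fourier_coef z'.1) (y' := fourier_coef z'.2)); [ring|ring|ring].
    by rewrite (vcoef_lin (q := -1) (x := fourier_coef z.1) (y := fourier_coef z.2) (x' := fourier_coef z'.1) (y' := fourier_coef z'.2)); [ring|ring|ring].
  have Er : range (fun t => normH a c d (subH (S z' t) (S z t))) = [set normH a c d (subH z' z)].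
    apply/seteqP; split => [_ [t _ <-]|_ ->]; first by rewrite Et.
    by exists 0.
  by rewrite /normCb Er sup1.
Qed.

End well_posedness_proof.

(** * Traces *)

Section modal_limits.
Context {R : realType}.
Local Notation mu := (@lebesgue_measure R).
Local Notation C := (R[i]).
Implicit Types (w : bool -> int -> R) (A : bool -> int -> C) (s : seq int).

Lemma nrm2_subset (D D' : set R) (f : R -> C) : measurable D -> measurable D' -> D' `<=` D ->
  L2 D f -> nrm2 D' f <= nrm2 D f.
Proof.
move=> mD mD' sub fL; have fL' := L2_subset mD' mD sub fL.
have [m1 m2 i] := fL; have [_ _ i'] := fL'.
rewrite /nrm2 /Rintegral fine_le ?(@integrable_fin_num _ _ _ mu)//.
apply: ge0_subset_integral => //; last by move=> x _; rewrite lee_fin abs2_ge0.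
by apply/measurable_EFinP; exact: measurable_abs2.
Qed.

Lemma modal_sub s1 s2 w A t : uniq s1 -> uniq s2 -> {subset s1 <= s2} ->
  modal s2 w A t - modal s1 w A t = modal [seq k <- s2 | k \notin s1] w A t.
Proof.
move=> u1 u2 sub; rewrite /modal /bsum big_filter.
by rewrite (big_uniq_split _ u1 u2 sub) [_ + _ - _]addrC addKr.
Qed.

Lemma mass_sub s1 s2 A : uniq s1 -> uniq s2 -> {subset s1 <= s2} ->
  mass s2 A - mass s1 A = mass [seq k <- s2 | k \notin s1] A.
Proof.
move=> u1 u2 sub; rewrite /mass /bsum big_filter.
by rewrite (big_uniq_split _ u1 u2 sub) [_ + _ - _]addrC addKr.
Qed.

Lemma mass_le s1 s2 A : uniq s1 -> uniq s2 -> {subset s1 <= s2} -> mass s1 A <= mass s2 A.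
Proof. by move=> u1 u2 sub; rewrite -subr_ge0 mass_sub// mass_ge0. Qed.

Lemma ints_cover s : exists N : nat, {subset s <= ints N N}.
Proof.
elim: s => [|k s [N hN]]; first by exists 0%N.
exists (maxn N `|k|%N) => m; rewrite inE => /orP[/eqP ->|/hN]; rewrite !mem_ints => *; lia.
Qed.

(** A finite set of modes nearly attains the supremum of the masses; beyond any symmetric range
    containing it, less than [e] is left, whatever the shape of the larger set. *)
Lemma mass_tail A (B e : R) : (forall s, uniq s -> mass s A <= B) -> 0 < e ->
  exists N0, forall N s, (N0 <= N)%N -> uniq s -> {subset ints N N <= s} ->
    mass s A - mass (ints N N) A <= e.
Proof.
move=> hB e0; pose E : set R := [set mass s A | s in [set s | uniq s]].
have hs : has_sup E.
  split; first by exists (mass [::] A); exists [::].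
  by exists B => _ [s us <-]; exact: hB.
have [_ [s0 us0 <-] h0] := sup_adherent e0 hs; have [N0 hN0] := ints_cover s0.
exists N0 => N s NN us _.
have h1 : mass s A <= sup E by apply: ub_le_sup; [case: hs|exists s].
have sub : {subset s0 <= ints N N} by move=> k /hN0; exact: ints_subset.
have := mass_le A us0 (ints_uniq N N) sub; lra.
Qed.

Lemma L2_modal s w A (p q : R) : L2 `[p, q]%classic (modal s w A).
Proof. by apply: ccontinuous_L2; exact: ccontinuous_modal. Qed.

Lemma small_product (b e x : R) : 0 < b -> x <= e / (4 * b) -> b * x <= e / 4.
Proof.
move=> b0 h; apply: (le_trans (ler_wpM2l (ltW b0) h)).
by rewrite le_eqVlt; apply/orP; left; apply/eqP; field; rewrite gt_eqF.
Qed.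

(** The upper inequality turns small mass into small norm on a bounded interval, so symmetric sums
    are Cauchy on each of them and have a common limit. Ranges with independent ends, as [is_trace]
    demands, are compared with a symmetric range inside them. *)
Lemma modal_limit w A (B : R) : gapped (w true) -> gapped (w false) ->
  (forall s, uniq s -> mass s A <= B) ->
  exists g, forall p q : R, L2 `[p, q]%classic g /\
    forall e, 0 < e -> exists N, forall m n, (N <= m)%N -> (N <= n)%N ->
      nrm2 `[p, q]%classic (fun t => modal (ints m n) w A t - g t) <= e.
Proof.
move=> g1 g2 hB.
pose F n := modal (ints n n) w A.
(* The successor keeps the interval non-degenerate at j = 0, as the upper inequality requires. *)
pose D (j : nat) : set R := `[- j.+1%:R, j.+1%:R]%classic.
have mD j : measurable (D j) by exact: measurable_itv.
have tail (p q e : R) : p < q -> 0 < e -> exists N0, forall N m n, (N0 <= N)%N -> (N <= m)%N -> (N <= n)%N ->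
    nrm2 `[p, q]%classic (fun t => modal (ints m n) w A t - F N t) <= e / 4.
  move=> pq e0; have [b b0 hb] := modal_upper g1 g2 pq.
  have [|N0 hN0] := @mass_tail A B (e / (4 * b)) hB; first by rewrite divr_gt0// mulr_gt0.
  exists N0 => N m n NN Nm Nn; have sub := ints_subset Nm Nn.
  rewrite (_ : nrm2 _ _ = nrm2 `[p, q]%classic (modal [seq k <- ints m n | k \notin ints N N] w A)).
    apply: (le_trans (hb _ _ (filter_uniq _ (ints_uniq m n)))).
    apply: (small_product b0); rewrite -mass_sub ?ints_uniq//.
    by apply: hN0 => //; exact: ints_uniq.
  by apply: eq_Rintegral => t _; rewrite /F modal_sub ?ints_uniq.
have Dlt j : - j.+1%:R < j.+1%:R :> R by have := ltr0Sn R j; lra.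
have [g hg] : exists g, forall j, L2 (D j) g /\ nrm2 (D j) (fun x => F n x - g x) @[n --> \oo] --> 0.
  apply: L2_complete => //.
  - by move=> j; rewrite /D lebesgue_measure_itv /=; case: ifP => _; rewrite -?EFinB ltry.
  - move=> i j ij t; rewrite /D /= !in_itv /= => /andP[h1 h2].
    have ij' : i.+1%:R <= j.+1%:R :> R by rewrite ler_nat.
    by apply/andP; split; lra.
  - by move=> n j; exact: L2_modal.
  - move=> j e e0; have [N0 hN0] := tail _ _ e (Dlt j) e0; exists N0 => n m Nn Nm.
    have L1 := L2B (mD j) (L2_modal (ints n n) w A _ _) (L2_modal (ints N0 N0) w A _ _).
    have L2' := L2B (mD j) (L2_modal (ints N0 N0) w A _ _) (L2_modal (ints m m) w A _ _).
    have := nrm2D_le (mD j) L1 L2'.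
    have h1 := hN0 N0 n n (leqnn _) Nn Nn; have h2 := hN0 N0 m m (leqnn _) Nm Nm.
    rewrite (nrm2B_sym _ (modal (ints N0 N0) w A)).
    rewrite (_ : (fun x => _) = fun x => F n x - F m x); last by apply/funext => t; rewrite /F; ring.
    rewrite -/(F N0) -/(D j) in h1 h2 *; lra.
exists g => p q.
have [j [jp jq]] : exists j : nat, - j.+1%:R <= p /\ q <= j.+1%:R.
  exists (maxn (Num.bound `|p|) (Num.bound `|q|)).
  have h (x : R) M : (Num.bound `|x| <= M)%N -> `|x| <= M.+1%:R.
    move=> xM; apply: (le_trans (ltW (archi_boundP (normr_ge0 x)))).
    by rewrite ler_nat; exact: leq_trans xM _.
  have := h p _ (leq_maxl (Num.bound `|p|) (Num.bound `|q|)).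
  have := h q _ (leq_maxr (Num.bound `|p|) (Num.bound `|q|)).
  have := ler_norm (- p); have := ler_norm q; rewrite normrN => *; split; lra.
have sub : `[p, q]%classic `<=` D j.
  by move=> t; rewrite /D /= !in_itv /= => /andP[h1 h2]; apply/andP; split; lra.
have mI : measurable (`[p, q]%classic : set R) by exact: measurable_itv.
have [gL gc] := hg j; split; first exact: L2_subset gL.
move=> e e0; have [N0 hN0] := tail _ _ e (Dlt j) e0.
have e4 : 0 < e / 4 by rewrite divr_gt0.
have [N1 _ hN1] : \forall n \near \oo, nrm2 (D j) (fun x => F n x - g x) <= e / 4.
  move/cvgrPdist_le/(_ _ e4) : gc; apply: filterS => n; rewrite sub0r normrN; exact/le_trans/ler_norm.
pose N := maxn N0 N1; exists N => m n Nm Nn.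
have FL := L2_modal (ints N N) w A (- j.+1%:R) j.+1%:R; have mL := L2_modal (ints m n) w A (- j.+1%:R) j.+1%:R.
have L1 := L2B (mD j) mL FL; have L2' := L2B (mD j) FL gL.
have h1 := hN0 N m n (leq_maxl _ _) Nm Nn; have h2 := hN1 N (leq_maxr _ _).
have h3 := nrm2D_le (mD j) L1 L2'.
rewrite (_ : (fun x => _ + _) = fun x => modal (ints m n) w A x - g x) in h3; last by apply/funext => t; ring.
apply: (@le_trans _ _ (nrm2 (D j) (fun t => modal (ints m n) w A t - g t))).
  exact: nrm2_subset (L2B (mD j) mL gL).
apply: (le_trans h3); rewrite -/(F N) -/(D j) in h1 h2 *; lra.
Qed.

End modal_limits.

(** * Traces of solutions and the two-sided estimate *)

Section traces_proof.
Context {R : realType}.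
Local Notation mu := (@lebesgue_measure R).
Local Notation C := (R[i]).
Implicit Types (u : R -> R -> C) (g : R -> C) (s : seq int).

Lemma nrm2_EFin (D : set R) (f : R -> C) : measurable D -> L2 D f ->
  (\int[mu]_(t in D) (abs2 (f t))%:E)%E = (nrm2 D f)%:E.
Proof.
by move=> mD [_ _ i]; rewrite /nrm2 /Rintegral fineK//; exact: (@integrable_fin_num _ _ _ mu _ mD _ i).
Qed.

Lemma is_trace_intro u x0 g :
  (forall p q m n, L2 `[p, q]%classic (fourier_sum u m n x0)) ->
  (forall p q, L2 `[p, q]%classic g /\
    forall e, 0 < e -> exists N, forall m n, (N <= m)%N -> (N <= n)%N ->
      nrm2 `[p, q]%classic (fun t => fourier_sum u m n x0 t - g t) <= e) ->
  is_trace u x0 g.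
Proof.
move=> fL H p q; have [gL hg] := H p q; split => //.
have mI : measurable (`[p, q]%classic : set R) by exact: measurable_itv.
rewrite (_ : (fun mn : nat * nat => _) = fun mn : nat * nat => (nrm2 `[p, q]%classic (fun t => fourier_sum u mn.1 mn.2 x0 t - g t))%:E); last first.
  by apply/funext => mn; rewrite nrm2_EFin//; exact: L2B.
apply: cvg_EFin; first by near=> mn.
apply/cvgrPdist_le => e e0; have [N hN] := hg e e0.
exists ([set n | (N <= n)%N], [set n | (N <= n)%N]) => /=; first by split; exists N.
move=> [m n] /= [Nm Nn]; rewrite sub0r normrN ger0_norm ?nrm2_ge0//; exact: hN.
Unshelve. all: by end_near. Qed.

Lemma is_trace_diag u x0 g p q : is_trace u x0 g ->
  nrm2 `[p, q]%classic (fourier_sum u n n x0) @[n --> \oo] --> nrm2 `[p, q]%classic g.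
Proof.
move=> /(_ p q)[gL fL h].
have mI : measurable (`[p, q]%classic : set R) by exact: measurable_itv.
apply: nrm2_cvg => //.
have hd : ((n, n) : nat * nat) @[n --> \oo] --> (\oo, \oo) by apply: cvg_pair; exact: cvg_id.
apply: cvg_trans (fine_cvg (cvg_comp _ _ hd h)); apply: near_eq_cvg.
by near=> n; rewrite /= nrm2_EFin//; exact: L2B.
Unshelve. all: by end_near. Qed.

Variables (a c d r : R).
Hypotheses (a0 : 0 < a) (c0 : 0 < c) (d0 : 0 < d) (r0 : 0 < r).
Hypothesis NR : nonresonant a c d r.
Local Notation K := (a * c / d).

Let g1 : gapped (freq a c d r true). Proof. by apply: gapped_freq => //; case: NR. Qed.
Let g2 : gapped (freq a c d r false). Proof. by apply: gapped_freq => //; case: NR. Qed.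

Section one_solution.
Variables (z : @state R) (w : @trajectory R) (x0 : R).
Hypotheses (zH : inH z) (sol : solution a c d r z w).

(** The point [x0] enters only through a unimodular factor common to both components, so masses and
    admissibility are those of the original amplitudes. *)
Definition tamp1 (z : @state R) x0 b k : C := amp1 a c d r (fourier_coef z.1) (fourier_coef z.2) b k * fexp k x0.
Definition tamp2 (z : @state R) x0 b k : C := amp2 a c d r (fourier_coef z.1) (fourier_coef z.2) b k * fexp k x0.

Lemma fourier_sum_modal1 m n t : fourier_sum (fun t => (w t).1) m n x0 t =
  modal (ints m n) (freq a c d r) (tamp1 z x0) t.
Proof.
rewrite /fourier_sum (big_ints m n (fun k => fourier_coef (w t).1 k * expi (k%:~R * x0))).
apply: eq_bigr => k _; have [-> _] := solution_coef a0 c0 d0 k zH sol t.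
by rewrite /ucoef /tamp1 /fexp; ring.
Qed.

Lemma fourier_sum_modal2 m n t : fourier_sum (fun t => (w t).2) m n x0 t =
  modal (ints m n) (freq a c d r) (tamp2 z x0) t.
Proof.
rewrite /fourier_sum (big_ints m n (fun k => fourier_coef (w t).2 k * expi (k%:~R * x0))).
apply: eq_bigr => k _; have [_ ->] := solution_coef a0 c0 d0 k zH sol t.
by rewrite /vcoef /tamp2 /fexp; ring.
Qed.

(** The right side of [mode_energy] is the weighted mass of a mode, and its left side is evaluated
    at time 0. *)
Lemma mass_energy s : mass s (tamp1 z x0) + K * mass s (tamp2 z x0) =
  \sum_(k <- s) (abs2 (fourier_coef z.1 k) + K * abs2 (fourier_coef z.2 k)).
Proof.
rewrite /mass /bsum mulr_sumr -big_split; apply: eq_bigr => k _ /=.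
rewrite /tamp1 /tamp2 !abs2M !abs2_fexp !mulr1.
rewrite -(mode_energy r a0 c0 d0 (fourier_coef z.1) (fourier_coef z.2) k 0).
by rewrite ucoef0// vcoef0// -!abs2M.
Qed.

Let K0 : 0 < K. Proof. exact: acd_gt0. Qed.

Lemma mass_bound1 s : uniq s -> mass s (tamp1 z x0) <= sqnormH a c d z / (2 * pi).
Proof.
move=> us; rewrite ler_pdivlMr ?pi2_gt0// mulrC; apply: le_trans (sum_coef_le a0 c0 d0 zH us).
rewrite ler_wpM2l ?(ltW (@pi2_gt0 R))// -mass_energy lerDl mulr_ge0 ?mass_ge0//; exact: ltW.
Qed.

Lemma mass_bound2 s : uniq s -> mass s (tamp2 z x0) <= K^-1 * (sqnormH a c d z / (2 * pi)).
Proof.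
move=> us; rewrite -ler_pdivrMl ?invr_gt0// invrK ler_pdivlMr ?pi2_gt0// mulrC.
apply: le_trans (sum_coef_le a0 c0 d0 zH us).
by rewrite ler_wpM2l ?(ltW (@pi2_gt0 R))// -mass_energy lerDr mass_ge0.
Qed.

Lemma trace_exists1 : exists g, is_trace (fun t => (w t).1) x0 g.
Proof.
have E m n := funext (fourier_sum_modal1 m n).
have [g hg] := modal_limit g1 g2 mass_bound1; exists g; apply: is_trace_intro.
  by move=> p q m n; rewrite E; exact: L2_modal.
move=> p q; have [gL h] := hg p q; split => // e e0; have [N hN] := h e e0.
by exists N => m n Nm Nn; rewrite E; exact: hN.
Qed.

Lemma trace_exists2 : exists g, is_trace (fun t => (w t).2) x0 g.
Proof.
have E m n := funext (fourier_sum_modal2 m n).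
have [g hg] := modal_limit g1 g2 mass_bound2; exists g; apply: is_trace_intro.
  by move=> p q m n; rewrite E; exact: L2_modal.
move=> p q; have [gL h] := hg p q; split => // e e0; have [N hN] := h e e0.
by exists N => m n Nm Nn; rewrite E; exact: hN.
Qed.

Lemma tamp_admissible b k : admissible a c d r b k (tamp1 z x0 b k) (tamp2 z x0 b k).
Proof.
rewrite /admissible /tamp1 /tamp2.
case: (amp_admissible a c d r (fourier_coef z.1) (fourier_coef z.2) b k) => [->|->]; first by left.
by right; rewrite mulrA.
Qed.

Lemma tamp_off b k : ~~ allmodes b k -> tamp1 z x0 b k = 0 /\ tamp2 z x0 b k = 0.
Proof.
move=> /(amp_off a c d r (fourier_coef z.1) (fourier_coef z.2))[h1 h2].
by rewrite /tamp1 /tamp2 h1 h2 !mul0r.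
Qed.

End one_solution.

Lemma Rintegral_anybnd (b b' : bool) (t1 t2 : R) (f : R -> R) :
  mu.-integrable `[t1, t2]%classic (EFin \o f) ->
  \int[mu]_(t in [set` Interval (BSide b t1) (BSide b' t2)]) f t = \int[mu]_(t in `[t1, t2]) f t.
Proof.
move=> i; have sub x y : mu.-integrable [set` Interval (BSide x t1) (BSide y t2)] (EFin \o f).
  apply: (@integrableS _ _ _ mu `[t1, t2]%classic) => // t /=.
  by case: x; case: y; rewrite !in_itv /= => /andP[h1 h2]; apply/andP; split => //; exact: ltW.
transitivity (\int[mu]_(t in [set` Interval (BSide b t1) (BSide false t2)]) f t).
  by case: b'; rewrite // Rintegral_itv_bndo_bndc//; exact: sub.
by case: b; rewrite // Rintegral_itv_obnd_cbnd//; exact: sub.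
Qed.

Lemma mass_compare (M1 M2 E k p : R) : 0 < k -> 0 <= M1 -> 0 <= M2 -> M1 + k * M2 = E ->
  (1 + k)^-1 * E <= M1 + M2 /\ M1 + M2 <= (1 + k^-1) * E.
Proof.
move=> k0 h1 h2 <-; have k1 : 0 < 1 + k by rewrite addr_gt0.
split; first by rewrite ler_pdivrMl// !mulrDl !mulrDr !mul1r; have := mulr_ge0 (ltW k0) h1; lra.
have ki : 0 < k^-1 by rewrite invr_gt0.
have -> : (1 + k^-1) * (M1 + k * M2) = M1 + k * M2 + k^-1 * M1 + M2 by field; rewrite gt_eqF.
have := mulr_ge0 (ltW k0) h2; have := mulr_ge0 (ltW ki) h1; lra.
Qed.

Lemma cvg_between (S X : nat -> R) (p q l x : R) : (forall n, p * S n <= X n <= q * S n) ->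
  S n @[n --> \oo] --> l -> X n @[n --> \oo] --> x -> p * l <= x <= q * l.
Proof.
move=> h cS cX.
have cp : p * S n @[n --> \oo] --> p * l by apply: cvgM => //; exact: cvg_cst.
have cq : q * S n @[n --> \oo] --> q * l by apply: cvgM => //; exact: cvg_cst.
apply/andP; split.
  by apply: (ler_cvg_to cp cX); near=> n; have /andP[] := h n.
by apply: (ler_cvg_to cX cq); near=> n; have /andP[] := h n.
Unshelve. all: by end_near. Qed.

(** Both inequalities hold for the symmetric partial sums with constants independent of n. As n
    grows, the norms of the partial sums tend to those of the traces and [S] tends to the energy by
    Parseval. The factors in K pass from the weighted mass to the plain one, and 2 pi comes from
    Parseval. *)
Lemma trace_estimates (b b' : bool) (t1 t2 : R) : t1 < t2 ->
  let I : set R := [set` Interval (BSide b t1) (BSide b' t2)] in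
  exists alpha beta : R, [/\ 0 < alpha, 0 < beta &
    forall z w, inH z -> solution a c d r z w ->
    forall (x0 : R) (g h : R -> C),
      is_trace (fun t => (w t).1) x0 g -> is_trace (fun t => (w t).2) x0 h ->
    forall s : R,
      alpha * energy a c d w s <= \int[mu]_(t in I) (abs2 (g t) + abs2 (h t))
        <= beta * energy a c d w s].
Proof.
move=> t12 I; have K0 : 0 < K by exact: acd_gt0.
have p0 := @pi2_gt0 R.
have l0 : 0 < (t2 - t1) / 2 by rewrite divr_gt0// subr_gt0.
have lt : (t2 - t1) / 2 < t2 - t1 by rewrite ltr_pdivrMr// ltr_pMr// ?ltr1n// subr_gt0.
have [al al0 hal] := observable_spectrum a0 c0 d0 r0 NR l0 lt.
have [be be0 hbe] := modal_upper g1 g2 t12.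
have k1 : 0 < 1 + K by rewrite addr_gt0.
have k2 : 0 < 1 + K^-1 by rewrite addr_gt0// invr_gt0.
exists (al * ((1 + K)^-1 / (2 * pi))), (be * ((1 + K^-1) / (2 * pi))); split.
- by rewrite mulr_gt0// divr_gt0// invr_gt0.
- by rewrite mulr_gt0// divr_gt0.
move=> z w zH sol x0 g h tg th s.
have mI : measurable (`[t1, t2]%classic : set R) by exact: measurable_itv.
have [gL _ _] := tg t1 t2; have [hL _ _] := th t1 t2.
have [_ _ ig] := gL; have [_ _ ih] := hL.
rewrite (solution_energy a0 c0 d0 zH sol).
have -> : \int[mu]_(t in I) (abs2 (g t) + abs2 (h t)) = nrm2 `[t1, t2]%classic g + nrm2 `[t1, t2]%classic h.
  rewrite /I Rintegral_anybnd; first by rewrite RintegralD.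
  exact: integrableDR.
have cg := is_trace_diag (p := t1) (q := t2) tg; have ch := is_trace_diag (p := t1) (q := t2) th.
pose S n := 2 * pi * (\sum_(k <- ints n n) (abs2 (fourier_coef z.1 k) + K * abs2 (fourier_coef z.2 k))).
have cE : S n @[n --> \oo] --> sqnormH a c d z by exact: parsevalH.
have key n : al * ((1 + K)^-1 / (2 * pi)) * S n <=
    nrm2 `[t1, t2]%classic (fourier_sum (fun t => (w t).1) n n x0) + nrm2 `[t1, t2]%classic (fourier_sum (fun t => (w t).2) n n x0)
    <= be * ((1 + K^-1) / (2 * pi)) * S n.
  rewrite (funext (fourier_sum_modal1 x0 zH sol n n)) (funext (fourier_sum_modal2 x0 zH sol n n)).
  have us := ints_uniq n n.
  have L := hal _ _ _ us (fun b k _ => tamp_admissible z x0 b k) (fun b k => @tamp_off z x0 b k).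
  have U1 := hbe _ (tamp1 z x0) us; have U2 := hbe _ (tamp2 z x0) us.
  have [h1 h2] := mass_compare 0 K0 (mass_ge0 _ _) (mass_ge0 _ _) (mass_energy z x0 (ints n n)).
  set Q := \sum_(k <- _) _ in h1 h2 *.
  have SQ (p q : R) : p * (q / (2 * pi)) * S n = p * (q * Q).
    by rewrite /S -/Q -mulrA [_ * (_ * Q)]mulrA divfK// gt_eqF.
  rewrite !SQ; apply/andP; split.
    by apply: le_trans L; rewrite ler_wpM2l// ltW.
  apply: (le_trans (lerD U1 U2)); rewrite -mulrDr ler_wpM2l//; exact: ltW.
exact: cvg_between key cE (cvgD cg ch).
Qed.

End traces_proof.

(** * Resonant parameters *)

Section null_sets.
Context {R : realType}.
Local Notation mu := (@lebesgue_measure R).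

Lemma finite_roots (p : {poly R}) : p != 0 -> finite_set [set x | p.[x] = 0].
Proof.
have [n] := ubnP (size p); elim: n p => // n IH p sp p0.
have [[x0 /eqP px0]|no] := pselect (exists x, p.[x] = 0); last first.
  by rewrite (_ : [set x | _] = set0)//; apply/seteqP; split => // x px; case: no; exists x.
have /factor_theorem[q pq] : root p x0 by rewrite /root.
have q0 : q != 0 by apply: contraNneq p0 => q0; rewrite pq q0 mul0r.
have sq : (size q < n)%N.
  by move: sp; rewrite pq size_Mmonic ?monicXsubC// size_XsubC addn2 /= ltnS.
apply: (@sub_finite_set _ _ ([set x0] `|` [set x | q.[x] = 0])).
  move=> x /=; rewrite pq hornerM !hornerE => /eqP; rewrite mulf_eq0 subr_eq0 => /orP[/eqP|/eqP]; [by right|by left].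
by rewrite finite_setU; split; [exact: finite_set1|exact: IH].
Qed.

(** The product measure of the zero set is the integral of the measures of its slices in the last
    variable, and finite slices are null. *)
Lemma null_slices d (T : measurableType d) (m : {measure set T -> \bar R}) (f : T * R -> R) :
  measurable_fun setT f -> (forall x, finite_set [set y | f (x, y) = 0]) ->
  (m \x mu)%E.-negligible [set p | f p = 0].
Proof.
move=> mf fin; exists [set p | f p = 0]; split => //.
  by rewrite -[X in measurable X]setTI; exact: (mf measurableT [set 0] (measurable_set1 0)).
rewrite /product_measure1 (eq_integral (fun=> 0%E)) ?integral0// => x _ /=.
apply: countable_lebesgue_measure0; apply: finite_set_countable.
by rewrite (_ : xsection _ _ = [set y | f (x, y) = 0])//; apply/seteqP; split => y; rewrite /xsection /= inE.
Qed.

(** For the condition a d = 1, which does not involve the last parameter r. *)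
Lemma null_cylinder d (T : measurableType d) (m : {measure set T -> \bar R}) (A : set T) :
  m.-negligible A -> (m \x mu)%E.-negligible [set p | A p.1].
Proof.
move=> [B [mB B0 AB]]; exists (B `*` setT); split.
- exact: measurableX.
- by rewrite product_measure1E// B0 mul0e.
- by move=> p /= /AB.
Qed.

Lemma cubic_roots_finite (q0 q1 q2 q3 : R) : q3 != 0 ->
  finite_set [set x | q0 + q1 * x + q2 * x ^+ 2 + q3 * x ^+ 3 = 0].
Proof.
move=> h; pose p := q0%:P + q1 *: 'X + q2 *: 'X^2 + q3 *: 'X^3.
have p0 : p != 0.
  apply: contraNneq h => /(congr1 (fun p : {poly R} => p`_3)).
  by rewrite /p !coefE /= !mulr0 !add0r mulr1 => ->.
have := finite_roots p0; congr finite_set; apply/seteqP; split => x /=; rewrite /p !hornerE;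
  by move=> e; rewrite -[RHS]e; ring.
Qed.

Local Notation mu4 := (mu \x mu \x mu \x mu)%E.
Implicit Types p : (R * R * R * R)%type.

Lemma measurable_coordinates :
  [/\ measurable_fun setT (fun p => p.1.1.1), measurable_fun setT (fun p => p.1.1.2),
      measurable_fun setT (fun p => p.1.2) & measurable_fun setT (fun p => p.2)].
Proof.
have m1 : measurable_fun setT (fun p => p.1) by exact: measurable_fst.
have m2 : measurable_fun setT (fun p => p.1.1) by exact: (measurableT_comp measurable_fst m1).
split.
- exact: (measurableT_comp measurable_fst m2).
- exact: (measurableT_comp measurable_snd m2).
- exact: (measurableT_comp measurable_snd m1).
- exact: measurable_snd.
Qed.

Lemma ae_product_neq1 : {ae mu4, forall p, p.1.1.1 * p.1.2 != 1}.
Proof.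
pose f (q : R * R * R) := q.1.1 * q.2 - 1.
have mf : measurable_fun setT f.
  apply: measurable_funB; last exact: measurable_cst.
  apply: measurable_funM; last exact: measurable_snd.
  exact: (measurableT_comp measurable_fst measurable_fst).
have fin x : finite_set [set y | f (x, y) = 0].
  (* A polynomial in d with value -1 at 0, hence non-zero even when a = 0. *)
  have pn : x.1 *: 'X - 1 != 0 :> {poly R}.
    apply/eqP => /(congr1 (fun p : {poly R} => p.[0])); rewrite !hornerE ?mulr0 ?sub0r => /eqP.
    by rewrite oppr_eq0 oner_eq0.
  have := finite_roots pn; congr finite_set; apply/seteqP; split => y /=; by rewrite !hornerE.
have := @null_cylinder _ _ _ _ (@null_slices _ _ (mu \x mu)%E f mf fin).
by apply: negligibleS => p /= /negP; rewrite negbK => /eqP; rewrite /f => ->; rewrite subrr.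
Qed.

Lemma ae_quadratic_neq0 (m : int) :
  {ae mu4, forall p, (1 - p.1.1.1 * p.1.2) * m%:~R ^+ 2 - p.2 != 0}.
Proof.
have [ma mc md mr] := measurable_coordinates.
pose f p := (1 - p.1.1.1 * p.1.2) * m%:~R ^+ 2 - p.2.
have mf : measurable_fun setT f.
  apply: measurable_funB; last exact: mr.
  apply: measurable_funM; last exact: measurable_cst.
  apply: measurable_funB; first exact: measurable_cst.
  exact: measurable_funM.
have fin x : finite_set [set y | f (x, y) = 0].
  apply: (sub_finite_set _ (finite_set1 ((1 - x.1.1 * x.2) * m%:~R ^+ 2))).
  by move=> y /=; rewrite /f /= => /eqP; rewrite subr_eq0 => /eqP ->.
have := @null_slices _ _ (mu \x mu \x mu)%E f mf fin.
by apply: negligibleS => p /= /negP; rewrite negbK => /eqP.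
Qed.

Lemma resultant_lead_neq0 (x y : R) : x != 0 -> y != 0 -> x != y ->
  x * (x ^+ 4 - y ^+ 4) * (x - y) - x ^+ 4 * (x - y) ^+ 2 != 0.
Proof.
move=> x0 y0 xy.
have -> : x * (x ^+ 4 - y ^+ 4) * (x - y) - x ^+ 4 * (x - y) ^+ 2 =
  x * y * (x - y) * (x - y) * (x ^+ 2 + x * y + y ^+ 2) by ring.
have d0 : x - y != 0 by rewrite subr_eq0.
rewrite !mulf_neq0//; apply/lt0r_neq0.
have h1 : 0 < x ^+ 2 by rewrite exprn_even_gt0.
have h2 : 0 < y ^+ 2 by rewrite exprn_even_gt0.
have := sqr_ge0 (x + y); lra.
Qed.

(* The resultant of two characteristic equations is a cubic polynomial in r whose
   leading coefficient k m (k - m) (k^3 - m^3) does not depend on a, c, d. *)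
Lemma ae_resultant_neq0 (k m : int) : k != 0 -> m != 0 -> k != m ->
  {ae mu4, forall p, let a := p.1.1.1 in let c := p.1.1.2 in let d := p.1.2 in let r := p.2 in
    c * (dt2 a d r k - dt2 a d r m) ^+ 2
      - tr c r k * (dt2 a d r k - dt2 a d r m) * (tr c r k - tr c r m)
      + dt2 a d r k * (tr c r k - tr c r m) ^+ 2 != 0}.
Proof.
move=> k0 m0 km; have [ma mc md mr] := measurable_coordinates.
pose T (n : int) p := tr p.1.1.2 p.2 n; pose D (n : int) p := dt2 p.1.1.1 p.1.2 p.2 n.
pose f p := p.1.1.2 * (D k p - D m p) ^+ 2 - T k p * (D k p - D m p) * (T k p - T m p)
   + D k p * (T k p - T m p) ^+ 2.
have mT n : measurable_fun setT (T n).
  apply: measurable_funB; apply: measurable_funM => //; try exact: measurable_cst.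
  by apply: measurable_funD => //; exact: measurable_cst.
have mD n : measurable_fun setT (D n).
  apply: measurable_funB; apply: measurable_funM => //; try exact: measurable_cst.
  by apply: measurable_funB; [exact: measurable_cst|exact: measurable_funM].
have mDD : measurable_fun setT (fun p => D k p - D m p) by exact: measurable_funB.
have mTT : measurable_fun setT (fun p => T k p - T m p) by exact: measurable_funB.
have mf : measurable_fun setT f.
  apply: measurable_funD; last by apply: measurable_funM => //; exact: measurable_funX.
  apply: measurable_funB; last by do 2 apply: measurable_funM => //.
  by apply: measurable_funM => //; exact: measurable_funX.
have fin x : finite_set [set y | f (x, y) = 0].
  pose kk : R := k%:~R; pose mm : R := m%:~R; pose c := x.1.2; pose al := 1 - x.1.1 * x.2; pose be := c + 1.
  pose P := kk ^+ 6 - mm ^+ 6; pose Q := kk ^+ 4 - mm ^+ 4; pose S := kk ^+ 3 - mm ^+ 3; pose U := kk - mm.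
  have lead : kk * Q * U - kk ^+ 4 * U ^+ 2 != 0.
    by apply: resultant_lead_neq0; rewrite ?intr_eq0// (inj_eq intr_inj).
  (* The coefficients of 1, r and r^2 in the expansion of the resultant; [lead] says that the
     coefficient of r^3 is non-zero. *)
  have := @cubic_roots_finite
    (c * al ^+ 2 * P ^+ 2 - be * kk ^+ 3 * (al * P) * (be * S) + al * kk ^+ 6 * (be * S) ^+ 2)
    (- 2 * c * al * P * Q + be * kk ^+ 3 * al * P * U + (be * kk ^+ 3 * Q + kk * al * P) * be * S
      - 2 * al * kk ^+ 6 * be * S * U - kk ^+ 4 * (be * S) ^+ 2)
    (c * Q ^+ 2 - (be * kk ^+ 3 * Q + kk * al * P) * U - kk * Q * be * S
      + al * kk ^+ 6 * U ^+ 2 + 2 * kk ^+ 4 * be * S * U) _ lead.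
  congr finite_set; apply/seteqP; split => y /= e; rewrite -[RHS]e /f /T /D /tr /dt2 /= -/kk -/mm -/c /P /Q /S /U /be /al /c; ring.
have := @null_slices _ _ (mu \x mu \x mu)%E f mf fin.
by apply: negligibleS => p /= /negP; rewrite negbK => /eqP.
Qed.

(** Countable intersections are indexed by natural numbers, so n and - n are treated together. *)
Lemma ae_int (Q : int -> (R * R * R * R)%type -> Prop) : (forall k, {ae mu4, forall p, Q k p}) ->
  {ae mu4, forall p, forall k, Q k p}.
Proof.
move=> H; have : {ae mu4, forall p, forall n : nat, Q n%:Z p /\ Q (- n%:Z) p}.
  apply: ae_foralln => n.
  exact: (@filterI _ _ (ae_filter_ringOfSetsType mu4) _ _ (H n%:Z) (H (- n%:Z))).
apply: (@filterS _ _ (ae_filter_ringOfSetsType mu4)) => p h k.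
by have [h1 h2] := h `|k|%N; case: (intP k) h1 h2 => [|n|n].
Qed.

Lemma ae_nonresonant :
  {ae mu4, forall p, nonresonant p.1.1.1 p.1.1.2 p.1.2 p.2}.
Proof.
have F := ae_filter_ringOfSetsType mu4.
have h2 : {ae mu4, forall p, forall m : int, m != 0 -> (1 - p.1.1.1 * p.1.2) * m%:~R ^+ 2 - p.2 != 0}.
  apply: ae_int => m; apply: (@filterS _ _ F _ _ _ (ae_quadratic_neq0 m)) => p h _; exact: h.
have h3 : {ae mu4, forall p, forall k m : int, k != 0 -> m != 0 -> k != m ->
    let a := p.1.1.1 in let c := p.1.1.2 in let d := p.1.2 in let r := p.2 in
    c * (dt2 a d r k - dt2 a d r m) ^+ 2
      - tr c r k * (dt2 a d r k - dt2 a d r m) * (tr c r k - tr c r m)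
      + dt2 a d r k * (tr c r k - tr c r m) ^+ 2 != 0}.
  apply: ae_int => k; apply: ae_int => m.
  have [k0|k0] := eqVneq k 0; first by apply: (@filterE _ _ F).
  have [m0|m0] := eqVneq m 0; first by apply: (@filterE _ _ F).
  have [km|km] := eqVneq k m; first by apply: (@filterE _ _ F).
  by apply: (@filterS _ _ F _ _ _ (ae_resultant_neq0 k0 m0 km)) => p h _ _ _; exact: h.
have := @filterI _ _ F _ _ ae_product_neq1 (@filterI _ _ F _ _ h2 h3).
by apply: (@filterS _ _ F) => p [e1 [e2 e3]]; split.
Qed.

End null_sets.

Theorem theorem1p2 (R : realType) :
  {ae (@lebesgue_measure R \x @lebesgue_measure R \x @lebesgue_measure R
        \x @lebesgue_measure R)%E,
    forall p : R * R * R * R,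
    let a := p.1.1.1 in let c := p.1.1.2 in let d := p.1.2 in let r := p.2 in
    0 < a -> 0 < c -> 0 < d -> 0 < r ->
    [/\ well_posed a c d r,
        forall z w, inH z -> solution a c d r z w ->
          forall s t, energy a c d w s = energy a c d w t,
        forall z w, inH z -> solution a c d r z w -> forall x0 : R,
          (exists g, is_trace (fun t => (w t).1) x0 g) /\
          (exists h, is_trace (fun t => (w t).2) x0 h)
      & forall (b b' : bool) (t1 t2 : R), t1 < t2 ->
          let I : set R := [set` Interval (BSide b t1) (BSide b' t2)] in
          exists alpha beta : R, [/\ 0 < alpha, 0 < beta &
            forall z w, inH z -> solution a c d r z w ->
            forall (x0 : R) (g h : R -> complex R),
              is_trace (fun t => (w t).1) x0 g ->
              is_trace (fun t => (w t).2) x0 h ->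
            forall s : R,
              alpha * energy a c d w s
                <= \int[@lebesgue_measure R]_(t in I) (abs2 (g t) + abs2 (h t))
                <= beta * energy a c d w s]]}.
Proof.
apply: (@filterS _ _ (ae_filter_ringOfSetsType _) _ _ _ (@ae_nonresonant R)).
move=> p NR a0 c0 d0 r0; split.
- exact: well_posed_holds.
- by move=> z w zH sol s t; rewrite !(solution_energy a0 c0 d0 zH sol).
- move=> z w zH sol x0; split.
    exact: (trace_exists1 a0 c0 d0 r0 NR x0 zH sol).
  exact: (trace_exists2 a0 c0 d0 r0 NR x0 zH sol).
- by move=> b b' t1 t2 t12; exact: (trace_estimates a0 c0 d0 r0 NR b b' t12).
Qed.
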